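(* Let $S$ be a non-zero, positive trace-class operator on $L^2(\mathbb{R}_+)$. Then $S$ is admissible if and only if $S\star_{\mathrm{Aff}}S\in L^1_r(\mathrm{Aff})$.
   Context: $\mathrm{Aff}=\mathbb{R}\times\mathbb{R}_+$, $\mathbb{R}_+=(0,\infty)$, is the affine group with $(x,a)\cdot(y,b)=(ay+x,ab)$; $L^1_r(\mathrm{Aff})=L^1(\mathrm{Aff},a^{-1}dx\,da)$. $L^2(\mathbb{R}_+)=L^2(\mathbb{R}_+,r^{-1}dr)$, with unitary representation $U(x,a)\psi(r)=e^{2\pi i xr}\psi(ar)$. For $S$ trace-class and $T$ bounded, $S\star_{\mathrm{Aff}}T(x,a)=\mathrm{tr}(SU(-x,a)^*TU(-x,a))$. ''Positive'' means positive semi-definite. $\mathcal{D}\psi(r)=r^{1/2}\psi(r)$ and $\mathcal{D}^{-1}\psi(r)=r^{-1/2}\psi(r)$ are the (unbounded, positive self-adjoint) multiplication operators on $L^2(\mathbb{R}_+)$ with their maximal domains. A non-zero bounded operator $S$ on $L^2(\mathbb{R}_+)$ mapping $\mathrm{dom}(\mathcal{D})$ into $\mathrm{dom}(\mathcal{D}^{-1})$ is admissible if $\mathcal{D}^{-1}S\mathcal{D}^{-1}$ is bounded on $\mathrm{dom}(\mathcal{D}^{-1})$ and extends to a trace-class operator on $L^2(\mathbb{R}_+)$. (In particular, being admissible includes mapping $\mathrm{dom}(\mathcal{D})$ into $\mathrm{dom}(\mathcal{D}^{-1})$.) *)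

(* Defs.v *)
From HB Require Import structures.
From mathcomp Require Import all_boot all_order all_algebra.
From mathcomp Require Import complex ring.
From mathcomp Require Import all_classical all_reals all_analysis.
From mathcomp Require Import measurable_realfun.
Import numFieldNormedType.Exports.

Set Implicit Arguments.
Unset Strict Implicit.
Unset Printing Implicit Defensive.
Import Order.TTheory GRing.Theory Num.Theory.
Local Open Scope classical_set_scope.
Local Open Scope ring_scope.
Local Open Scope quotient_scope.

Definition cmeasurable d (T : measurableType d) (R : realType)
    (D : set T) (f : T -> R[i]) : Prop :=
  measurable_fun D (fun x => complex.Re (f x)) /\
  measurable_fun D (fun x => complex.Im (f x)).

Definition square_integrable d (T : measurableType d) (R : realType)
    (mu : {measure set T -> \bar R}) (f : T -> R[i]) : Prop :=
  cmeasurable [set: T] f /\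
  (\int[mu]_x ((Normc.normc (f x)) ^+ 2)%:E < +oo)%E.

Definition sqint d (T : measurableType d) (R : realType)
    (mu : {measure set T -> \bar R}) : pred (T -> R[i]) :=
  fun f => `[< square_integrable mu f >].

Section sqint_submod.
Context d (T : measurableType d) (R : realType).
Variable mu : {measure set T -> \bar R}.

Let normcE (z : R[i]) :
  Normc.normc z ^+ 2 = complex.Re z ^+ 2 + complex.Im z ^+ 2.
Proof. by case: z => a b; rewrite /= sqr_sqrtr// addr_ge0// sqr_ge0. Qed.

Let normcD2 (z w : R[i]) : Normc.normc (z + w) ^+ 2 <=
  2 * Normc.normc z ^+ 2 + 2 * Normc.normc w ^+ 2.
Proof.
rewrite !normcE; case: z w => a b [c e] /=.
have := sqr_ge0 (a - c); have := sqr_ge0 (b - e).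
rewrite !sqrrB !sqrrD => h1 h2.
rewrite -subr_ge0; apply: le_trans (addr_ge0 h1 h2) _.
by rewrite le_eqVlt; apply/orP; left; apply/eqP; ring.
Qed.

Let cmeasurableD f g : cmeasurable [set: T] f -> cmeasurable [set: T] g ->
  cmeasurable [set: T] (f + g : T -> R[i]).
Proof.
move=> [f1 f2] [g1 g2]; split.
- rewrite (_ : (fun _ => _) =
    (fun x => complex.Re (f x)) \+ (fun x => complex.Re (g x))).
    exact: measurable_funD.
  by apply/funext => x; rewrite /= addrfctE; case: (f x); case: (g x).
- rewrite (_ : (fun _ => _) =
    (fun x => complex.Im (f x)) \+ (fun x => complex.Im (g x))).
    exact: measurable_funD.
  by apply/funext => x; rewrite /= addrfctE; case: (f x); case: (g x).
Qed.

Let cmeasurableZ (a : R[i]) f : cmeasurable [set: T] f ->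
  cmeasurable [set: T] (a *: f : T -> R[i]).
Proof.
case: a => a b [f1 f2]; split.
- rewrite (_ : (fun _ => _) = (fun x => a * complex.Re (f x)) \-
    (fun x => b * complex.Im (f x))).
    by apply: measurable_funB; apply: measurable_funM.
  by apply/funext => x; rewrite /= scalrfctE; case: (f x).
- rewrite (_ : (fun _ => _) = (fun x => a * complex.Im (f x)) \+
    (fun x => b * complex.Re (f x))).
    by apply: measurable_funD; apply: measurable_funM.
  by apply/funext => x; rewrite /= scalrfctE; case: (f x).
Qed.

Let measurable_normc2 (f : T -> R[i]) : cmeasurable [set: T] f ->
  measurable_fun [set: T] (fun x => (Normc.normc (f x) ^+ 2)%:E).
Proof.
move=> [f1 f2]; apply/measurable_EFinP.
under eq_fun do rewrite normcE.
by apply: measurable_funD; apply: measurable_funX.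
Qed.

Fact sqint_submod_closed : submod_closed (sqint mu).
Proof.
split=> [|a f g]; rewrite !unfold_in /sqint.
  apply/asboolP; split.
    by split; rewrite /= (_ : (fun _ => _) = cst 0)//; exact: measurable_cst.
  rewrite (eq_integral (cst 0%E)) ?integral0// => x _.
  by rewrite fctE normcE /= expr0n addr0.
move=> /asboolP[mf If] /asboolP[mg Ig]; apply/asboolP.
have maf := cmeasurableZ a mf.
split; first exact: cmeasurableD.
pose F x := ((2 * Normc.normc a ^+ 2)%:E * (Normc.normc (f x) ^+ 2)%:E)%E.
pose G x := ((2 : R)%:E * (Normc.normc (g x) ^+ 2)%:E)%E.
have n2 (z : R[i]) : (0 <= (Normc.normc z ^+ 2)%:E)%E by rewrite lee_fin sqr_ge0.
have c0 : 0 <= 2 * Normc.normc a ^+ 2 by rewrite mulr_ge0// sqr_ge0.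
apply: (@le_lt_trans _ _ (\int[mu]_x (F x + G x))%E).
  apply: ge0_le_integral => //.
  - exact/measurable_normc2/cmeasurableD.
  - by apply: emeasurable_funD; apply: emeasurable_funM => //;
      exact: measurable_normc2.
  - move=> x _; rewrite /F /G -!EFinM -EFinD lee_fin.
    apply: le_trans (normcD2 _ _) _.
    by rewrite fctE Normc.normcM exprMn mulrA.
rewrite ge0_integralD//; last 4 first.
- by move=> x _; rewrite mule_ge0// lee_fin.
- by apply: emeasurable_funM => //; exact: measurable_normc2.
- by move=> x _; rewrite mule_ge0// lee_fin.
- by apply: emeasurable_funM => //; exact: measurable_normc2.
rewrite ge0_integralZl//; [|exact: measurable_normc2].
rewrite ge0_integralZl//; [|exact: measurable_normc2].
by rewrite lte_add_pinfty// lte_mul_pinfty// lee_fin.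
Qed.

HB.instance Definition _ := GRing.isSubmodClosed.Build R[i] (T -> R[i])
  (sqint mu) sqint_submod_closed.

Record L2fun := MkL2fun { l2val :> T -> R[i] ; _ : l2val \in sqint mu }.
HB.instance Definition _ := [isSub for l2val].
HB.instance Definition _ := [Choice of L2fun by <:].
HB.instance Definition _ := [SubChoice_isSubLmodule of L2fun by <:].

Definition l2null : {pred L2fun} :=
  fun f => `[< {ae mu, forall x, f x = 0} >].

Fact l2null_submod_closed : submod_closed l2null.
Proof.
split=> [|a f g]; rewrite !unfold_in /l2null.
  by apply/asboolP; exact: aeW.
move=> /asboolP f0 /asboolP g0; apply/asboolP.
apply: filterS2 f0 g0 => x fx gx.
by rewrite /= addrfctE scalrfctE fx gx scaler0 addr0.
Qed.

HB.instance Definition _ := GRing.isSubmodClosed.Build R[i] L2fun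
  l2null l2null_submod_closed.
End sqint_submod.

Definition L2 d (T : measurableType d) (R : realType)
  (mu : {measure set T -> \bar R}) := Quotient.quot (@l2null d T R mu).

Section L2_lmod.
Context d (T : measurableType d) (R : realType).
Variable mu : {measure set T -> \bar R}.

HB.instance Definition _ := GRing.Zmodule.on (L2 mu).
HB.instance Definition _ := EqQuotient.on (L2 mu).

Definition l2scale (a : R[i]) (u : L2 mu) : L2 mu :=
  \pi_(L2 mu) (a *: repr u).

Let piB (f g : L2fun mu) : l2null (f - g) -> \pi_(L2 mu) f = \pi_(L2 mu) g.
Proof. by move=> fg; apply/eqP; rewrite -Quotient.idealrBE. Qed.

Let reprB (f : L2fun mu) : l2null (f - repr (\pi_(L2 mu) f)).
Proof.
suff : f - repr (\pi_(L2 mu) f) \in @l2null d T R mu by [].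
by rewrite Quotient.idealrBE reprK.
Qed.

Let l2scale_pi a f : l2scale a (\pi_(L2 mu) f) = \pi_(L2 mu) (a *: f).
Proof.
rewrite /l2scale; apply/esym/piB; rewrite -scalerBr.
suff : a *: (f - repr (\pi_(L2 mu) f)) \in @l2null d T R mu by [].
by apply: rpredZ; exact: reprB.
Qed.

Let piD (f g : L2fun mu) :
  \pi_(L2 mu) (f + g) = \pi_(L2 mu) f + \pi_(L2 mu) g :> L2 mu.
Proof. exact: Quotient.pi_add. Qed.

Let l2scaleA a b u : l2scale a (l2scale b u) = l2scale (a * b) u.
Proof. by elim/quotW: u => f; rewrite (l2scale_pi b) !l2scale_pi scalerA. Qed.

Let l2scale1 : left_id 1 l2scale.
Proof. by elim/quotW=> f; rewrite l2scale_pi scale1r. Qed.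

Let l2scaleDr : right_distributive l2scale +%R.
Proof.
move=> a; elim/quotW=> f; elim/quotW=> g.
by rewrite -piD !l2scale_pi scalerDr piD.
Qed.

Let l2scaleDl u : {morph l2scale^~ u : a b / a + b}.
Proof.
by move=> a b; elim/quotW: u => f; rewrite !l2scale_pi scalerDl piD.
Qed.

HB.instance Definition _ := GRing.Zmodule_isLmodule.Build R[i] (L2 mu)
  l2scaleA l2scale1 l2scaleDr l2scaleDl.
End L2_lmod.

Section L2_operators.
Context d (T : measurableType d) (R : realType).
Variable mu : {measure set T -> \bar R}.

Definition l2repr (u : L2 mu) : T -> R[i] := l2val (repr u).
Coercion l2repr : L2 >-> Funclass.

(* The class of f when f is square-integrable; the junk value 0 otherwise. *)
Definition toL2 (f : T -> R[i]) : L2 mu :=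
  \pi_(L2 mu) (insubd (0 : L2fun mu) f).

Definition cintegral (f : T -> R[i]) : R[i] :=
  Complex (\int[mu]_x complex.Re (f x)) (\int[mu]_x complex.Im (f x)).

Definition l2dot (u v : L2 mu) : R[i] :=
  cintegral (fun x => u x * conjc (v x)).

Definition l2norm (u : L2 mu) : R := Num.sqrt (complex.Re (l2dot u u)).

Definition bounded_op (S : L2 mu -> L2 mu) : Prop :=
  linear S /\ exists M : R, forall u, l2norm (S u) <= M * l2norm u.

(* The order of R[i] is the partial one: 0 <= z means that z is a nonnegative
   real number. *)
Definition positive_op (S : L2 mu -> L2 mu) : Prop :=
  forall u, 0 <= l2dot (S u) u.

(* Unique when it exists, which is the case for every bounded S; the value fun=> 0
   for other S is junk. *)
Definition adjoint (S : L2 mu -> L2 mu) : L2 mu -> L2 mu :=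
  xget (fun=> 0) [set S' | forall u v, l2dot (S u) v = l2dot u (S' v)].

(* Orthonormal bases are indexed by nat: the Hilbert spaces considered below are
   separable and infinite-dimensional. *)
Definition orthonormal_basis (e : nat -> L2 mu) : Prop :=
  (forall m n, l2dot (e m) (e n) = (m == n)%:R) /\
  (forall u, (forall n, l2dot u (e n) = 0) -> u = 0).

(* P = |S|, the positive square root of S^* S. *)
Definition is_abs_op (S P : L2 mu -> L2 mu) : Prop :=
  [/\ bounded_op P, positive_op P & P \o P = adjoint S \o S].

(* S is bounded and tr |S| < +oo. *)
Definition trace_class (S : L2 mu -> L2 mu) : Prop :=
  bounded_op S /\
  exists2 P, is_abs_op S P &
    exists2 e, orthonormal_basis e &
      (\sum_(0 <= n <oo) (complex.Re (l2dot (P (e n)) (e n)))%:E < +oo)%E.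

(* The common value of the sums \sum_n <S e_n, e_n> over all orthonormal bases
   (well defined for S trace-class). *)
Definition trace (S : L2 mu -> L2 mu) : R[i] :=
  xget 0 [set t : R[i] | forall e, orthonormal_basis e ->
    series (fun n => l2dot (S (e n)) (e n)) @ \oo --> (t : R[i]^o)].
End L2_operators.

(* The measure r^{-1} dr on ]0, +oo[, seen as a measure on R that vanishes on
   ]-oo, 0]; hence L2 (haar R) is L^2(R_+, r^{-1} dr). *)
Definition haar (R : realType) (A : set (measurableTypeR R)) : \bar R :=
  (\int[lebesgue_measure]_(r in A `&` `]0%R, +oo[) (r^-1)%:E)%E.

Section haar_measure.
Variable R : realType.
Local Open Scope ereal_scope.
Local Notation haar := (@haar R).

Let haar0 : haar set0 = 0.
Proof. by rewrite /Defs.haar set0I integral_set0. Qed.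

Let inv_ge0 (A : set R) (r : R) :
  (A `&` `]0%R, +oo[) r -> 0 <= (r^-1)%:E :> \bar R.
Proof.
by move=> [_]; rewrite /= in_itv/= andbT => r0; rewrite lee_fin invr_ge0 ltW.
Qed.

Let haar_ge0 A : 0 <= haar A.
Proof. by apply: integral_ge0 => r /inv_ge0. Qed.

Let measurable_pinv (D : set (measurableTypeR R)) : D `<=` `]0%R, +oo[ ->
  measurable_fun D (fun r : measurableTypeR R => (r^-1)%:E : \bar R).
Proof.
move=> Dpos; apply/measurable_EFinP.
apply: (@eq_measurable_fun _ _ _ _ _ (@powR R ^~ (-1)%R)).
  move=> r; rewrite inE => /Dpos; rewrite /= in_itv/= andbT => r0.
  by rewrite powR_inv1// ltW.
exact: measurable_funTS.
Qed.

Let haar_sigma_additive : semi_sigma_additive haar.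
Proof.
move=> F mF tF mUF.
rewrite /Defs.haar setI_bigcupl ge0_integral_bigcup//=.
- by apply: is_cvg_ereal_nneg_natsum_cond => n _ _; exact: haar_ge0.
- by move=> k; exact: measurableI.
- by apply: measurable_pinv => r [k _ []].
- by move=> r [k _] /inv_ge0.
- exact: trivIset_setIr.
Qed.

HB.instance Definition _ := isMeasure.Build _ (measurableTypeR R) R haar
  haar0 haar_ge0 haar_sigma_additive.

Let haar_sigma_finite : sigma_finite [set: measurableTypeR R] haar.
Proof.
pose F n : set (measurableTypeR R) :=
  `]-oo, 0%R] `|` `[(n.+1%:R^-1)%R, n.+1%:R].
exists F.
  apply/esym; rewrite -subTset => r _.
  have [r0|r0] := leP r 0%R; first by exists 0%N => //; left; rewrite /= in_itv.
  have r0' : (0 < r^-1)%R by rewrite invr_gt0.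
  exists (maxn (Num.truncn r) (Num.truncn r^-1)) => //; right.
  rewrite /= in_itv/=; apply/andP; split.
    rewrite invf_ple ?posrE//.
    apply: le_trans (ltW (truncnS_gt _)) _.
    by rewrite ler_nat ltnS leq_maxr.
  apply: le_trans (ltW (truncnS_gt _)) _.
  by rewrite ler_nat ltnS leq_maxl.
move=> n; split; first exact: measurableU.
have mI : measurable (F n `&` `]0%R, +oo[ : set (measurableTypeR R)).
  by apply: measurableI => //; exact: measurableU.
apply: (@le_lt_trans _ _
  (\int[lebesgue_measure]_(r in F n `&` `]0%R, +oo[) (n.+1%:R)%:E)).
  apply: ge0_le_integral => //.
  - by move=> r /inv_ge0.
  - exact: measurable_pinv.
  - move=> r [[|]]; rewrite /= !in_itv/= andbT.
      by move=> /le_lt_trans/[apply]; rewrite ltxx.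
    by move=> /andP[nr _] r0; rewrite lee_fin invf_ple ?posrE.
rewrite integral_cst// lte_mul_pinfty//.
apply: (@le_lt_trans _ _ (lebesgue_measure `[(n.+1%:R^-1)%R, n.+1%:R : R])).
  apply: le_measure; rewrite ?inE//.
  move=> r [[|//]]; rewrite /= !in_itv/= andbT.
  by move=> /le_lt_trans/[apply]; rewrite ltxx.
by rewrite lebesgue_measure_itv/=; case: ifP => _; rewrite ?ltry// -EFinB ltry.
Qed.

HB.instance Definition _ := Measure_isSigmaFinite.Build _ _ _ haar
  haar_sigma_finite.
End haar_measure.

Notation L2pos R := (L2 (@haar R)).

Section affine.
Variable R : realType.
Local Notation L2pos := (L2pos R).

Definition cexpi (t : R) : R[i] := Complex (cos t) (sin t).

(* Only meaningful for a > 0. *)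
Definition affU (x a : R) (psi : L2pos) : L2pos :=
  toL2 (@haar R) (fun r => cexpi (2 * pi * x * r) * psi (a * r)).

Definition aff_conv (S T : L2pos -> L2pos) (g : R * R) : R[i] :=
  trace (S \o adjoint (affU (- g.1) g.2) \o T \o affU (- g.1) g.2).

(* L^1(Aff, a^{-1} dx da): the measure is the product of dx and a^{-1} da, and
   only the values on Aff = R x ]0, +oo[ matter. *)
Definition L1r_Aff (F : R * R -> R[i]) : Prop :=
  let nu := (@lebesgue_measure R \x @haar R)%E in
  let Aff := [set: R] `*` `]0, +oo[ in
  nu.-integrable Aff (fun g => (complex.Re (F g))%:E) /\
  nu.-integrable Aff (fun g => (complex.Im (F g))%:E).

(* Multiplication by r^s on L^2(R_+) with its maximal domain; D is the case
   s = 1/2 and D^{-1} the case s = -1/2. *)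
Definition mulpow_fun (s : R) (psi : L2pos) : R -> R[i] :=
  fun r => (r `^ s)%:C%C * psi r.

Definition dom_mulpow (s : R) : set L2pos :=
  [set psi | square_integrable (@haar R) (mulpow_fun s psi)].

Definition mulpow (s : R) (psi : L2pos) : L2pos :=
  toL2 (@haar R) (mulpow_fun s psi).

Definition dom_D : set L2pos := dom_mulpow 2^-1.
Definition dom_Dinv : set L2pos := dom_mulpow (- 2^-1).
Definition Dinv : L2pos -> L2pos := mulpow (- 2^-1).

Definition admissible (S : L2pos -> L2pos) : Prop :=
  [/\ bounded_op S,
      S <> (fun=> 0),
      forall psi, dom_D psi -> dom_Dinv (S psi),
      exists M : R, forall psi, dom_Dinv psi ->
        l2norm (Dinv (S (Dinv psi))) <= M * l2norm psi &
      exists2 T : L2pos -> L2pos, trace_class T &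
        forall psi, dom_Dinv psi -> T psi = Dinv (S (Dinv psi))].
End affine.

(* Main.v *)
Require Import Defs.
From HB Require Import structures.
From mathcomp Require Import all_boot all_order all_algebra.
From mathcomp Require Import complex ring lra.
From mathcomp Require Import all_classical all_reals all_analysis.
From mathcomp Require Import measurable_realfun.
Import numFieldNormedType.Exports.

(** The operator [S] is a sum of rank-one operators [u |-> <u, v_k> v_k] with
    [\sum_k |v_k|^2] finite ([trace_class_gram]).  Expanding both copies of [S]
    in the convolution gives ([aff_conv_gram])
      [S * S (x, a) = \sum_k \sum_j |<U(-x, a) v_k, v_j>|^2],
    a nonnegative function, so it is integrable if and only if the integrals of
    all the squared matrix coefficients have a finite sum.

    For fixed [a], the coefficient [x |-> <U(x, a) u, v>] is the Fourier
    transform of [r |-> u(a r) conj(v(r)) / r] on the half-line.  Plancherel's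
    theorem in [x], followed by the invariance of [dr / r] under dilations when
    one integrates in [a], yields the orthogonality relation
      [\int |<U(-x, a) u, v>|^2 dx da/a = |u|^2 |D^-1 v|^2].
    Finiteness being the only issue, two inequalities with constants are enough
    ([integral_coef_le], [le_integral_coef]).  As [S <> 0], some [v_k] is
    nonzero, and the convolution is integrable if and only if
    [\sum_j |D^-1 v_j|^2] is finite ([L1r_aff_conv]).

    This sum is the trace of [D^-1 S D^-1].  If it is finite, the vectors
    [w_j = D^-1 v_j] are square-summable, and the sums of rank-one operators
    [\sum_j <., w_j> w_j] and [\sum_j <., v_j> w_j] define a trace-class
    extension of [D^-1 S D^-1] and the operator [D^-1 S]
    ([admissible_of_energy]).  Conversely, the trace-class extension [A] of
    [D^-1 S D^-1] is positive, hence [A = \sum_j <., w_j> w_j] for some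
    square-summable [w_j].  Let [X] be the indicator of [[1/(N+1), N+1]], as a
    multiplication operator.  The operators [X D^-1 S D^-1 X] and [X A X]
    coincide, and their traces are [\sum_j |X D^-1 v_j|^2] and
    [\sum_j |X w_j|^2]; letting [N] tend to infinity bounds
    [\sum_j |D^-1 v_j|^2] by [\sum_j |w_j|^2] ([energy_of_admissible]).

    Plancherel's theorem is replaced by two inequalities between the square
    integral of a real integrable [p] and that of its cosine and sine transforms
    over the half-line.  With the weight [exp (- e x)], the inversion formula is
    the convolution of [p] with a Poisson kernel, whose mass is [pi]; pairing it
    with [p] gives the upper bound ([plancherel_upper]).  For the lower bound,
    a second factor in the weight turns the Poisson kernel into its average over
    an interval, so that the inversion formula tends to an average of [p] as [e]
    tends to [0].  The upper bound, applied to the weighted transforms, controls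
    the square integral of these averages, and Lebesgue's differentiation
    theorem recovers [p] ([plancherel_lower]). *)

Set Implicit Arguments.
Unset Strict Implicit.
Unset Printing Implicit Defensive.
Import Order.TTheory GRing.Theory Num.Theory.
Local Open Scope classical_set_scope.
Local Open Scope ring_scope.

(** * Complex numbers, Hermitian forms and the inner product of L2 *)

Section complex_modulus.
Variable R : realType.
Implicit Types z w : R[i].

Definition sqmod z : R := complex.Re z ^+ 2 + complex.Im z ^+ 2.

Lemma sqmodE z : Normc.normc z ^+ 2 = sqmod z.
Proof. by case: z => a b; rewrite /= sqr_sqrtr// addr_ge0// sqr_ge0. Qed.

Lemma sqmod_ge0 z : 0 <= sqmod z.
Proof. by rewrite addr_ge0// sqr_ge0. Qed.

Lemma sqmodM z w : sqmod (z * w) = sqmod z * sqmod w.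
Proof. by case: z w => a b [c d]; rewrite /sqmod /=; ring. Qed.

Lemma sqmod_conj z : sqmod (conjc z) = sqmod z.
Proof. by case: z => a b; rewrite /sqmod /= sqrrN. Qed.

Lemma sqmod0 : sqmod 0 = 0.
Proof. by rewrite /sqmod /= expr0n addr0. Qed.

Lemma sqmod_eq0 z : sqmod z = 0 -> z = 0.
Proof.
move=> /eqP; rewrite /sqmod paddr_eq0 ?sqr_ge0// !sqrf_eq0.
by case: z => a b /= /andP[/eqP -> /eqP ->].
Qed.

Lemma sqmodN z : sqmod (- z) = sqmod z.
Proof. by case: z => a b; rewrite /sqmod /= !sqrrN. Qed.

Lemma mul_conjc z : z * conjc z = (sqmod z)%:C%C.
Proof. by case: z => a b; apply/eqP; rewrite eq_complex /=; apply/andP; split; apply/eqP; rewrite /sqmod /=; ring. Qed.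

Lemma sqmodC (x : R) : sqmod x%:C%C = x ^+ 2.
Proof. by rewrite /sqmod /= expr0n addr0. Qed.

Lemma sqmodD_le z w : sqmod (z + w) <= 2 * sqmod z + 2 * sqmod w.
Proof.
case: z w => a b [c d]; rewrite /sqmod /=.
by have := sqr_ge0 (a - c); have := sqr_ge0 (b - d); lra.
Qed.

Lemma normr_Re_le z : `|complex.Re z| <= Num.sqrt (sqmod z).
Proof. by rewrite -sqrtr_sqr ler_wsqrtr// lerDl sqr_ge0. Qed.

Lemma normr_ReM_le z w : `|complex.Re (z * w)| <= sqmod z + sqmod w.
Proof.
case: z w => a b [c d]; rewrite ler_norml /sqmod /=.
have := sqr_ge0 (a - c); have := sqr_ge0 (b - d).
have := sqr_ge0 (a + c); have := sqr_ge0 (b + d).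
have := sqr_ge0 a; have := sqr_ge0 b; have := sqr_ge0 c; have := sqr_ge0 d.
by move=> *; apply/andP; split; lra.
Qed.

Lemma normr_ImM_le z w : `|complex.Im (z * w)| <= sqmod z + sqmod w.
Proof.
case: z w => a b [c d]; rewrite ler_norml /sqmod /=.
have := sqr_ge0 (a - d); have := sqr_ge0 (b - c).
have := sqr_ge0 (a + d); have := sqr_ge0 (b + c).
have := sqr_ge0 a; have := sqr_ge0 b; have := sqr_ge0 c; have := sqr_ge0 d.
by move=> *; apply/andP; split; lra.
Qed.

Lemma ReD z w : complex.Re (z + w) = complex.Re z + complex.Re w.
Proof. by case: z; case: w. Qed.

Lemma ReN z : complex.Re (- z) = - complex.Re z.
Proof. by case: z. Qed.

Lemma ReCM (c : R) z : complex.Re (c%:C%C * z) = c * complex.Re z.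
Proof. by case: z => a b /=; rewrite mul0r subr0. Qed.

Lemma ImD z w : complex.Im (z + w) = complex.Im z + complex.Im w.
Proof. by case: z; case: w. Qed.

Lemma ReM z w : complex.Re (z * w) =
  complex.Re z * complex.Re w - complex.Im z * complex.Im w.
Proof. by case: z => a b; case: w => c d; rewrite /=; ring. Qed.

Lemma ImN z : complex.Im (- z) = - complex.Im z.
Proof. by case: z. Qed.

Lemma ImM z w : complex.Im (z * w) =
  complex.Re z * complex.Im w + complex.Im z * complex.Re w.
Proof. by case: z => a b; case: w => c d; rewrite /=; ring. Qed.

Lemma Re_conj z : complex.Re (conjc z) = complex.Re z.
Proof. by case: z. Qed.

Lemma Im_conj z : complex.Im (conjc z) = - complex.Im z.
Proof. by case: z. Qed.

Lemma realCM (a b : R) : (a * b)%:C%C = a%:C%C * b%:C%C :> R[i].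
Proof. exact: rmorphM. Qed.

Lemma realCB (a b : R) : (a - b)%:C%C = a%:C%C - b%:C%C :> R[i].
Proof. exact: rmorphB. Qed.

Lemma conjcM z w : conjc (z * w) = conjc z * conjc w.
Proof. exact: rmorphM. Qed.

Lemma Re_sum I (r : seq I) (P : pred I) (f : I -> R[i]) :
  complex.Re (\sum_(k <- r | P k) f k) = \sum_(k <- r | P k) complex.Re (f k).
Proof. by apply: (big_morph (@complex.Re R)) => // z w; exact: ReD. Qed.

Lemma Im_sum I (r : seq I) (P : pred I) (f : I -> R[i]) :
  complex.Im (\sum_(k <- r | P k) f k) = \sum_(k <- r | P k) complex.Im (f k).
Proof. by apply: (big_morph (@complex.Im R)) => // z w; exact: ImD. Qed.
End complex_modulus.

Section hermitian.
Variables (R : realType) (V : lmodType R[i]).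
Implicit Types u v w : V.

(** The inner product of [L2 mu] and the form [(u, v) |-> <S u, v>] of a positive
    operator [S] are both of this kind, and both need the Cauchy--Schwarz
    inequality. *)
Definition psd_form (b : V -> V -> R[i]) :=
  [/\ (forall a u v w, b (a *: u + v) w = a * b u w + b v w),
      (forall u v, b v u = conjc (b u v)) &
      (forall u, 0 <= complex.Re (b u u))].

(** Over the complex numbers the real-valuedness of the quadratic form already
    forces symmetry: expand it at [u + v] and at [u + 'i *: v]. *)
Lemma real_diag_hermitian (b : V -> V -> R[i]) :
  (forall u v w, b (u + v) w = b u w + b v w) ->
  (forall u v w, b u (v + w) = b u v + b u w) ->
  (forall a u w, b (a *: u) w = a * b u w) ->
  (forall a u w, b u (a *: w) = conjc a * b u w) ->
  (forall u, complex.Im (b u u) = 0) ->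
  forall u v, b v u = conjc (b u v).
Proof.
move=> Dl Dr Zl Zr I0 u v; have := I0 (u + v); have := I0 (u + (Complex 0 1) *: v).
rewrite !Dl !Dr !Zl !Zr !ImD !ImM; have := I0 u; have := I0 v.
move: (b u u) (b v v) (b u v) (b v u) => [c' f'] [c f] [p q] [p' q'] /= h h' h1 h2.
by apply/eqP; rewrite eq_complex /=; apply/andP; split; apply/eqP; lra.
Qed.

Section theory.
Variable b : V -> V -> R[i].
Hypothesis pb : psd_form b.

Lemma formDl u v w : b (u + v) w = b u w + b v w.
Proof. by case: pb => h _ _; rewrite -[u in LHS]scale1r h mul1r. Qed.
Lemma form0l w : b 0 w = 0.
Proof. by apply/(addrI (b 0 w)); rewrite -formDl !addr0. Qed.
Lemma formZl a u w : b (a *: u) w = a * b u w.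
Proof. by case: pb => h _ _; rewrite -[_ *: _]addr0 h form0l addr0. Qed.
Lemma formC u v : b v u = conjc (b u v).
Proof. by case: pb. Qed.
Lemma formNl u w : b (- u) w = - b u w.
Proof. by rewrite -scaleN1r formZl mulN1r. Qed.
Lemma formDr u v w : b u (v + w) = b u v + b u w.
Proof. by rewrite formC formDl rmorphD /= -!formC. Qed.
Lemma form0r w : b w 0 = 0.
Proof. by rewrite formC form0l conjc0. Qed.
Lemma formZr a u w : b u (a *: w) = conjc a * b u w.
Proof. by rewrite formC formZl rmorphM /= -formC. Qed.
Lemma formNr u w : b u (- w) = - b u w.
Proof. by rewrite formC formNl rmorphN /= -formC. Qed.
Lemma form_suml I (r : seq I) (P : pred I) (f : I -> V) w :
  b (\sum_(k <- r | P k) f k) w = \sum_(k <- r | P k) b (f k) w.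
Proof. by apply: (big_morph (b^~ w)) => [u v|]; rewrite ?formDl ?form0l. Qed.
Lemma form_sumr I (r : seq I) (P : pred I) (f : I -> V) w :
  b w (\sum_(k <- r | P k) f k) = \sum_(k <- r | P k) b w (f k).
Proof. by apply: (big_morph (b w)) => [u v|]; rewrite ?formDr ?form0r. Qed.

Lemma form_ge0 u : 0 <= complex.Re (b u u).
Proof. by case: pb. Qed.

Lemma form_diag u : b u u = (complex.Re (b u u))%:C%C.
Proof.
have := formC u u; case: (b u u) => x y /=.
move=> [/eqP]; rewrite -subr_eq0 opprK -mulr2n mulrn_eq0 /= => /eqP ->.
by [].
Qed.

Lemma form_sqD u v : complex.Re (b (u + v) (u + v)) =
  complex.Re (b u u) + complex.Re (b v v) + 2 * complex.Re (b u v).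
Proof.
rewrite formDl !formDr !ReD [b v u]formC Re_conj; ring.
Qed.

Lemma form_sqZ a u : complex.Re (b (a *: u) (a *: u)) =
  sqmod a * complex.Re (b u u).
Proof.
by rewrite formZl formZr mulrA mul_conjc form_diag ReM /= mul0r subr0.
Qed.

Lemma form_sqN u : complex.Re (b (- u) (- u)) = complex.Re (b u u).
Proof. by rewrite formNl formNr opprK. Qed.

(** The form is nonnegative at [s *: u - b u v *: v] for every real [s], and
    the optimal [s] yields the inequality; the case where the form vanishes at
    [v] needs large values of [s] instead. *)
Lemma form_CS u v :
  sqmod (b u v) <= complex.Re (b u u) * complex.Re (b v v).
Proof.
set A := complex.Re (b u u); set B := complex.Re (b v v); set z := b u v.
have key (s : R) : 0 <= s ^+ 2 * A + sqmod z * B - 2 * s * sqmod z.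
  have := form_ge0 (s%:C%C *: u + (- z) *: v).
  rewrite form_sqD !form_sqZ sqmodC sqmodN -/A -/B formZl formZr -/z.
  rewrite rmorphN mulNr [conjc z * z]mulrC mul_conjc ReM /= mul0r subr0.
  by rewrite mulrN mulrN mulrA.
have A0 : 0 <= A := form_ge0 u.
have B0 : 0 <= B := form_ge0 v.
have z0 := sqmod_ge0 z.
have [B00|Bn0] := eqVneq B 0.
  rewrite B00 mulr0; rewrite leNgt; apply/negP => zp.
  have := key ((A + 1)^-1 * sqmod z); rewrite B00.
  have A1 : A + 1 != 0 by apply: lt0r_neq0; lra.
  set t := sqmod z in zp *; set c := (A + 1)^-1.
  have cA : c * A = 1 - c by rewrite /c; field.
  have c0 : 0 < c by rewrite /c invr_gt0; lra.
  rewrite (_ : _ + _ - _ = c * t * t * (c * A - 2)); last by ring.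
  rewrite cA; have h1 : 0 < c * t * t by rewrite !mulr_gt0.
  have h2 : 1 - c - 2 < 0 by lra.
  by rewrite leNgt nmulr_llt0// h1.
have Bp : 0 < B by rewrite lt_neqAle eq_sym Bn0.
have := key B; rewrite (_ : _ + _ - _ = B * (A * B - sqmod z)); last by ring.
by rewrite pmulr_rge0// subr_ge0.
Qed.

Lemma form_sqD_le u v : complex.Re (b (u + v) (u + v)) <=
  2 * complex.Re (b u u) + 2 * complex.Re (b v v).
Proof.
have := form_ge0 (u - v); rewrite !form_sqD form_sqN formNr.
by case: (b u v) => x y /=; lra.
Qed.

Lemma form_triangle u v : Num.sqrt (complex.Re (b (u + v) (u + v))) <=
  Num.sqrt (complex.Re (b u u)) + Num.sqrt (complex.Re (b v v)).
Proof.
have A0 := form_ge0 u; have B0 := form_ge0 v.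
rewrite -[leRHS]ger0_norm ?addr_ge0 ?sqrtr_ge0// -sqrtr_sqr ler_wsqrtr//.
rewrite form_sqD sqrrD !sqr_sqrtr// -addrA [leRHS]addrAC -addrA lerD2l lerD2l.
rewrite -[leRHS]mulr_natl ler_wpM2l//.
apply: (le_trans (ler_norm _)); apply: (le_trans (normr_Re_le _)).
by rewrite -sqrtrM// ler_wsqrtr// form_CS.
Qed.
End theory.
End hermitian.

Section almost_everywhere.
Context d (T : measurableType d) (R : realType) (mu : {measure set T -> \bar R}).
Implicit Types P Q : T -> Prop.

Lemma aeS P Q : {ae mu, forall r, P r} -> (forall r, P r -> Q r) ->
  {ae mu, forall r, Q r}.
Proof. by move=> H PQ; apply: filterS H => r; exact: PQ. Qed.

Lemma aeI P Q : {ae mu, forall r, P r} -> {ae mu, forall r, Q r} ->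
  {ae mu, forall r, P r /\ Q r}.
Proof. by move=> H1 H2; apply: filterS2 H1 H2 => r. Qed.
End almost_everywhere.

Section cintegral_theory.
Context d (T : measurableType d) (R : realType).
Variable mu : {measure set T -> \bar R}.
Implicit Types f g : T -> R[i].

Definition cintegrable f :=
  mu.-integrable [set: T] (EFin \o (fun x => complex.Re (f x))) /\
  mu.-integrable [set: T] (EFin \o (fun x => complex.Im (f x))).

Lemma cintegralD f g : cintegrable f -> cintegrable g ->
  cintegral mu (fun x => f x + g x) = cintegral mu f + cintegral mu g.
Proof.
move=> [f1 f2] [g1 g2]; apply/eqP; rewrite eq_complex /=; apply/andP; split; apply/eqP.
- under eq_Rintegral do rewrite ReD.
  by rewrite RintegralD.
- under eq_Rintegral do rewrite ImD.
  by rewrite RintegralD.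
Qed.

Lemma integrableZl_EFin (c : R) (h : T -> R) : mu.-integrable [set: T] (EFin \o h) ->
  mu.-integrable [set: T] (EFin \o (fun x => c * h x)).
Proof.
move=> ih; apply: (eq_integrable _ (fun x => c%:E * (h x)%:E)%E) => //.
exact: integrableZl.
Qed.

Lemma cintegrableZ a f : cintegrable f -> cintegrable (fun x => a * f x).
Proof.
move=> [f1 f2]; split; under [X in EFin \o X]eq_fun do rewrite ?ReM ?ImM.
- by apply: (integrableB _ (integrableZl_EFin _ f1) (integrableZl_EFin _ f2)).
- by apply: (integrableD _ (integrableZl_EFin _ f2) (integrableZl_EFin _ f1)).
Qed.

Lemma cintegralZ a f : cintegrable f ->
  cintegral mu (fun x => a * f x) = a * cintegral mu f.
Proof.
move=> [f1 f2].
apply/eqP; rewrite eq_complex; apply/andP; split; apply/eqP; rewrite ?ReM ?ImM /=.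
- under eq_Rintegral do rewrite ReM.
  by rewrite RintegralB ?RintegralZl//; exact: integrableZl_EFin.
- under eq_Rintegral do rewrite ImM.
  by rewrite RintegralD ?RintegralZl//; exact: integrableZl_EFin.
Qed.

Lemma cintegral_conj f :
  cintegrable f -> cintegral mu (fun x => conjc (f x)) = conjc (cintegral mu f).
Proof.
move=> [f1 f2]; apply/eqP; rewrite eq_complex; apply/andP; split; apply/eqP => /=.
- by under eq_Rintegral do rewrite Re_conj.
- under eq_Rintegral do rewrite Im_conj -mulN1r.
  by rewrite RintegralZl// mulN1r.
Qed.

Lemma ae_eq_cintegral f g : cmeasurable [set: T] f -> cmeasurable [set: T] g ->
  {ae mu, forall x, f x = g x} -> cintegral mu f = cintegral mu g.
Proof.
move=> [f1 f2] [g1 g2] fg; rewrite /cintegral /Rintegral; congr (Complex (fine _) (fine _)).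
- apply: ae_eq_integral => //; try exact/measurable_EFinP.
  by apply: filterS fg => x /= ->.
- apply: ae_eq_integral => //; try exact/measurable_EFinP.
  by apply: filterS fg => x /= ->.
Qed.

Lemma cmeasurableM f g : cmeasurable [set: T] f -> cmeasurable [set: T] g ->
  cmeasurable [set: T] (fun x => f x * g x).
Proof.
move=> [f1 f2] [g1 g2]; split.
- under eq_fun do rewrite ReM.
  by apply: measurable_funB; exact: measurable_funM.
- under eq_fun do rewrite ImM.
  by apply: measurable_funD; exact: measurable_funM.
Qed.

Lemma cmeasurableD f g : cmeasurable [set: T] f -> cmeasurable [set: T] g ->
  cmeasurable [set: T] (fun x => f x + g x).
Proof.
move=> [f1 f2] [g1 g2]; split.
- by under eq_fun do rewrite ReD; exact: measurable_funD.
- by under eq_fun do rewrite ImD; exact: measurable_funD.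
Qed.

Lemma cmeasurable_conj f : cmeasurable [set: T] f ->
  cmeasurable [set: T] (fun x => conjc (f x)).
Proof.
move=> [f1 f2]; split; first by under eq_fun do rewrite Re_conj.
by under eq_fun do rewrite Im_conj; exact: measurableT_comp.
Qed.

Lemma cmeasurableC (h : T -> R) : measurable_fun [set: T] h ->
  cmeasurable [set: T] (fun x => (h x)%:C%C).
Proof. by move=> mh; split => //=; exact: measurable_cst. Qed.

Lemma measurable_sqmod f : cmeasurable [set: T] f ->
  measurable_fun [set: T] (fun x => sqmod (f x)).
Proof. by move=> [f1 f2]; apply: measurable_funD; exact: measurable_funX. Qed.

Lemma square_integrableE f : square_integrable mu f <->
  cmeasurable [set: T] f /\ (\int[mu]_x (sqmod (f x))%:E < +oo)%E.
Proof.
by rewrite /square_integrable; under eq_integral do rewrite sqmodE.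
Qed.

Lemma square_integrable_le f (h : T -> R) : cmeasurable [set: T] f ->
  (forall x, sqmod (f x) <= h x) -> measurable_fun [set: T] h ->
  (\int[mu]_x (h x)%:E < +oo)%E -> square_integrable mu f.
Proof.
move=> mf fh mh ih; apply/square_integrableE; split=> //.
apply: le_lt_trans ih; apply: ge0_le_integral => //.
- by move=> x _; rewrite lee_fin sqmod_ge0.
- exact/measurable_EFinP/measurable_sqmod.
- exact/measurable_EFinP.
- by move=> x _; rewrite lee_fin.
Qed.

Lemma integrable_sqmod f : square_integrable mu f ->
  mu.-integrable [set: T] (EFin \o (fun x => sqmod (f x))).
Proof.
move=> /square_integrableE[mf If]; apply/integrableP; split.
  exact/measurable_EFinP/measurable_sqmod.
by under eq_integral => x _ do rewrite /= ger0_norm ?sqmod_ge0//.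
Qed.

Lemma cintegrable_mul_conj f g : square_integrable mu f -> square_integrable mu g ->
  cintegrable (fun x => f x * conjc (g x)).
Proof.
move=> sf sg; have [m1 m2] := cmeasurableM sf.1 (cmeasurable_conj sg.1).
have dom : mu.-integrable [set: T] (EFin \o (fun x => sqmod (f x) + sqmod (g x))).
  exact: (integrableD _ (integrable_sqmod sf) (integrable_sqmod sg)).
split.
- apply: le_integrable dom => //; first exact/measurable_EFinP.
  move=> x _; rewrite /= lee_fin [leRHS]ger0_norm; last by rewrite addr_ge0// sqmod_ge0.
  by rewrite -[sqmod (g x)]sqmod_conj normr_ReM_le.
- apply: le_integrable dom => //; first exact/measurable_EFinP.
  move=> x _; rewrite /= lee_fin [leRHS]ger0_norm; last by rewrite addr_ge0// sqmod_ge0.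
  by rewrite -[sqmod (g x)]sqmod_conj normr_ImM_le.
Qed.
End cintegral_theory.

Section L2_inner_product.
Context d (T : measurableType d) (R : realType).
Variable mu : {measure set T -> \bar R}.
Implicit Types (u v w : L2 mu) (f g : T -> R[i]).

Lemma l2P u : square_integrable mu u.
Proof.
have : l2val (repr u) \in sqint mu by case: (repr u).
by rewrite unfold_in => /asboolP.
Qed.

Lemma l2_cmeasurable u : cmeasurable [set: T] u.
Proof. by case: (l2P u). Qed.

Lemma L2fun_ae (F : L2fun mu) :
  {ae mu, forall x, l2repr (\pi_(L2 mu) F)%qT x = F x}.
Proof.
have : repr (\pi_(L2 mu) F)%qT - F \in @l2null d T R mu.
  by rewrite Quotient.idealrBE reprK.
rewrite unfold_in => /asboolP; apply: filterS => x.
by move=> h; apply/eqP; rewrite -subr_eq0; apply/eqP; exact: h.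
Qed.

Lemma toL2_ae f : square_integrable mu f ->
  {ae mu, forall x, toL2 mu f x = f x}.
Proof.
move=> sf; have := L2fun_ae (insubd 0 f); apply: filterS => x ->.
by rewrite /= val_insubd unfold_in /sqint; case: asboolP.
Qed.

Lemma l2_ae_eq u v : {ae mu, forall x, u x = v x} -> u = v.
Proof.
move=> uv; rewrite -[u]reprK -[v]reprK; apply/eqP.
rewrite -Quotient.idealrBE unfold_in; apply/asboolP.
by apply: filterS uv => x /eqP; rewrite -subr_eq0 => /eqP.
Qed.

Lemma l2D_ae u v : {ae mu, forall x, l2repr (u + v) x = u x + v x}.
Proof.
have := L2fun_ae (repr u + repr v); rewrite Quotient.pi_add !reprK.
by apply: filterS => x ->.
Qed.

Lemma l2Z_ae a u : {ae mu, forall x, l2repr (a *: u) x = a * u x}.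
Proof. by have := L2fun_ae (a *: repr u); apply: filterS => x ->. Qed.

Lemma l20_ae : {ae mu, forall x, l2repr (0 : L2 mu) x = 0}.
Proof.
have := l2Z_ae 0 (0 : L2 mu); rewrite scale0r.
by apply: filterS => x ->; rewrite mul0r.
Qed.

Lemma l2dotE u v f g : square_integrable mu f -> square_integrable mu g ->
  {ae mu, forall x, u x = f x} -> {ae mu, forall x, v x = g x} ->
  l2dot u v = cintegral mu (fun x => f x * conjc (g x)).
Proof.
move=> sf sg uf vg; apply: ae_eq_cintegral.
- by apply: cmeasurableM; [|apply: cmeasurable_conj]; exact: l2_cmeasurable.
- by apply: cmeasurableM; [case: sf|apply: cmeasurable_conj; case: sg].
- by apply: filterS2 uf vg => x -> ->.
Qed.

Lemma l2dot_psd : psd_form (@l2dot d T R mu).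
Proof.
split.
- move=> a; change (forall u v w : L2 mu, l2dot (a *: u + v) w = a * l2dot u w + l2dot v w) => u v w.
  have sw := l2P w; have su := cintegrable_mul_conj (l2P u) sw.
  have sv := cintegrable_mul_conj (l2P v) sw.
  transitivity (cintegral mu (fun x => a * (u x * conjc (w x)) + v x * conjc (w x))).
    apply: ae_eq_cintegral.
    + by apply: cmeasurableM; [|apply: cmeasurable_conj]; exact: l2_cmeasurable.
    + apply: cmeasurableD; last by apply: cmeasurableM; [|apply: cmeasurable_conj]; exact: l2_cmeasurable.
      apply: cmeasurableM; first by split; exact: measurable_cst.
      by apply: cmeasurableM; [|apply: cmeasurable_conj]; exact: l2_cmeasurable.
    + apply: filterS2 (l2D_ae (a *: u) v) (l2Z_ae a u) => x -> ->.
      by rewrite mulrDl mulrA.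
  by rewrite cintegralD ?cintegralZ//; exact: cintegrableZ.
  - move=> u v; have uv := cintegrable_mul_conj (l2P u) (l2P v).
  rewrite /l2dot -(cintegral_conj uv); congr cintegral.
  by apply/funext => x; rewrite conjcM conjcK mulrC.
- move=> u; rewrite /l2dot /=; apply: Rintegral_ge0 => x _.
  by rewrite mul_conjc /= sqmod_ge0.
Qed.

Lemma l2dotDl u v w : l2dot (u + v) w = l2dot u w + l2dot v w.
Proof. exact: (formDl l2dot_psd). Qed.
Lemma l2dotDr u v w : l2dot u (v + w) = l2dot u v + l2dot u w.
Proof. exact: (formDr l2dot_psd). Qed.
Lemma l2dotZl a u w : l2dot (a *: u) w = a * l2dot u w.
Proof. exact: (formZl l2dot_psd). Qed.
Lemma l2dotZr a u w : l2dot u (a *: w) = conjc a * l2dot u w.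
Proof. exact: (formZr l2dot_psd). Qed.
Lemma l2dotNl u w : l2dot (- u) w = - l2dot u w.
Proof. exact: (formNl l2dot_psd). Qed.
Lemma l2dotNr u w : l2dot u (- w) = - l2dot u w.
Proof. exact: (formNr l2dot_psd). Qed.
Lemma l2dotBl u v w : l2dot (u - v) w = l2dot u w - l2dot v w.
Proof. by rewrite l2dotDl l2dotNl. Qed.
Lemma l2dotBr u v w : l2dot u (v - w) = l2dot u v - l2dot u w.
Proof. by rewrite l2dotDr l2dotNr. Qed.
Lemma l2dot0l w : l2dot 0 w = 0.
Proof. exact: (form0l l2dot_psd). Qed.
Lemma l2dot0r w : l2dot w 0 = 0.
Proof. exact: (form0r l2dot_psd). Qed.
Lemma l2dotC u v : l2dot v u = conjc (l2dot u v).
Proof. exact: (formC l2dot_psd). Qed.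
Lemma l2dot_suml I (r : seq I) (P : pred I) (f : I -> L2 mu) w :
  l2dot (\sum_(k <- r | P k) f k) w = \sum_(k <- r | P k) l2dot (f k) w.
Proof. exact: (form_suml l2dot_psd). Qed.
Lemma l2dot_sumr I (r : seq I) (P : pred I) (f : I -> L2 mu) w :
  l2dot w (\sum_(k <- r | P k) f k) = \sum_(k <- r | P k) l2dot w (f k).
Proof. exact: (form_sumr l2dot_psd). Qed.

Definition nsq u : R := complex.Re (l2dot u u).

Lemma l2dot_nsq u : l2dot u u = (nsq u)%:C%C.
Proof. exact: (form_diag l2dot_psd). Qed.
Lemma nsq_ge0 u : 0 <= nsq u.
Proof. exact: (form_ge0 l2dot_psd). Qed.
Lemma nsqD u v : nsq (u + v) = nsq u + nsq v + 2 * complex.Re (l2dot u v).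
Proof. exact: (form_sqD l2dot_psd). Qed.
Lemma nsqZ a u : nsq (a *: u) = sqmod a * nsq u.
Proof. exact: (form_sqZ l2dot_psd). Qed.
Lemma nsqN u : nsq (- u) = nsq u.
Proof. exact: (form_sqN l2dot_psd). Qed.
Lemma nsq0 : nsq 0 = 0.
Proof. by rewrite /nsq l2dot0l. Qed.
Lemma nsqD_le u v : nsq (u + v) <= 2 * nsq u + 2 * nsq v.
Proof. exact: (form_sqD_le l2dot_psd). Qed.
Lemma l2dot_CS u v : sqmod (l2dot u v) <= nsq u * nsq v.
Proof. exact: (form_CS l2dot_psd). Qed.
Lemma l2normE u : l2norm u = Num.sqrt (nsq u).
Proof. by []. Qed.
Lemma l2norm_ge0 u : 0 <= l2norm u.
Proof. exact: sqrtr_ge0. Qed.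
Lemma l2norm_sq u : l2norm u ^+ 2 = nsq u.
Proof. exact: sqr_sqrtr (nsq_ge0 u). Qed.
Lemma l2norm_triangle u v : l2norm (u + v) <= l2norm u + l2norm v.
Proof. exact: (form_triangle l2dot_psd). Qed.

Lemma ae_square_integrable u f : cmeasurable [set: T] f ->
  {ae mu, forall x, u x = f x} -> square_integrable mu f.
Proof.
move=> mf uf; apply/square_integrableE; split=> //.
have /square_integrableE[mu_ iu] := l2P u.
rewrite (ae_eq_integral (fun x => (sqmod (u x))%:E))//.
- exact/measurable_EFinP/measurable_sqmod.
- exact/measurable_EFinP/measurable_sqmod.
- by apply: filterS uf => x ->.
Qed.

Lemma nsqE u f : cmeasurable [set: T] f -> {ae mu, forall x, u x = f x} ->
  (nsq u)%:E = (\int[mu]_x (sqmod (f x))%:E)%E.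
Proof.
move=> mf uf; have sf := ae_square_integrable mf uf.
rewrite /nsq (l2dotE sf sf uf uf) /cintegral /=.
under eq_Rintegral do rewrite mul_conjc /=.
rewrite /Rintegral fineK//; apply: integrable_fin_num => //.
exact: integrable_sqmod.
Qed.

Lemma nsq_eq0 u : nsq u = 0 -> u = 0.
Proof.
move=> u0; apply: l2_ae_eq.
have := nsqE (l2_cmeasurable u) (aeW _ (fun x => erefl (u x))); rewrite u0 => /esym h.
have mu2 : measurable_fun [set: T] (EFin \o (fun x => sqmod (u x))).
  exact/measurable_EFinP/measurable_sqmod/l2_cmeasurable.
have [h1 _] := ae_eq_integral_abs mu measurableT mu2.
have : (\int[mu]_x `|(EFin \o (fun x => sqmod (u x))) x| = 0)%E.
  by rewrite -[RHS]h; apply: eq_integral => x _; rewrite /= ger0_norm// sqmod_ge0.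
move=> /h1; rewrite /ae_eq => ae0.
by apply: filterS2 l20_ae ae0 => x -> /(_ I) [] /sqmod_eq0.
Qed.
End L2_inner_product.

(** * Series of real numbers and completeness of L2 *)

Section series_of_reals.
Variable R : realType.

Lemma le_cvg_seq (u : nat -> R) (l c : R) :
  u @ \oo --> l -> (forall n, c <= u n) -> c <= l.
Proof.
move=> ul cu; rewrite -(cvg_lim _ ul)//.
by apply: limr_ge; [exact: cvgP ul|exact: nearW].
Qed.

Lemma cvg_seq_le (u : nat -> R) (l c : R) :
  u @ \oo --> l -> (forall n, u n <= c) -> l <= c.
Proof.
move=> ul cu; rewrite -(cvg_lim _ ul)//.
by apply: limr_le; [exact: cvgP ul|exact: nearW].
Qed.

Lemma bounded_abs_series_cvg (c : nat -> R) (M : R) :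
  (forall n, \sum_(k < n) `|c k| <= M) -> cvgn (fun n => \sum_(k < n) c k).
Proof.
move=> cM; suff : cvgn (series c).
  by under [in X in _ -> X]eq_fun do rewrite -(big_mkord xpredT).
apply: normed_cvg.
rewrite (_ : [normed series c] = (fun n => \sum_(k < n) `|c k|)); last first.
  by apply/funext => n; rewrite /normed_series_of /= /series /= big_mkord.
apply: nondecreasing_is_cvgn; last by exists M => _ [n _ <-]; exact: cM.
by apply/nondecreasing_seqP => n; rewrite big_ord_recr /= lerDl.
Qed.

Lemma nneseries_EFin (x : nat -> R) (l : R) : (forall k, 0 <= x k) ->
  (fun n => \sum_(k < n) x k) @ \oo --> l ->
  (\sum_(0 <= k <oo) (x k)%:E = l%:E)%E.
Proof.
move=> x0 xl; apply: cvg_lim => //.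
rewrite (_ : (fun n => _) = EFin \o (fun n => \sum_(k < n) x k)); last first.
  by apply/funext => n; rewrite /= big_mkord sumEFin.
by apply: cvg_EFin => //; exact: nearW.
Qed.

Lemma nneseries_partial_le (x : nat -> R) n : (forall k, 0 <= x k) ->
  ((\sum_(k < n) x k)%:E <= \sum_(0 <= k <oo) (x k)%:E)%E.
Proof.
move=> x0; rewrite -sumEFin -(big_mkord xpredT (fun k => (x k)%:E)).
by apply: nneseries_lim_ge => k _ _; rewrite lee_fin.
Qed.

Lemma nneseries_partial_le_fine (x : nat -> R) n : (forall k, 0 <= x k) ->
  (\sum_(0 <= k <oo) (x k)%:E < +oo)%E ->
  \sum_(k < n) x k <= fine (\sum_(0 <= k <oo) (x k)%:E)%E.
Proof.
move=> x0 xoo; rewrite -lee_fin fineK; first exact: nneseries_partial_le.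
by rewrite ge0_fin_numE//; apply: nneseries_ge0 => k _ _; rewrite lee_fin.
Qed.

Lemma nneseries_le_bound (x : nat -> R) (M : \bar R) : (forall k, 0 <= x k) ->
  (forall n, ((\sum_(k < n) x k)%:E <= M)%E) ->
  (\sum_(0 <= k <oo) (x k)%:E <= M)%E.
Proof.
move=> x0 xM; apply: lime_le.
  by apply: is_cvg_nneseries => k _ _; rewrite lee_fin.
by apply: nearW => n; rewrite big_mkord sumEFin.
Qed.

Lemma sum_half_le (n : nat) : \sum_(j < n) (2^-1 : R) ^+ j <= 2.
Proof.
suff -> : \sum_(j < n) (2^-1 : R) ^+ j = 2 - 2 * 2^-1 ^+ n.
  by rewrite gerBl mulr_ge0// exprn_ge0.
elim: n => [|n IH]; first by rewrite big_ord0 expr0 mulr1 subrr.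
by rewrite big_ord_recr /= IH exprS; lra.
Qed.
End series_of_reals.

Section completeness.
Context d (T : measurableType d) (R : realType).
Variable mu : {measure set T -> \bar R}.
Implicit Types (u v w s : L2 mu) (x : nat -> L2 mu).

Lemma l2B_ae u v : {ae mu, forall r, l2repr (u - v) r = u r - v r}.
Proof.
apply: filterS2 (l2D_ae u (- v)) (l2Z_ae (-1) v) => r ->.
by rewrite scaleN1r => ->; rewrite mulN1r.
Qed.

Lemma l2sum_ae x n :
  {ae mu, forall r, l2repr (\sum_(k < n) x k) r = \sum_(k < n) x k r}.
Proof.
elim: n => [|n IH].
  rewrite big_ord0; apply: filterS (l20_ae mu) => r ->.
  by rewrite big_ord0.
rewrite big_ord_recr /=; apply: filterS2 IH (l2D_ae (\sum_(k < n) x k) (x n)) => r h ->.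
by rewrite big_ord_recr /= h.
Qed.

Lemma l2norm_sum_le x n : l2norm (\sum_(k < n) x k) <= \sum_(k < n) l2norm (x k).
Proof.
elim: n => [|n IH]; first by rewrite !big_ord0 /l2norm l2dot0l /= sqrtr0.
rewrite !big_ord_recr /=; apply: le_trans (l2norm_triangle _ _) _.
by rewrite lerD2r.
Qed.

Lemma cmeasurable_sum (f : nat -> T -> R[i]) n :
  (forall k, cmeasurable [set: T] (f k)) ->
  cmeasurable [set: T] (fun r => \sum_(k < n) f k r).
Proof.
move=> mf; elim: n => [|n IH].
  by under eq_fun do rewrite big_ord0; split; exact: measurable_cst.
by under eq_fun do rewrite big_ord_recr /=; exact: cmeasurableD.
Qed.

Lemma cmeasurableB (f g : T -> R[i]) :
  cmeasurable [set: T] f -> cmeasurable [set: T] g ->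
  cmeasurable [set: T] (fun r => f r - g r).
Proof.
move=> [f1 f2] [g1 g2]; split.
- rewrite (_ : (fun _ => _) = (fun r => complex.Re (f r) - complex.Re (g r))).
    exact: measurable_funB.
  by apply/funext => r; rewrite ReD; case: (g r).
- rewrite (_ : (fun _ => _) = (fun r => complex.Im (f r) - complex.Im (g r))).
    exact: measurable_funB.
  by apply/funext => r; rewrite ImD; case: (g r).
Qed.

Local Notation cabs z := (Num.sqrt (sqmod z)).

Lemma cabs_sqr (z : R[i]) : cabs z ^+ 2 = sqmod z.
Proof. exact/sqr_sqrtr/sqmod_ge0. Qed.

Lemma cabsD (z w : R[i]) : cabs (z + w) <= cabs z + cabs w.
Proof. by have := le_normcD z w; case: z w => [a b] [a' b']. Qed.

Lemma cabs_sum_le (z : nat -> R[i]) n :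
  cabs (\sum_(k < n) z k) <= \sum_(k < n) cabs (z k).
Proof.
elim: n => [|n IH]; first by rewrite !big_ord0 sqmod0 sqrtr0.
by rewrite !big_ord_recr /= (le_trans (cabsD _ _))// lerD2r.
Qed.

Lemma measurable_cabs (f : T -> R[i]) : cmeasurable [set: T] f ->
  measurable_fun [set: T] (fun r => cabs (f r)).
Proof.
move=> mf; apply: (measurableT_comp (f := @Num.sqrt R)).
  by apply: continuous_measurable_fun; exact: sqrt_continuous.
exact: measurable_sqmod.
Qed.

Section absolute_series.
Variables (x : nat -> L2 mu) (B : R).
Hypothesis xB : forall n, \sum_(k < n) l2norm (x k) <= B.

Let a k r := cabs (x k r).
Let g n r := \sum_(k < n) a k r.

Let a_ge0 k r : 0 <= a k r. Proof. exact: sqrtr_ge0. Qed.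
Let ma k : measurable_fun [set: T] (a k).
Proof. exact/measurable_cabs/l2_cmeasurable. Qed.
Let mg n : measurable_fun [set: T] (g n).
Proof. by apply: measurable_sum => k. Qed.
Let g_ge0 n r : 0 <= g n r. Proof. exact: sumr_ge0. Qed.
Let g_nd r : nondecreasing_seq (g ^~ r).
Proof. by apply/nondecreasing_seqP => n; rewrite /g big_ord_recr /= lerDl. Qed.

Let int_g n : (\int[mu]_r (g n r ^+ 2)%:E <= (B ^+ 2)%:E)%E.
Proof.
(* The triangle inequality in [L2 mu] is applied to the functions [a k]. *)
pose y k := toL2 mu (fun r => (a k r)%:C%C).
have sa k : square_integrable mu (fun r => (a k r)%:C%C).
  have /square_integrableE[mx ix] := l2P (x k).
  apply/square_integrableE; split; first exact: cmeasurableC.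
  by under eq_integral do rewrite sqmodC cabs_sqr.
have ny k : l2norm (y k) = l2norm (x k).
  rewrite /l2norm; congr Num.sqrt; apply: EFin_inj.
  rewrite -/(nsq _) -/(nsq _) (nsqE (proj1 (sa k)) (toL2_ae (sa k))).
  rewrite (nsqE (l2_cmeasurable (x k)) (aeW _ (fun r => erefl (x k r)))).
  by apply: eq_integral => r _; rewrite sqmodC cabs_sqr.
have Yg : {ae mu, forall r, l2repr (\sum_(k < n) y k) r = (g n r)%:C%C}.
  have h : {ae mu, forall r, forall k, y k r = (a k r)%:C%C}.
    by apply: ae_foralln => k; exact: toL2_ae.
  apply: filterS2 h (l2sum_ae y n) => r h ->.
  by rewrite /g rmorph_sum /=; apply: eq_bigr => k _; exact: h.
have := nsqE (cmeasurableC (mg n)) Yg.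
under eq_integral do rewrite sqmodC; move=> <-.
rewrite lee_fin -l2norm_sq.
have h1 : l2norm (\sum_(k < n) y k) <= B.
  apply: le_trans (l2norm_sum_le y n) _; apply: le_trans (xB n).
  by apply: ler_sum => k _; rewrite ny.
by rewrite ler_sqr ?nnegrE ?l2norm_ge0//; apply: le_trans (l2norm_ge0 _) h1.
Qed.

Let L r : \bar R := limn (fun n => (g n r ^+ 2)%:E).

Let mg2 n : measurable_fun [set: T] (fun r => (g n r ^+ 2)%:E).
Proof. by apply/measurable_EFinP; apply: measurable_funX. Qed.

Let g2_nd r : {homo (fun n => (g n r ^+ 2)%:E) : n m / (n <= m)%N >-> (n <= m)%E}.
Proof. by move=> n m nm; rewrite lee_fin ler_sqr ?nnegrE//; exact: g_nd. Qed.

Let g2_cvg r : (fun n => (g n r ^+ 2)%:E) @ \oo --> L r.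
Proof. by apply: ereal_nondecreasing_is_cvgn; exact: g2_nd. Qed.

Let g_le_L n r : ((g n r ^+ 2)%:E <= L r)%E.
Proof.
apply: lime_ge; first exact: g2_cvg.
by exists n => // m /= nm; exact: g2_nd.
Qed.

Let L_ge0 r : (0 <= L r)%E.
Proof. by apply: le_trans (g_le_L 0 r); rewrite lee_fin sqr_ge0. Qed.

Let mL : measurable_fun [set: T] L.
Proof. by apply: (emeasurable_fun_cvg (fun n r => (g n r ^+ 2)%:E)) => // r _. Qed.

Let int_L : (\int[mu]_r L r <= (B ^+ 2)%:E)%E.
Proof.
rewrite monotone_convergence//.
- apply: lime_le; last by apply: nearW => n; exact: int_g.
  apply: ereal_nondecreasing_is_cvgn => n m nm.
  apply: ge0_le_integral => //.
  + by move=> r _; rewrite lee_fin sqr_ge0.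
  + by move=> r _; exact: g2_nd.
- by move=> n r _; rewrite lee_fin sqr_ge0.
Qed.

Let iL : mu.-integrable [set: T] L.
Proof.
apply/integrableP; split=> //.
under eq_integral do rewrite gee0_abs//.
by apply: le_lt_trans int_L _; rewrite ltry.
Qed.

Let E := [set r | (L r < +oo)%E].
Let mE : measurable E.
Proof.
by rewrite -[E]setTI; exact: emeasurable_fun_infty_o.
Qed.

Let ae_E : {ae mu, forall r, E r}.
Proof.
apply: filterS (integrable_ae measurableT iL) => r /(_ I).
by rewrite ge0_fin_numE.
Qed.

Let h r := fine (L r).
Let h_ge0 r : 0 <= h r. Proof. exact: fine_ge0. Qed.

Let mh : measurable_fun [set: T] h.
Proof. exact: measurableT_comp. Qed.

Let ih8 : mu.-integrable [set: T] (EFin \o (fun r => 8 * h r)).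
Proof.
apply: integrableZl_EFin; apply/integrableP; split.
  exact/measurable_EFinP.
apply: le_lt_trans (ltry (B ^+ 2)); apply: le_trans int_L.
rewrite le_eqVlt; apply/orP; left; apply/eqP; apply: ae_eq_integral => //.
  by apply: measurableT_comp => //; exact/measurable_EFinP.
apply: filterS ae_E => r Er _.
by rewrite gee0_abs /= ?lee_fin ?fine_ge0// fineK ?ge0_fin_numE.
Qed.

(* The terms are replaced by [0] on the null set where the dominating sum is
   infinite, so that the series converges everywhere. *)
Let x' k r := (\1_E r)%:C%C * x k r.
Let S n r := \sum_(k < n) x' k r.

Let x'_E k r : E r -> x' k r = x k r.
Proof. by move=> Er; rewrite /x' indicE mem_set// mul1r. Qed.

Let x'_NE k r : ~ E r -> x' k r = 0.
Proof. by move=> Er; rewrite /x' indicE memNset// mul0r. Qed.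

Let sum_x' n r : \sum_(k < n) cabs (x' k r) <= Num.sqrt (h r).
Proof.
have [Er|nE] := pselect (E r); last first.
  by rewrite big1 ?sqrtr_ge0// => k _; rewrite x'_NE// sqmod0 sqrtr0.
under eq_bigr do rewrite x'_E//.
rewrite -[leLHS](ger0_norm (g_ge0 n r)) -sqrtr_sqr ler_wsqrtr//.
by rewrite -lee_fin fineK ?ge0_fin_numE//; exact: g_le_L.
Qed.

Let S_bound n r : sqmod (S n r) <= h r.
Proof.
rewrite -[leRHS]sqr_sqrtr// -cabs_sqr ler_sqr ?nnegrE ?sqrtr_ge0//.
exact: le_trans (cabs_sum_le (fun k => x' k r) n) (sum_x' n r).
Qed.

Let cvg_Re r : cvgn (fun n => complex.Re (S n r)).
Proof.
rewrite (_ : (fun _ => _) = (fun n => \sum_(k < n) complex.Re (x' k r))); last first.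
  by apply/funext => n; exact: Re_sum.
apply: (@bounded_abs_series_cvg R (fun k => complex.Re (x' k r)) (Num.sqrt (h r))) => n.
by apply: le_trans (sum_x' n r); apply: ler_sum => k _; exact: normr_Re_le.
Qed.

Let cvg_Im r : cvgn (fun n => complex.Im (S n r)).
Proof.
rewrite (_ : (fun _ => _) = (fun n => \sum_(k < n) complex.Im (x' k r))).
  apply: (@bounded_abs_series_cvg R (fun k => complex.Im (x' k r)) (Num.sqrt (h r))) => n.
  apply: le_trans (sum_x' n r); apply: ler_sum => k _.
  by rewrite -sqrtr_sqr ler_wsqrtr// lerDr sqr_ge0.
by apply/funext => n; exact: Im_sum.
Qed.

Let lim_S r : R[i] :=
  Complex (limn (fun n => complex.Re (S n r))) (limn (fun n => complex.Im (S n r))).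

Let mS n : cmeasurable [set: T] (S n).
Proof.
apply: cmeasurable_sum => k; apply: cmeasurableM; last exact: l2_cmeasurable.
by apply: cmeasurableC; exact: measurable_indic.
Qed.

Let m_lim : cmeasurable [set: T] lim_S.
Proof.
split.
- apply: (measurable_fun_cvg (h := fun n r => complex.Re (S n r))).
    by move=> n; case: (mS n).
  by move=> r _; exact: cvg_Re.
- apply: (measurable_fun_cvg (h := fun n r => complex.Im (S n r))).
    by move=> n; case: (mS n).
  by move=> r _; exact: cvg_Im.
Qed.

Let S_cvg r : (fun n => sqmod (lim_S r - S n r)) @ \oo --> (0 : R).
Proof.
rewrite (_ : 0 = (complex.Re (lim_S r) - complex.Re (lim_S r)) ^+ 2 +
  (complex.Im (lim_S r) - complex.Im (lim_S r)) ^+ 2 :> R); last first.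
  by rewrite !subrr expr0n addr0.
rewrite (_ : (fun _ => _) = (fun n =>
  (complex.Re (lim_S r) - complex.Re (S n r)) ^+ 2 +
  (complex.Im (lim_S r) - complex.Im (S n r)) ^+ 2)); last first.
  by apply/funext => n; rewrite /sqmod; case: (lim_S r) => ? ?; case: (S n r).
apply: cvgD; rewrite !expr2; under eq_fun do rewrite expr2.
  by apply: cvgM; apply: cvgB; [exact: cvg_cst|exact: cvg_Re|exact: cvg_cst|exact: cvg_Re].
by apply: cvgM; apply: cvgB; [exact: cvg_cst|exact: cvg_Im|exact: cvg_cst|exact: cvg_Im].
Qed.

Let lim_bound n r : sqmod (lim_S r - S n r) <= 8 * h r.
Proof.
have : (fun m => 2 * sqmod (lim_S r - S m r) + 8 * h r) @ \oo --> 2 * 0 + 8 * h r.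
  by apply: cvgD; [apply: cvgM; [exact: cvg_cst|exact: S_cvg]|exact: cvg_cst].
rewrite mulr0 add0r => hl.
apply: (le_cvg_seq hl) => m.
rewrite (_ : lim_S r - S n r = (lim_S r - S m r) + (S m r - S n r)); last first.
  by rewrite addrA subrK.
apply: le_trans (sqmodD_le _ _) _; rewrite lerD2l.
have := sqmodD_le (S m r) (- S n r); rewrite sqmodN.
by have := S_bound n r; have := S_bound m r; lra.
Qed.

(** The functions [\sum_(k < n) |x k|] increase with [n] and have L2 norm at most
    [B], hence their limit is square-integrable.  It dominates the partial sums
    of the [x k], which therefore converge almost everywhere and in L2. *)
Lemma l2_absolute_series : exists s,
  (fun n => nsq (s - \sum_(k < n) x k)) @ \oo --> (0 : R).
Proof.
have sq : square_integrable mu lim_S.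
  apply: (@square_integrable_le _ _ _ _ _ (fun r => 8 * h r)) => //.
  - by move=> r; have := lim_bound 0 r; rewrite /S big_ord0 subr0.
  - by apply: measurable_funM => //.
  - have /integrableP[_] := ih8.
    by under eq_integral => r _ do rewrite /= ger0_norm ?mulr_ge0//.
exists (toL2 mu lim_S).
have ae_diff n : {ae mu, forall r, l2repr (toL2 mu lim_S - \sum_(k < n) x k) r =
    lim_S r - S n r}.
  apply: filterS2 (l2B_ae (toL2 mu lim_S) (\sum_(k < n) x k)) (filterI ae_E (filterI (toL2_ae sq) (l2sum_ae x n))) => r -> [Er [-> ->]].
  by congr (_ - _); apply: eq_bigr => k _; rewrite x'_E.
have m_diff n : cmeasurable [set: T] (fun r => lim_S r - S n r).
  exact: cmeasurableB.
have := @dominated_convergence _ _ _ mu _ measurableT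
  (fun n r => (sqmod (lim_S r - S n r))%:E) (cst 0%E) _ _ _ _ ih8 _.
case.
- by move=> n; apply/measurable_EFinP; exact: measurable_sqmod.
- exact: measurable_cst.
- by apply: aeW => r _; apply: cvg_EFin; [exact: nearW|exact: S_cvg].
- by apply: aeW => r n _; rewrite gee0_abs ?lee_fin ?sqmod_ge0// lim_bound.
move=> _ _; rewrite integral0 => cv.
apply: (@fine_cvg R _ _ _ (fun n => (nsq (toL2 mu lim_S - \sum_(k < n) x k))%:E)).
rewrite (_ : (fun n => _) = (fun n => \int[mu]_r (sqmod (lim_S r - S n r))%:E)%E) //.
by apply/funext => n; exact: nsqE.
Qed.
End absolute_series.
End completeness.

(** * Orthonormal bases *)

Section orthonormal_bases.
Context d (T : measurableType d) (R : realType).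
Variable mu : {measure set T -> \bar R}.
Implicit Types (u v w s : L2 mu).

Variable e : nat -> L2 mu.
Hypothesis onb_e : orthonormal_basis e.

Let dot_e m n : l2dot (e m) (e n) = (m == n)%:R.
Proof. by case: onb_e. Qed.

Let nsq_e n : nsq (e n) = 1.
Proof. by rewrite /nsq dot_e eqxx. Qed.

Definition onb_proj n u := \sum_(k < n) l2dot u (e k) *: e k.

Lemma onb_proj_dot n u i :
  l2dot (onb_proj n u) (e i) = if (i < n)%N then l2dot u (e i) else 0.
Proof.
rewrite l2dot_suml; under eq_bigr do rewrite l2dotZl dot_e.
case: ltnP => [iltn|nlei].
  rewrite (bigD1 (Ordinal iltn))//= eqxx mulr1 big1 ?addr0// => k /eqP ki.
  by rewrite (_ : (_ == _) = false) ?mulr0//; apply/eqP => ki'; apply: ki; exact: val_inj.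
rewrite big1// => k _; rewrite (_ : (_ == _) = false) ?mulr0//.
by apply/eqP => ki; move: nlei; rewrite -ki leqNgt ltn_ord.
Qed.

Lemma onb_projS n u : onb_proj n.+1 u = onb_proj n u + l2dot u (e n) *: e n.
Proof. by rewrite /onb_proj big_ord_recr. Qed.

Lemma nsq_onb_projB n u :
  nsq (u - onb_proj n u) = nsq u - \sum_(k < n) sqmod (l2dot u (e k)).
Proof.
elim: n => [|n IH]; first by rewrite /onb_proj !big_ord0 !subr0.
rewrite onb_projS big_ord_recr /= opprD addrA nsqD IH nsqN nsqZ nsq_e mulr1.
rewrite l2dotNr l2dotZr l2dotBl onb_proj_dot ltnn subr0 [conjc _ * _]mulrC mul_conjc /=.
by lra.
Qed.

Lemma bessel n u : \sum_(k < n) sqmod (l2dot u (e k)) <= nsq u.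
Proof. by rewrite -subr_ge0 -nsq_onb_projB nsq_ge0. Qed.

Lemma nsq_onb_proj_nonincreasing m n u : (m <= n)%N ->
  nsq (u - onb_proj n u) <= nsq (u - onb_proj m u).
Proof.
move=> mn; rewrite !nsq_onb_projB lerD2l lerN2.
rewrite -!(big_mkord xpredT (fun k => sqmod (l2dot u (e k)))).
by rewrite [leRHS](big_cat_nat _ mn)//= lerDl sumr_ge0// => k _; exact: sqmod_ge0.
Qed.

Lemma nsq_onb_proj n u : nsq (onb_proj n u) = \sum_(k < n) sqmod (l2dot u (e k)).
Proof.
have := nsqD (u - onb_proj n u) (onb_proj n u); rewrite subrK nsq_onb_projB.
rewrite [X in _ + 2 * complex.Re X](_ : _ = 0); first by rewrite mulr0 addr0; lra.
rewrite {2}/onb_proj l2dot_sumr big1// => k _.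
by rewrite l2dotZr l2dotBl onb_proj_dot ltn_ord subrr mulr0.
Qed.

Lemma nsq_onb_proj_diff m n u : (m <= n)%N ->
  nsq (onb_proj n u - onb_proj m u) =
  \sum_(k < n) sqmod (l2dot u (e k)) - \sum_(k < m) sqmod (l2dot u (e k)).
Proof.
move=> mn; rewrite -nsq_onb_proj.
rewrite (_ : onb_proj m u = onb_proj m (onb_proj n u)); last first.
  by apply: eq_bigr => k _; rewrite onb_proj_dot (leq_trans (ltn_ord k)).
rewrite nsq_onb_projB; congr (_ - _); apply: eq_bigr => k _.
by rewrite onb_proj_dot (leq_trans (ltn_ord k)).
Qed.

(** A subsequence of the projections with increments of norm at most [2^-j]
    converges.  Its limit has the same coefficients as [u], so it is [u], and
    the whole sequence follows since the distances to [u] do not increase. *)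
Lemma onb_proj_cvg u : (fun n => nsq (u - onb_proj n u)) @ \oo --> (0 : R).
Proof.
pose a n := \sum_(k < n) sqmod (l2dot u (e k)).
have a_nd : nondecreasing_seq a.
  by apply/nondecreasing_seqP => n; rewrite /a big_ord_recr /= lerDl sqmod_ge0.
have a_cvg : cvgn a.
  apply: nondecreasing_is_cvgn => //.
  by exists (nsq u) => _ [n _ <-]; exact: bessel.
have a_le n : a n <= limn a by exact: nondecreasing_cvgn_le.
have /choice[phi phiP] : forall j : nat, exists N, limn a - a N <= (2^-1 ^+ j) ^+ 2.
  move=> j; have e0 : 0 < (2^-1 ^+ j : R) ^+ 2 by rewrite !exprn_gt0.
  have /cvgrPdist_le/(_ _ e0)[N _ NP] := a_cvg.
  by exists N; apply: le_trans (ler_norm _) _; exact: (NP N (leqnn N)).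
(* [nn] is strictly increasing and lies above [phi]. *)
pose nn j := (\sum_(i < j.+1) (phi i).+1)%N.
have nn_phi j : (phi j <= nn j)%N.
  by rewrite /nn big_ord_recr /= (leq_trans (leqnSn _))// leq_addl.
have nn_S j : nn j.+1 = (nn j + (phi j.+1).+1)%N by rewrite /nn big_ord_recr.
have nn_gt j : (j < nn j)%N.
  elim: j => [|j IH]; first by rewrite /nn big_ord_recr /= big_ord0.
  by rewrite nn_S addnS ltnS (leq_trans IH)// leq_addr.
pose x j := onb_proj (nn j.+1) u - onb_proj (nn j) u.
have xj j : l2norm (x j) <= 2^-1 ^+ j.
  rewrite -[leRHS]ger0_norm ?exprn_ge0// -sqrtr_sqr ler_wsqrtr//.
  rewrite -/(nsq _) nsq_onb_proj_diff; last by rewrite nn_S leq_addr.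
  apply: le_trans (phiP j); apply: lerB; first exact: a_le.
  exact: a_nd.
have [|s' s'P] := @l2_absolute_series _ _ _ mu x 2.
  by move=> n; apply: le_trans (sum_half_le R n); exact: ler_sum.
pose s := s' + onb_proj (nn 0) u.
have sP : (fun n => nsq (s - onb_proj (nn n) u)) @ \oo --> (0 : R).
  rewrite (_ : (fun n => _) = (fun n => nsq (s' - \sum_(k < n) x k)))//.
  apply/funext => n; congr nsq; rewrite /s -addrA; congr (_ + _).
  elim: n => [|n IH]; first by rewrite big_ord0 subrr oppr0.
  by rewrite big_ord_recr /= opprD -IH /x opprB addrA subrK.
have us : u = s.
  apply/eqP; rewrite -subr_eq0; apply/eqP; case: onb_e => _; apply => i.
  apply: sqmod_eq0; apply/eqP; rewrite eq_le sqmod_ge0 andbT.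
  have := sP; rewrite -(cvg_shiftn i) => h; apply: (le_cvg_seq h) => j /=.
  rewrite (_ : l2dot _ _ = - l2dot (s - onb_proj (nn (j + i)) u) (e i)).
    rewrite sqmodN; apply: le_trans (l2dot_CS _ _) _.
    by rewrite nsq_e mulr1.
  have ilt : (i < nn (j + i))%N by rewrite (leq_ltn_trans _ (nn_gt _))// leq_addl.
  by rewrite !l2dotBl onb_proj_dot ilt opprB.
apply/cvgrPdist_le => eps eps0.
move: sP; rewrite -us => /cvgrPdist_le/(_ _ eps0)[N _ NP].
exists (nn N) => // m /= Nm; rewrite sub0r normrN ger0_norm ?nsq_ge0//.
apply: le_trans (nsq_onb_proj_nonincreasing u Nm) _.
by have := NP N (leqnn N); rewrite sub0r normrN ger0_norm ?nsq_ge0.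
Qed.

Lemma parseval u :
  (fun n => \sum_(k < n) sqmod (l2dot u (e k))) @ \oo --> nsq u.
Proof.
rewrite (_ : (fun n => _) = (fun n => nsq u - nsq (u - onb_proj n u))).
  by rewrite -[nsq u in X in _ --> X]subr0; apply: cvgB; [exact: cvg_cst|exact: onb_proj_cvg].
by apply/funext => n; rewrite nsq_onb_projB opprB addrC subrK.
Qed.

Lemma parseval_ereal u :
  (\sum_(0 <= k <oo) (sqmod (l2dot u (e k)))%:E = (nsq u)%:E)%E.
Proof.
by apply: nneseries_EFin => [k|]; [exact: sqmod_ge0|exact: parseval].
Qed.
End orthonormal_bases.

(** * Positive operators *)

Section positive_operators.
Context d (T : measurableType d) (R : realType).
Variable mu : {measure set T -> \bar R}.
Implicit Types (u v w x : L2 mu) (S P A : L2 mu -> L2 mu).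

Lemma l2dot_extl u v : (forall w, l2dot u w = l2dot v w) -> u = v.
Proof.
move=> uv; apply/eqP; rewrite -subr_eq0; apply/eqP/nsq_eq0.
by rewrite /nsq l2dotBl uv subrr.
Qed.

Lemma l2dot_extr u v : (forall w, l2dot w u = l2dot w v) -> u = v.
Proof. by move=> uv; apply: l2dot_extl => w; rewrite l2dotC uv -l2dotC. Qed.

Lemma adjointE S S' : (forall u v, l2dot (S u) v = l2dot u (S' v)) ->
  adjoint S = S'.
Proof.
move=> SS'; apply: xget_unique => // S'' h; apply/funext => v.
by apply: l2dot_extr => w; rewrite -SS' h.
Qed.

Lemma linear_lmodZD S : linear S -> forall a u v, S (a *: u + v) = a *: S u + S v.
Proof. by []. Qed.

Lemma linear_lmodD S : linear S -> {morph S : u v / u + v}.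
Proof. by move=> lS u v; have := lS 1 u v; rewrite !scale1r. Qed.

Lemma linear_lmod0 S : linear S -> S 0 = 0.
Proof. by move=> lS; apply/(addrI (S 0)); rewrite -(linear_lmodD lS) !addr0. Qed.

Lemma linear_lmodZ S : linear S -> forall a u, S (a *: u) = a *: S u.
Proof. by move=> lS a u; have := linear_lmodZD lS a u 0; rewrite (linear_lmod0 lS) !addr0. Qed.

Lemma linear_lmodN S : linear S -> forall u, S (- u) = - S u.
Proof. by move=> lS u; rewrite -scaleN1r (linear_lmodZ lS) scaleN1r. Qed.

Lemma linear_lmodB S : linear S -> forall u v, S (u - v) = S u - S v.
Proof. by move=> lS u v; rewrite (linear_lmodD lS) (linear_lmodN lS). Qed.

Lemma linear_lmod_sum S I (r : seq I) (P : pred I) (f : I -> L2 mu) : linear S ->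
  S (\sum_(k <- r | P k) f k) = \sum_(k <- r | P k) S (f k).
Proof.
by move=> lS; apply: (big_morph S); [exact: linear_lmodD|exact: linear_lmod0].
Qed.

(** [positive_op] bounds only the quadratic form from below; the order of [R[i]]
    makes that form real-valued, hence Hermitian. *)
Lemma positive_psd S : linear S -> positive_op S ->
  psd_form (fun u v => l2dot (S u) v).
Proof.
move=> lS S0; have Im0 u : complex.Im (l2dot (S u) u) = 0.
  by have := S0 u; rewrite lecE => /andP[/eqP].
split.
- by move=> a u v w; rewrite lS l2dotDl l2dotZl.
- apply: (@real_diag_hermitian _ _ (fun u v => l2dot (S u) v)) => //.
  + by move=> u v w; rewrite (linear_lmodD lS) l2dotDl.
  + by move=> u v w; rewrite l2dotDr.
  + by move=> c u w; rewrite (linear_lmodZ lS) l2dotZl.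
  + by move=> c u w; rewrite l2dotZr.
- by move=> u; have := S0 u; rewrite lecE => /andP[].
Qed.

Lemma positive_sym S : linear S -> positive_op S ->
  forall u v, l2dot (S u) v = l2dot u (S v).
Proof.
by move=> lS S0 u v; rewrite (formC (positive_psd lS S0)) -l2dotC.
Qed.

Lemma positive_adjoint S : linear S -> positive_op S -> adjoint S = S.
Proof. by move=> lS S0; apply: adjointE; exact: positive_sym. Qed.

Lemma bounded_op_nsq S : bounded_op S ->
  exists2 M, 0 <= M & forall u, nsq (S u) <= M * nsq u.
Proof.
move=> [_ [M MP]]; exists (M ^+ 2); first exact: sqr_ge0.
move=> u; rewrite -!l2norm_sq -exprMn.
have h := MP u; have h0 := l2norm_ge0 (S u).
by rewrite ler_sqr// nnegrE (le_trans h0 h).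
Qed.

Lemma bounded_op_of_nsq S M : linear S -> (forall u, nsq (S u) <= M * nsq u) ->
  bounded_op S.
Proof.
move=> lS MP; split=> //; exists (Num.sqrt `|M|) => u.
rewrite /l2norm -sqrtrM// ler_wsqrtr//; apply: le_trans (MP u) _.
by rewrite ler_wpM2r ?nsq_ge0// ler_norm.
Qed.

Lemma Re_l2dot_le u v : complex.Re (l2dot u v) <= nsq u + nsq v.
Proof.
have := nsq_ge0 (u - v); rewrite nsqD nsqN l2dotNr.
have := nsq_ge0 u; have := nsq_ge0 v.
by case: (l2dot u v) => a b /=; lra.
Qed.

(** The inequality is Cauchy--Schwarz for the form of [S] at [S u] and [u]. *)
Lemma positive_nsq_le S (M : R) : linear S -> positive_op S -> 0 <= M ->
  (forall u, nsq (S u) <= M * nsq u) ->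
  forall u, nsq (S u) <= (M + 1) * complex.Re (l2dot (S u) u).
Proof.
move=> lS S0 M0 SM u; have pS := positive_psd lS S0.
have := form_CS pS u (S u); rewrite l2dot_nsq sqmodC.
have a0 := form_ge0 pS u; set a := complex.Re (l2dot (S u) u) in a0 *.
set b := complex.Re (l2dot (S (S u)) (S u)) => h.
have b_le : b <= (M + 1) * nsq (S u).
  apply: le_trans (Re_l2dot_le _ _) _; rewrite mulrDl mul1r lerD2r.
  exact: SM.
have n0 := nsq_ge0 (S u).
have [->|nn0] := eqVneq (nsq (S u)) 0; first by rewrite mulr_ge0// addr_ge0.
have np : 0 < nsq (S u) by rewrite lt_neqAle eq_sym nn0.
rewrite -(ler_pM2r np) -expr2; apply: le_trans h _.
by rewrite [(M + 1) * a]mulrC -mulrA ler_wpM2l.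
Qed.

(** Set [X := P - S] and [Y := P + S], so that [X Y + Y X = 0].  At a unit
    vector [u] where [X] almost attains its norm, [X (X u)] is close to [K u]
    with [K] the square of that norm, hence
    [<Y (X u), X u> = - <Y (X (X u)), u>] is close to [- K <Y u, u>].  Both
    [<Y (X u), X u>] and [<Y u, u>] are nonnegative, so [<Y u, u>] is small,
    which makes [P u], [S u] and [X u] small. *)
Lemma positive_sqrt_unique P S : bounded_op P -> positive_op P ->
  bounded_op S -> positive_op S -> P \o P = S \o S -> P = S.
Proof.
move=> bP P0 bS S0 PS; have [lP _] := bP; have [lS _] := bS.
have [MP MP0 MPP] := bounded_op_nsq bP.
have [MS MS0 MSP] := bounded_op_nsq bS.
have PPu u : P (P u) = S (S u) by have := congr1 (fun f => f u) PS.
have [pP pS] := (positive_psd lP P0, positive_psd lS S0).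
pose X u := P u - S u; pose Y u := P u + S u.
have XD u v : X (u + v) = X u + X v.
  by rewrite /X (linear_lmodD lP) (linear_lmodD lS) opprD addrACA.
have XZ a u : X (a *: u) = a *: X u.
  by rewrite /X (linear_lmodZ lP) (linear_lmodZ lS) scalerBr.
have YD u v : Y (u + v) = Y u + Y v.
  by rewrite /Y (linear_lmodD lP) (linear_lmodD lS) addrACA.
have YZ a u : Y (a *: u) = a *: Y u.
  by rewrite /Y (linear_lmodZ lP) (linear_lmodZ lS) scalerDr.
have Xsym u v : l2dot (X u) v = l2dot u (X v).
  by rewrite /X l2dotBl l2dotBr !positive_sym.
have XY u : X (Y u) = - Y (X u).
  rewrite /X /Y (linear_lmodD lP) (linear_lmodD lS) (linear_lmodB lP) (linear_lmodB lS).
  rewrite PPu [S (P u) + _]addrC opprD addrACA subrr add0r.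
  by rewrite [S (S u) - _ + _]addrC addrA subrK opprB.
pose C1 : R := 2 * (MP + 1) + 2 * (MS + 1); pose C2 : R := 2 * (MP + MS).
have C10 : 0 <= C1 by rewrite /C1; lra.
have C20 : 0 <= C2 by rewrite /C2; lra.
have Y0 u : 0 <= complex.Re (l2dot (Y u) u).
  by rewrite l2dotDl ReD; have := form_ge0 pP u; have := form_ge0 pS u; lra.
have X_le_Y u : nsq (X u) <= C1 * complex.Re (l2dot (Y u) u).
  apply: le_trans (nsqD_le _ _) _; rewrite nsqN l2dotDl ReD /C1.
  have := positive_nsq_le lP P0 MP0 MPP u; have := positive_nsq_le lS S0 MS0 MSP u.
  have := form_ge0 pP u; have := form_ge0 pS u.
  move: (complex.Re _) (complex.Re _) => p q.
  by move: (nsq _) (nsq _) => a b *; nra.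
have Y_le u : nsq (Y u) <= C2 * nsq u.
  apply: le_trans (nsqD_le _ _) _; rewrite /C2.
  by have := MPP u; have := MSP u; lra.
pose A := [set nsq (X u) | u in [set u | nsq u <= 1]].
have A_sup : has_sup A.
  split; first by exists (nsq (X 0)), 0 => //=; rewrite nsq0.
  exists (2 * (MP + MS)) => _ [u /= u1 <-].
  apply: le_trans (nsqD_le _ _) _; rewrite nsqN.
  by have := MPP u; have := MSP u; nra.
pose K := sup A.
have A_le u : nsq u <= 1 -> nsq (X u) <= K.
  by move=> u1; apply: ub_le_sup; [case: A_sup|exists u].
have X_le u : nsq (X u) <= K * nsq u.
  have [u0|un0] := eqVneq (nsq u) 0.
    by rewrite (nsq_eq0 u0) -(scale0r (0 : L2 mu)) XZ !scale0r nsq0 mulr0.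
  have up : 0 < nsq u by rewrite lt_neqAle eq_sym un0 nsq_ge0.
  have := A_le ((Num.sqrt (nsq u))^-1%:C%C *: u).
  rewrite XZ !nsqZ sqmodC exprVn sqr_sqrtr ?nsq_ge0// mulVf// => /(_ (lexx _)).
  by rewrite mulrC ler_pdivrMr.
have [K0|Kp] := leP K 0.
  apply/funext => u; apply/eqP; rewrite -subr_eq0; apply/eqP/nsq_eq0/eqP.
  rewrite eq_le nsq_ge0 andbT; apply: le_trans (X_le u) _.
  by rewrite mulr_le0_ge0 ?nsq_ge0.
exfalso.
pose D : R := 8 * C1 ^+ 2 * C2.
have D0 : 0 <= D by apply: mulr_ge0 => //; apply: mulr_ge0 => //; exact: sqr_ge0.
(* Small enough for [h9] and [h11] to be incompatible. *)
pose del : R := Num.min (K / 2) (K ^+ 3 / (2 * (D + 1))).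
have delp : 0 < del.
  by rewrite lt_min !divr_gt0 ?exprn_gt0//; lra.
have [_ [u /= u1 <-] Ku] := sup_adherent delp A_sup.
pose y := complex.Re (l2dot (Y u) u).
have del1 : del <= K / 2 by rewrite ge_min lexx.
have h1 : K / 2 <= C1 * y.
  by apply: le_trans (X_le_Y u); move: Ku; rewrite -/K; lra.
pose z := X (X u) - K%:C%C *: u.
have nz : nsq z <= 2 * K * del.
  rewrite nsqD nsqN nsqZ sqmodC l2dotNr l2dotZr Xsym l2dot_nsq.
  have h3 := X_le (X u); have h4 := A_le u u1; move: Ku; rewrite -/K => Ku.
  rewrite [complex.Re _](_ : _ = - (K * nsq (X u))); last first.
    by rewrite /=; ring.
  move: h3 h4 Ku u1 (nsq_ge0 u); move: (nsq (X (X u))) (nsq (X u)) (nsq u).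
  move=> a b c h3 h4 Ku u1 c0.
  have h5 : K * b <= K * K by rewrite ler_wpM2l// ltW.
  have h6 : K * (K - del) <= K * b by rewrite ler_wpM2l ?ltW.
  have h7 : K ^+ 2 * c <= K ^+ 2 * 1 by rewrite ler_wpM2l// sqr_ge0.
  by move: h5 h6 h7; rewrite expr2 !mulrBr; lra.
have h2 : (K * y) ^+ 2 <= C2 * (2 * K * del).
  have e1 : l2dot (Y (X u)) (X u) = - (l2dot (Y z) u + K%:C%C * l2dot (Y u) u).
    rewrite -Xsym (_ : X (Y (X u)) = - Y (X (X u)))// l2dotNl; congr (- _).
    by rewrite -l2dotZl -YZ -l2dotDl -YD /z subrK.
  have := Y0 (X u); rewrite e1 => h3.
  have {h3} Ky : K * y <= - complex.Re (l2dot (Y z) u).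
    by move: h3; rewrite ReN ReD ReCM -/y; lra.
  have y0 : 0 <= K * y by rewrite mulr_ge0 ?Y0// ltW.
  apply: (@le_trans _ _ (sqmod (l2dot (Y z) u))).
    apply: (@le_trans _ _ (complex.Re (l2dot (Y z) u) ^+ 2)).
      by rewrite -[leRHS]sqrrN ler_sqr// nnegrE (le_trans y0).
    by rewrite lerDl sqr_ge0.
  apply: le_trans (l2dot_CS _ _) _.
  apply: (@le_trans _ _ (nsq (Y z) * 1)).
    by rewrite ler_wpM2l// nsq_ge0.
  rewrite mulr1; apply: le_trans (Y_le z) _.
  by rewrite ler_wpM2l.
have h8 : (K ^+ 2 / 2) ^+ 2 <= C1 ^+ 2 * (C2 * (2 * K * del)).
  apply: (@le_trans _ _ ((C1 * (K * y)) ^+ 2)).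
    rewrite ler_sqr ?nnegrE; last first.
    - by rewrite !mulr_ge0 ?Y0// ltW.
    - by rewrite mulr_ge0// sqr_ge0.
    by rewrite [leRHS]mulrCA expr2 -mulrA ler_wpM2l// ltW.
  by rewrite exprMn ler_wpM2l// sqr_ge0.
have h9 : K ^+ 3 <= D * del.
  rewrite -(ler_pM2l Kp) -subr_ge0.
  rewrite (_ : _ - _ = 4 * (C1 ^+ 2 * (C2 * (2 * K * del)) - (K ^+ 2 / 2) ^+ 2)); last first.
    by rewrite /D; field.
  by rewrite mulr_ge0// subr_ge0.
have h10 : D * del <= D * (K ^+ 3 / (2 * (D + 1))).
  by rewrite ler_wpM2l// ge_min lexx orbT.
have h11 : D * (K ^+ 3 / (2 * (D + 1))) < K ^+ 3.
  rewrite mulrCA gtr_pMr ?exprn_gt0// ltr_pdivrMr; lra.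
by have := le_lt_trans (le_trans h9 h10) h11; rewrite ltxx.
Qed.

End positive_operators.

(** * Positive operators as sums of rank-one operators *)

Section complex_limits.
Variable R : realType.
Implicit Types (z : nat -> R[i]) (l : R[i]).

(** Convergence in [R[i]], expressed on the squared modulus so that all estimates
    take place in [R]. *)
Definition ccvg z l := (fun n => sqmod (l - z n)) @ \oo --> (0 : R).

Lemma ccvg_le z l (b : nat -> R) : (forall n, sqmod (l - z n) <= b n) ->
  b @ \oo --> (0 : R) -> ccvg z l.
Proof.
move=> zb b0; apply: (@squeeze_cvgr _ _ _ _ (cst 0) b) => //; last exact: cvg_cst.
by apply: nearW => n; rewrite sqmod_ge0 zb.
Qed.

Lemma ccvg_Re z l : ccvg z l -> (fun n => complex.Re (z n)) @ \oo --> complex.Re l.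
Proof.
move=> zl; apply/cvgrPdist_le => e e0.
have e20 : 0 < e ^+ 2 by rewrite exprn_gt0.
move/cvgrPdist_le: zl => /(_ _ e20)[N _ NP]; exists N => // n /= Nn.
have := NP n Nn; rewrite sub0r normrN ger0_norm ?sqmod_ge0// => h.
rewrite -ReN -ReD -(ler_sqr (normr_ge0 _) (ltW e0)) real_normK ?num_real//.
by apply: le_trans h; rewrite lerDl sqr_ge0.
Qed.

Lemma ccvg_Im z l : ccvg z l -> (fun n => complex.Im (z n)) @ \oo --> complex.Im l.
Proof.
move=> zl; apply/cvgrPdist_le => e e0.
have e20 : 0 < e ^+ 2 by rewrite exprn_gt0.
move/cvgrPdist_le: zl => /(_ _ e20)[N _ NP]; exists N => // n /= Nn.
have := NP n Nn; rewrite sub0r normrN ger0_norm ?sqmod_ge0// => h.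
rewrite -ImN -ImD -(ler_sqr (normr_ge0 _) (ltW e0)) real_normK ?num_real//.
by apply: le_trans h; rewrite lerDr sqr_ge0.
Qed.

Lemma ccvgI z l : (fun n => complex.Re (z n)) @ \oo --> complex.Re l ->
  (fun n => complex.Im (z n)) @ \oo --> complex.Im l -> ccvg z l.
Proof.
move=> zr zi; rewrite /ccvg.
have h1 : (fun n => complex.Re l - complex.Re (z n)) @ \oo --> (0 : R).
  by rewrite -(subrr (complex.Re l)); apply: cvgB => //; exact: cvg_cst.
have h2 : (fun n => complex.Im l - complex.Im (z n)) @ \oo --> (0 : R).
  by rewrite -(subrr (complex.Im l)); apply: cvgB => //; exact: cvg_cst.
rewrite [X in _ --> X](_ : 0 = 0 * 0 + 0 * 0 :> R); last by rewrite mul0r addr0.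
rewrite (_ : (fun n => sqmod _) = (fun n => (complex.Re l - complex.Re (z n)) *
  (complex.Re l - complex.Re (z n)) + (complex.Im l - complex.Im (z n)) *
  (complex.Im l - complex.Im (z n)))).
  by apply: cvgD; exact: cvgM.
by apply/funext => n; rewrite /sqmod ReD ImD ReN ImN !expr2.
Qed.

Lemma ccvg_eq z z' l : z =1 z' -> ccvg z l -> ccvg z' l.
Proof. by move=> /funext ->. Qed.

Lemma ccvg_unique z l l' : ccvg z l -> ccvg z l' -> l = l'.
Proof.
move=> zl zl'; apply/eqP; rewrite eq_complex; apply/andP; split; apply/eqP.
- by rewrite -(cvg_lim _ (ccvg_Re zl))// -(cvg_lim _ (ccvg_Re zl')).
- by rewrite -(cvg_lim _ (ccvg_Im zl))// -(cvg_lim _ (ccvg_Im zl')).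
Qed.

Lemma ccvgZD a z z' l l' : ccvg z l -> ccvg z' l' ->
  ccvg (fun n => a * z n + z' n) (a * l + l').
Proof.
move=> zl zl'; apply: (@ccvg_le _ _ (fun n => 2 * (sqmod a * sqmod (l - z n)) + 2 * sqmod (l' - z' n))).
  move=> n; rewrite opprD addrACA -mulrBr -sqmodM; exact: sqmodD_le.
rewrite [X in _ --> X](_ : 0 = 2 * (sqmod a * 0) + 2 * 0 :> R); last by rewrite !mulr0 addr0.
apply: cvgD; apply: cvgM; [exact: cvg_cst| |exact: cvg_cst|exact: zl'].
by apply: cvgM; [exact: cvg_cst|exact: zl].
Qed.

Lemma ccvg_suml n (z : nat -> nat -> R[i]) (l : nat -> R[i]) :
  (forall k, ccvg (z k) (l k)) ->
  ccvg (fun m => \sum_(k < n) z k m) (\sum_(k < n) l k).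
Proof.
move=> zl; elim: n => [|n IH].
  by apply: (@ccvg_le _ _ (cst 0)); [move=> m; rewrite !big_ord0 subr0 sqmod0|exact: cvg_cst].
apply: ccvgI.
  rewrite big_ord_recr ReD /=; under eq_fun do rewrite big_ord_recr ReD /=.
  by apply: cvgD; [exact: ccvg_Re|exact: ccvg_Re].
rewrite big_ord_recr ImD /=; under eq_fun do rewrite big_ord_recr ImD /=.
by apply: cvgD; [exact: ccvg_Im|exact: ccvg_Im].
Qed.

Lemma ccvg_topology z l : ccvg z l -> z @ \oo --> (l : R[i]^o).
Proof.
move=> zl; apply/(cvgrPdist_lt (z : nat -> R[i]^o) (l : R[i]^o)) => e e0.
have [e1 ee] : 0 < complex.Re e /\ e = (complex.Re e)%:C%C.
  move: e0; rewrite ltcE /= => /andP[/eqP ie re]; split=> //.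
  by move: ie; case: (e) => a b /= ->.
have e20 : 0 < complex.Re e ^+ 2 by rewrite exprn_gt0.
move/cvgrPdist_lt: zl => /(_ _ e20)[N _ NP]; exists N => // n /= Nn.
have := NP n Nn; rewrite sub0r normrN ger0_norm ?sqmod_ge0// => h.
rewrite ee normc_def ltcR -/(sqmod _) -(gtr0_norm e1) -sqrtr_sqr.
by rewrite ltr_sqrt.
Qed.

(** Dominated convergence for series: the tails are uniformly small in [N], and
    the finite parts converge term by term. *)
Lemma tannery (a : nat -> nat -> R) (b l A : nat -> R) (B L : R) :
  (forall N k, `|a N k| <= b k) -> (forall k, a ^~ k @ \oo --> l k) ->
  (forall n, \sum_(k < n) b k <= B) ->
  (forall N, (fun n => \sum_(k < n) a N k) @ \oo --> A N) ->
  (fun n => \sum_(k < n) l k) @ \oo --> L ->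
  A @ \oo --> L.
Proof.
move=> ab al bB aA lL.
have b0 k : 0 <= b k by apply: le_trans (ab 0%N k).
have lb k : `|l k| <= b k.
  by apply: (cvg_seq_le (cvg_norm (al k))) => N; exact: ab.
pose sb n := \sum_(k < n) b k.
have sb_nd : nondecreasing_seq sb.
  by apply/nondecreasing_seqP => n; rewrite /sb big_ord_recr /= lerDl.
have sb_cvg : cvgn sb.
  by apply: nondecreasing_is_cvgn => //; exists B => _ [n _ <-]; exact: bB.
have tail (c : nat -> R) (C : R) K : (forall k, `|c k| <= b k) ->
    (fun n => \sum_(k < n) c k) @ \oo --> C ->
    `|C - \sum_(k < K) c k| <= limn sb - sb K.
  move=> cb cC.
  have h : (fun n => `|\sum_(k < n) c k - \sum_(k < K) c k|) @ \oo -->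
      `|C - \sum_(k < K) c k|.
    by apply: cvg_norm; apply: cvgB => //; exact: cvg_cst.
  rewrite -(cvg_shiftn K) in h.
  apply: (cvg_seq_le h) => n.
  have e1 (f : nat -> R) : \sum_(k < n + K) f k - \sum_(k < K) f k =
      \sum_(K <= k < n + K) f k.
    rewrite -!(big_mkord xpredT f) (big_cat_nat _ (leq_addl n K))//=.
    by rewrite addrAC subrr add0r.
  rewrite /= e1; apply: (@le_trans _ _ (sb (n + K)%N - sb K)); last first.
    by rewrite lerD2r; exact: nondecreasing_cvgn_le.
  rewrite /sb e1; apply: le_trans (ler_norm_sum _ _ _) _.
  exact: ler_sum.
apply/cvgrPdist_le => e e0.
have e3 : 0 < e / 3 by rewrite divr_gt0.
have /cvgrPdist_le/(_ _ e3)[K _ KP] := sb_cvg.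
have {KP} tK : limn sb - sb K <= e / 3.
  by apply: le_trans (ler_norm _) (KP K (leqnn K)).
have fin : (fun N => \sum_(k < K) a N k) @ \oo --> \sum_(k < K) l k.
  by apply: cvg_big => [|i _]; [exact: add_continuous|exact: al].
move/cvgrPdist_le: fin => /(_ _ e3)[N0 _ N0P]; exists N0 => // N /= N0N.
have h1 := tail _ _ K (ab N) (aA N); have h2 := tail _ _ K lb lL.
have h3 := N0P N N0N.
rewrite (_ : L - A N = (L - \sum_(k < K) l k) + (\sum_(k < K) l k -
  \sum_(k < K) a N k) - (A N - \sum_(k < K) a N k)); last by ring.
apply: le_trans (ler_normB _ _) _.
have h4 := ler_normD (L - \sum_(k < K) l k) (\sum_(k < K) l k - \sum_(k < K) a N k).
by lra.
Qed.
End complex_limits.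

Section gram.
Context d (T : measurableType d) (R : realType).
Variable mu : {measure set T -> \bar R}.
Implicit Types (u v w x : L2 mu) (S A W : L2 mu -> L2 mu) (e : nat -> L2 mu).

(** [S] is the sum of the rank-one operators [u |-> <u, v k> v k], whose traces
    [nsq (v k)] are summable. *)
Definition gram S (v : nat -> L2 mu) :=
  (forall u w, ccvg (fun n => \sum_(k < n) (l2dot u (v k) * l2dot (v k) w))
     (l2dot (S u) w)) /\
  (\sum_(0 <= k <oo) (nsq (v k))%:E < +oo)%E.

(** When the form of [A] vanishes at [x], so does [A x], and the inverse of [0]
    makes the pivot [0]. *)
Definition pivot A x : L2 mu :=
  ((Num.sqrt (complex.Re (l2dot (A x) x)))^-1)%:C%C *: A x.

Definition deflate A x u := A u - l2dot u (pivot A x) *: pivot A x.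

Section deflation.
Variables (A : L2 mu -> L2 mu) (x : L2 mu).
Hypotheses (lA : linear A) (A0 : positive_op A).

Lemma deflate_linear : linear (deflate A x).
Proof.
move=> a u v; rewrite /deflate lA l2dotDl l2dotZl scalerDl -scalerA scalerBr.
by rewrite opprD addrACA.
Qed.

Lemma deflate_dot u w : l2dot (deflate A x u) w =
  l2dot (A u) w - l2dot u (pivot A x) * l2dot (pivot A x) w.
Proof. by rewrite /deflate l2dotBl l2dotZl. Qed.

Lemma sqmod_pivot u : sqmod (l2dot u (pivot A x)) =
  (complex.Re (l2dot (A x) x))^-1 * sqmod (l2dot (A x) u).
Proof.
rewrite /pivot l2dotZr sqmodM sqmod_conj sqmodC exprVn sqr_sqrtr.
  by rewrite [l2dot u _]l2dotC sqmod_conj.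
exact: (form_ge0 (positive_psd lA A0)).
Qed.

(** Cauchy--Schwarz for the form of [A] at [u] and [x]. *)
Lemma deflate_positive : positive_op (deflate A x).
Proof.
have pA := positive_psd lA A0.
move=> u; rewrite deflate_dot [l2dot (pivot A x) u]l2dotC mul_conjc sqmod_pivot.
rewrite (form_diag pA) -rmorphB ler0c subr_ge0.
have [->|a0] := eqVneq (complex.Re (l2dot (A x) x)) 0.
  by rewrite invr0 mul0r; exact: (form_ge0 pA).
rewrite mulrC ler_pdivrMr; first by rewrite mulrC; exact: (form_CS pA).
by rewrite lt_neqAle eq_sym a0; exact: (form_ge0 pA).
Qed.

Lemma deflate_pivot : deflate A x x = 0.
Proof.
have pA := positive_psd lA A0.
have [a0|a0] := eqVneq (complex.Re (l2dot (A x) x)) 0.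
  have Ax : A x = 0.
    apply: nsq_eq0; have := form_CS pA x (A x); rewrite a0 mul0r l2dot_nsq sqmodC.
    by move=> h; apply/eqP; rewrite -sqrf_eq0 eq_le h sqr_ge0.
  by rewrite /deflate /pivot Ax scaler0 l2dot0r scale0r subrr.
rewrite /deflate /pivot l2dotZr conjc_real -(positive_sym lA A0) scalerA.
rewrite (form_diag pA) -!rmorphM /=; set a := complex.Re _ in a0 *.
rewrite mulrAC -expr2 exprVn sqr_sqrtr ?mulVf ?scale1r ?subrr//.
exact: (form_ge0 pA).
Qed.

Lemma deflate_ker y : A y = 0 -> deflate A x y = 0.
Proof.
move=> Ay; rewrite /deflate Ay /pivot l2dotZr -(positive_sym lA A0) Ay l2dot0l.
by rewrite mulr0 scale0r subrr.
Qed.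
End deflation.

(** Elimination along the basis [e], as in a Cholesky factorization: each step
    subtracts a rank-one operator so that the rest also annihilates [e n]. *)
Fixpoint residual S e n : L2 mu -> L2 mu :=
  if n is m.+1 then deflate (residual S e m) (e m) else S.

Definition cholesky S e n : L2 mu := pivot (residual S e n) (e n).

Section cholesky.
Variables (S : L2 mu -> L2 mu) (e : nat -> L2 mu).
Hypotheses (bS : bounded_op S) (S0 : positive_op S) (onb_e : orthonormal_basis e).
Hypothesis tr_fin : (\sum_(0 <= n <oo) (complex.Re (l2dot (S (e n)) (e n)))%:E < +oo)%E.

Lemma residualP n : [/\ linear (residual S e n), positive_op (residual S e n) &
  forall j, (j < n)%N -> residual S e n (e j) = 0].
Proof.
elim: n => [|n [lA A0 kA]]; first by split=> //; case: bS.
split; [exact: deflate_linear|exact: deflate_positive|].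
move=> j; rewrite ltnS leq_eqVlt => /orP[/eqP ->|jn] /=.
  exact: deflate_pivot.
by apply: deflate_ker => //; exact: kA.
Qed.

Lemma residual_dot n u w : l2dot (S u) w = l2dot (residual S e n u) w +
  \sum_(k < n) l2dot u (cholesky S e k) * l2dot (cholesky S e k) w.
Proof.
elim: n => [|n IH]; first by rewrite big_ord0 addr0.
by rewrite IH big_ord_recr /= deflate_dot [X in _ = _ + X]addrC addrA subrK.
Qed.

Lemma residual_diag_le n u : complex.Re (l2dot (residual S e n u) u) <=
  complex.Re (l2dot (S u) u).
Proof.
rewrite (residual_dot n u u) ReD lerDl Re_sum sumr_ge0// => k _.
by rewrite [l2dot (cholesky S e k) u]l2dotC mul_conjc sqmod_ge0.
Qed.

Lemma cholesky_sum_le n u :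
  \sum_(k < n) sqmod (l2dot u (cholesky S e k)) <= complex.Re (l2dot (S u) u).
Proof.
rewrite (residual_dot n u u) ReD Re_sum.
under [X in _ <= _ + X]eq_bigr do rewrite [l2dot (cholesky S e _) u]l2dotC mul_conjc.
rewrite lerDr; have [lA A0 _] := residualP n.
exact: (form_ge0 (positive_psd lA A0)).
Qed.

(** The [n]-th residual annihilates the first [n] basis vectors, so it sees only
    the part of [u] orthogonal to them, which tends to [0]; Cauchy--Schwarz for
    the form of the residual, which lies below that of [S], concludes. *)
Lemma residual_cvg0 u w :
  (fun n => sqmod (l2dot (residual S e n u) w)) @ \oo --> (0 : R).
Proof.
have [M M0 SM] := bounded_op_nsq bS.
set c := complex.Re (l2dot (S w) w).
have lS : linear S by case: bS.
apply: (@squeeze_cvgr _ _ _ _ (cst 0)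
  (fun n => (M + 1) * nsq (u - onb_proj e n u) * c)); last 2 first.
- exact: cvg_cst.
- rewrite [X in _ --> X](_ : 0 = (M + 1) * 0 * c :> R); last by rewrite mulr0 mul0r.
  apply: cvgM; last exact: cvg_cst.
  by apply: cvgM; [exact: cvg_cst|exact: onb_proj_cvg].
apply: nearW => n; rewrite sqmod_ge0 /=.
have [lA A0 kA] := residualP n; have pA := positive_psd lA A0.
have -> : residual S e n u = residual S e n (u - onb_proj e n u).
  rewrite (linear_lmodB lA) (linear_lmod_sum _ _ _ lA) big1 ?subr0// => k _.
  by rewrite (linear_lmodZ lA) kA// scaler0.
apply: le_trans (form_CS pA _ _) _; apply: ler_pM; try exact: (form_ge0 pA).
- apply: le_trans (residual_diag_le n _) _.
  apply: le_trans (Re_l2dot_le _ _) _.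
  by rewrite mulrDl mul1r lerD2r.
- exact: residual_diag_le.
Qed.

Theorem cholesky_gram : gram S (cholesky S e).
Proof.
split.
- move=> u w; apply: ccvg_le (residual_cvg0 u w) => n.
  by rewrite [X in X - _](residual_dot n u w) addrK.
- apply: le_lt_trans tr_fin.
  under eq_eseriesr => k _ do rewrite -(parseval_ereal onb_e).
  rewrite nneseries_interchange; last first.
    by move=> k n; rewrite lee_fin sqmod_ge0.
  apply: lee_nneseries => [n _ _|n _]; first by apply: nneseries_ge0 => k _ _; rewrite lee_fin sqmod_ge0.
  apply: nneseries_le_bound => [k|m]; first exact: sqmod_ge0.
  rewrite lee_fin; apply: le_trans (cholesky_sum_le m (e n)).
  by apply: ler_sum => k _; rewrite [X in sqmod X]l2dotC sqmod_conj.
Qed.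
End cholesky.
End gram.

(** * Traces *)

Section gram_theory.
Context d (T : measurableType d) (R : realType).
Variable mu : {measure set T -> \bar R}.
Implicit Types (u v w x : L2 mu) (S A W G : L2 mu -> L2 mu) (e : nat -> L2 mu).

Lemma gram_diag S (v : nat -> L2 mu) u : gram S v ->
  (\sum_(0 <= k <oo) (sqmod (l2dot u (v k)))%:E =
   (complex.Re (l2dot (S u) u))%:E)%E.
Proof.
move=> [/(_ u u)/ccvg_Re h _]; apply: nneseries_EFin => [k|]; first exact: sqmod_ge0.
rewrite (_ : (fun n => _) =
  fun n => complex.Re (\sum_(k < n) l2dot u (v k) * l2dot (v k) u))//.
apply/funext => n; rewrite Re_sum; apply: eq_bigr => k _.
by rewrite [l2dot (v k) u]l2dotC mul_conjc.
Qed.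

Lemma gram_positive S (v : nat -> L2 mu) : gram S v -> positive_op S.
Proof.
move=> gS u; rewrite lecE /=; apply/andP; split.
  have [/(_ u u)/ccvg_Im h _] := gS; apply/eqP/esym.
  have h' : (fun n => complex.Im (\sum_(k < n) l2dot u (v k) * l2dot (v k) u)) @ \oo --> (0 : R).
    rewrite (_ : (fun n => _) = cst 0); first exact: cvg_cst.
    apply/funext => n; rewrite Im_sum big1// => k _.
    by rewrite [l2dot (v k) u]l2dotC mul_conjc.
  by rewrite -(cvg_lim _ h')// (cvg_lim _ h).
rewrite -lee_fin -(gram_diag u gS); apply: nneseries_ge0 => k _ _.
by rewrite lee_fin sqmod_ge0.
Qed.

(** By Parseval, both sides are the sum over [n] and [k] of
    [sqmod (l2dot (e n) (v k))]. *)
Lemma gram_trace S (v : nat -> L2 mu) e : gram S v -> orthonormal_basis e ->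
  (\sum_(0 <= n <oo) (complex.Re (l2dot (S (e n)) (e n)))%:E =
   \sum_(0 <= k <oo) (nsq (v k))%:E)%E.
Proof.
move=> gS onb_e; under eq_eseriesr => n _ do rewrite -(gram_diag (e n) gS).
rewrite nneseries_interchange; last by move=> k n; rewrite lee_fin sqmod_ge0.
apply: eq_eseriesr => k _; rewrite -(parseval_ereal onb_e).
by apply: eq_eseriesr => n _; rewrite [X in sqmod X]l2dotC sqmod_conj.
Qed.

(** A positive operator is its own absolute value, by uniqueness of positive square
    roots, so the sum that is finite by definition is the trace of [S]. *)
Lemma trace_class_gram S : trace_class S -> positive_op S -> exists v : nat -> L2 mu, gram S v.
Proof.
move=> [bS [P [bP P0 PS] [e onb_e tr_fin]]] S0.
have PS' : P = S.
  apply: positive_sqrt_unique => //; rewrite PS (positive_adjoint _ S0)//.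
  by case: bS.
by rewrite PS' in tr_fin; exists (cholesky S e); exact: cholesky_gram.
Qed.

Lemma gram_trace_class S (v : nat -> L2 mu) e : bounded_op S ->
  gram S v -> orthonormal_basis e -> trace_class S.
Proof.
move=> bS gS onb_e; split=> //; have S0 := gram_positive gS; exists S.
  by split=> //; rewrite positive_adjoint//; case: bS.
by exists e => //; rewrite (gram_trace gS onb_e); case: gS.
Qed.

Lemma traceE A e (t : R[i]) : orthonormal_basis e ->
  (forall e', orthonormal_basis e' ->
     ccvg (fun n => \sum_(k < n) l2dot (A (e' k)) (e' k)) t) ->
  trace A = t.
Proof.
move=> onb_e At; apply: xget_unique => [e' onb_e'|t' t'P].
  rewrite (_ : series _ = fun n => \sum_(k < n) l2dot (A (e' k)) (e' k)).
    exact/ccvg_topology/At.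
  by apply/funext => n; rewrite /series /= big_mkord.
have h := t'P e onb_e.
have h' : series (fun n => l2dot (A (e n)) (e n)) @ \oo --> (t : R[i]^o).
  rewrite (_ : series _ = fun n => \sum_(k < n) l2dot (A (e k)) (e k)).
    exact/ccvg_topology/At.
  by apply/funext => n; rewrite /series /= big_mkord.
exact: (@cvg_unique R[i]^o (@norm_hausdorff _ (R[i]^o : normedModType R[i])) _ _ t' t h h').
Qed.

Section trace_product.
Variables (S W : L2 mu -> L2 mu) (v : nat -> L2 mu) (e : nat -> L2 mu).
Hypotheses (gS : gram S v) (bW : bounded_op W) (W0 : positive_op W) (onb_e : orthonormal_basis e).

Let lW : linear W. Proof. by case: bW. Qed.

Let diag_ge0 k : 0 <= complex.Re (l2dot (W (v k)) (v k)).
Proof. exact: (form_ge0 (positive_psd lW W0)). Qed.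

(** Expanding [S] turns the [n]-th partial sum of the trace into
    [\sum_k <W (p v_k), v_k>], with [p] the projection onto the span of the
    first [n] basis vectors; the projections tend to the identity, and the
    sums over [k] are dominated by a multiple of [\sum_k nsq (v k)]. *)
Lemma trace_gram_mul : exists2 t : R,
  (t%:E = \sum_(0 <= k <oo) (complex.Re (l2dot (W (v k)) (v k)))%:E)%E &
  trace (S \o W) = t%:C%C.
Proof.
have [M M0 MW] := bounded_op_nsq bW.
have [_ vfin] := gS.
set V := (\sum_(0 <= k <oo) _)%E in vfin.
pose b k := Num.sqrt M * nsq (v k).
have bB n : \sum_(k < n) b k <= Num.sqrt M * fine V.
  rewrite -mulr_sumr ler_wpM2l ?sqrtr_ge0//.
  by apply: nneseries_partial_le_fine => // k; exact: nsq_ge0.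
have Wb k u : nsq u <= nsq (v k) -> Num.sqrt (sqmod (l2dot (W u) (v k))) <= b k.
  move=> uv; rewrite -[b k]ger0_norm ?mulr_ge0 ?sqrtr_ge0 ?nsq_ge0//.
  rewrite -sqrtr_sqr ler_wsqrtr// exprMn sqr_sqrtr// expr2.
  apply: le_trans (l2dot_CS _ _) _; rewrite mulrA ler_wpM2r ?nsq_ge0//.
  by apply: le_trans (MW u) _; rewrite ler_wpM2l.
have proj_le e' (h : orthonormal_basis e') n u : nsq (onb_proj e' n u) <= nsq u.
  by rewrite nsq_onb_proj// bessel.
pose l k := complex.Re (l2dot (W (v k)) (v k)).
have l_cvg : cvgn (fun n => \sum_(k < n) l k).
  apply: (@bounded_abs_series_cvg _ _ (Num.sqrt M * fine V)) => n.
  apply: le_trans (bB n); apply: ler_sum => k _.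
  by apply: le_trans (normr_Re_le _) _; exact: Wb.
exists (limn (fun n => \sum_(k < n) l k)).
  by apply/esym/nneseries_EFin => // k; exact: diag_ge0.
apply: (traceE onb_e) => e' onb_e'.
have partial N : ccvg (fun n => \sum_(k < n) l2dot (W (onb_proj e' N (v k))) (v k))
    (\sum_(m < N) l2dot ((S \o W) (e' m)) (e' m)).
  have := @ccvg_suml _ N (fun m n => \sum_(k < n) l2dot (W (e' m)) (v k) * l2dot (v k) (e' m))
    (fun m => l2dot (S (W (e' m))) (e' m)) (fun m => proj1 gS _ _).
  rewrite (_ : (fun n => _) = (fun n => \sum_(k < n) l2dot (W (onb_proj e' N (v k))) (v k)))//.
  apply/funext => n; rewrite exchange_big /=; apply: eq_bigr => k _.
  rewrite (linear_lmod_sum _ _ _ lW) l2dot_suml; apply: eq_bigr => m _.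
  by rewrite (linear_lmodZ lW) l2dotZl mulrC.
have term k : ccvg (fun N => l2dot (W (onb_proj e' N (v k))) (v k)) (l2dot (W (v k)) (v k)).
  apply: (@ccvg_le _ _ _ (fun N => M * nsq (v k - onb_proj e' N (v k)) * nsq (v k))).
    move=> N; rewrite -l2dotBl -(linear_lmodB lW); apply: le_trans (l2dot_CS _ _) _.
    by rewrite ler_wpM2r ?nsq_ge0.
  rewrite [X in _ --> X](_ : 0 = M * 0 * nsq (v k) :> R); last by rewrite mulr0 mul0r.
  apply: cvgM; last exact: cvg_cst.
  by apply: cvgM; [exact: cvg_cst|exact: onb_proj_cvg].
apply: ccvgI.
- apply: (@tannery _ (fun N k => complex.Re (l2dot (W (onb_proj e' N (v k))) (v k))) b l _ _ _ _ _ bB) => //.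
  + by move=> N k; apply: le_trans (normr_Re_le _) _; apply: Wb; exact: proj_le.
  + by move=> k; exact: ccvg_Re (term k).
  + move=> N; have := ccvg_Re (partial N).
    by under eq_fun do rewrite Re_sum.
- apply: (@tannery _ (fun N k => complex.Im (l2dot (W (onb_proj e' N (v k))) (v k))) b (cst 0) _ _ _ _ _ bB) => //.
  + move=> N k; apply: (@le_trans _ _ (Num.sqrt (sqmod (l2dot (W (onb_proj e' N (v k))) (v k))))).
      by rewrite -sqrtr_sqr ler_wsqrtr// lerDr sqr_ge0.
    by apply: Wb; exact: proj_le.
  + move=> k; have := ccvg_Im (term k).
    by rewrite (form_diag (positive_psd lW W0)).
  + move=> N; have := ccvg_Im (partial N).
    by under eq_fun do rewrite Im_sum.
  + by under eq_fun do rewrite big1//; exact: cvg_cst.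
Qed.
End trace_product.
End gram_theory.

(** * Operators defined by sums of rank-one operators *)

Section rank_one_sums.
Context d (T : measurableType d) (R : realType).
Variable mu : {measure set T -> \bar R}.
Implicit Types (u v w : L2 mu) (G : L2 mu -> L2 mu) (a b : nat -> L2 mu).

Lemma nsq_cvg_dot (x : nat -> L2 mu) s w :
  (fun n => nsq (s - x n)) @ \oo --> (0 : R) ->
  ccvg (fun n => l2dot (x n) w) (l2dot s w).
Proof.
move=> xs; apply: (@ccvg_le _ _ _ (fun n => nsq (s - x n) * nsq w)).
  by move=> n; rewrite -l2dotBl; exact: l2dot_CS.
rewrite [X in _ --> X](_ : 0 = 0 * nsq w :> R); last by rewrite mul0r.
by apply: cvgM => //; exact: cvg_cst.
Qed.

Lemma l2norm_le_mean u v : l2norm u * l2norm v <= nsq u + nsq v.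
Proof.
rewrite -!l2norm_sq; have := l2norm_ge0 u; have := l2norm_ge0 v.
by move: (l2norm u) (l2norm v) => x y *; nra.
Qed.

(** For every [u] the series of the [l2dot u (a k) *: b k] converges absolutely,
    because [l2norm (a k) * l2norm (b k) <= nsq (a k) + nsq (b k)]. *)
Lemma rank_one_sum a b :
  (\sum_(0 <= k <oo) (nsq (a k))%:E < +oo)%E ->
  (\sum_(0 <= k <oo) (nsq (b k))%:E < +oo)%E ->
  exists2 G, linear G & forall u w,
    ccvg (fun n => \sum_(k < n) l2dot u (a k) * l2dot (b k) w) (l2dot (G u) w).
Proof.
move=> afin bfin.
set A := (\sum_(0 <= k <oo) _)%E in afin; set B := (\sum_(0 <= k <oo) _)%E in bfin.
have /choice[G GP] : forall u, exists s,
    (fun n => nsq (s - \sum_(k < n) l2dot u (a k) *: b k)) @ \oo --> (0 : R).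
  move=> u; apply: (@l2_absolute_series _ _ _ _ (fun k => l2dot u (a k) *: b k) (l2norm u * (fine A + fine B))) => n.
  apply: (@le_trans _ _ (\sum_(k < n) l2norm u * (nsq (a k) + nsq (b k)))).
    apply: ler_sum => k _; rewrite (l2normE (_ *: _)) nsqZ sqrtrM ?sqmod_ge0//.
    apply: (@le_trans _ _ (l2norm u * (l2norm (a k) * l2norm (b k)))).
      rewrite mulrA ler_wpM2r ?sqrtr_ge0// !l2normE -sqrtrM ?nsq_ge0//.
      by rewrite ler_wsqrtr// l2dot_CS.
    by rewrite ler_wpM2l ?l2norm_ge0// l2norm_le_mean.
  rewrite -mulr_sumr ler_wpM2l ?l2norm_ge0// big_split /=.
  by apply: lerD; apply: nneseries_partial_le_fine => // k; exact: nsq_ge0.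
have weak u w : ccvg (fun n => \sum_(k < n) l2dot u (a k) * l2dot (b k) w) (l2dot (G u) w).
  have := nsq_cvg_dot w (GP u).
  rewrite (_ : (fun n => _) = (fun n => \sum_(k < n) l2dot u (a k) * l2dot (b k) w))//.
  by apply/funext => n; rewrite l2dot_suml; apply: eq_bigr => k _; rewrite l2dotZl.
exists G => // c u v; apply: l2dot_extl => w; rewrite l2dotDl l2dotZl.
apply: ccvg_unique (weak (c *: u + v) w) _.
have := ccvgZD c (weak u w) (weak v w).
rewrite (_ : (fun n => _) = (fun n => \sum_(k < n) l2dot (c *: u + v) (a k) * l2dot (b k) w))//.
apply/funext => n; rewrite mulr_sumr -big_split; apply: eq_bigr => k _ /=.
by rewrite l2dotDl l2dotZl mulrDl mulrA.
Qed.

(** Cauchy--Schwarz for the form of [G] at [u] and [G u] turns a bound on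
    [<G u, u>] into one on [nsq (G u)]. *)
Lemma gram_bounded G (v : nat -> L2 mu) : linear G -> gram G v -> bounded_op G.
Proof.
move=> lG gG; have [_ vfin] := gG; have G0 := gram_positive gG.
have pG := positive_psd lG G0.
set V := (\sum_(0 <= k <oo) _)%E in vfin.
have diag u : complex.Re (l2dot (G u) u) <= fine V * nsq u.
  rewrite -lee_fin -(gram_diag u gG); apply: nneseries_le_bound => [k|n].
    exact: sqmod_ge0.
  rewrite lee_fin; apply: (@le_trans _ _ (\sum_(k < n) nsq (v k) * nsq u)).
    by apply: ler_sum => k _; rewrite mulrC; exact: l2dot_CS.
  rewrite -mulr_suml ler_wpM2r ?nsq_ge0//.
  by apply: nneseries_partial_le_fine => // k; exact: nsq_ge0.
apply: (@bounded_op_of_nsq _ _ _ _ _ (fine V ^+ 2)) => // u.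
have := form_CS pG u (G u); rewrite l2dot_nsq sqmodC => h.
have [->|n0] := eqVneq (nsq (G u)) 0; first by rewrite mulr_ge0 ?nsq_ge0// sqr_ge0.
have np : 0 < nsq (G u) by rewrite lt_neqAle eq_sym n0 nsq_ge0.
rewrite -(ler_pM2r np) -[leLHS]expr2; apply: le_trans h _.
rewrite [leRHS](_ : _ = (fine V * nsq u) * (fine V * nsq (G u))); last by ring.
by apply: ler_pM; rewrite ?diag//; exact: (form_ge0 pG).
Qed.
End rank_one_sums.

(** * Integral kernels and affine substitutions *)

Section bounded_multiplier.
Context d (T : measurableType d) (R : realType) (mu : {measure set T -> \bar R}).

Lemma integrable_bounded_mul (h g : T -> R) (M : R) :
  measurable_fun [set: T] h -> (forall y, `|h y| <= M) ->
  mu.-integrable [set: T] (EFin \o g) ->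
  mu.-integrable [set: T] (EFin \o (fun y => h y * g y)).
Proof.
move=> mh hM ig.
have i2 := integrableZl_EFin M ig.
apply: (le_integrable _ _ _ i2) => //.
  apply/measurable_EFinP; apply: measurable_funM => //.
  exact/measurable_EFinP/measurable_int/ig.
move=> y _; rewrite /= lee_fin !normrM ler_wpM2r// (le_trans (hM _))//.
exact: ler_norm.
Qed.

Lemma EFin_Rintegral (f : T -> R) : mu.-integrable [set: T] (EFin \o f) ->
  (\int[mu]_x f x)%:E = (\int[mu]_x (f x)%:E)%E.
Proof. by move=> If; rewrite /Rintegral fineK// integrable_fin_num. Qed.

Lemma EFin_RintegralZl (c : R) (f : T -> R) : mu.-integrable [set: T] (EFin \o f) ->
  (c * \int[mu]_x f x)%:E = (\int[mu]_x (c * f x)%:E)%E.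
Proof.
by move=> If; rewrite -RintegralZl// EFin_Rintegral//; exact: integrableZl_EFin.
Qed.
End bounded_multiplier.

Lemma measurable_fun_section d1 d2 d (T1 : measurableType d1)
  (T2 : measurableType d2) (U : measurableType d) (F : T1 * T2 -> U) x :
  measurable_fun [set: T1 * T2] F -> measurable_fun [set: T2] (fun y => F (x, y)).
Proof. by move=> mF; apply: measurableT_comp => //; exact: pair1_measurable. Qed.

Section bounded_kernels.
Context d1 d2 (T1 : measurableType d1) (T2 : measurableType d2) (R : realType).
Variables (m1 : {sigma_finite_measure set T1 -> \bar R}).
Variables (m2 : {sigma_finite_measure set T2 -> \bar R}).

Lemma measurable_Rintegral_param (F : T1 * T2 -> R) :
  measurable_fun [set: T1 * T2] F ->
  measurable_fun [set: T1] (fun x => \int[m2]_y F (x, y)).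
Proof.
move=> mF; apply: (measurableT_comp (f := @fine R)) => //.
have mE : measurable_fun [set: T1 * T2] (EFin \o F) by exact/measurable_EFinP.
rewrite (_ : (fun x => _) = (fun x => \int[m2]_y (EFin \o F)^\+ (x, y) -
    \int[m2]_y (EFin \o F)^\- (x, y))%E).
  apply: emeasurable_funB.
  - apply: (@measurable_fun_fubini_tonelli_F _ _ _ _ _ m2 (EFin \o F)^\+%E) => //.
    exact: measurable_funepos.
  - apply: (@measurable_fun_fubini_tonelli_F _ _ _ _ _ m2 (EFin \o F)^\-%E) => //.
    exact: measurable_funeneg.
by apply/funext => x; rewrite [LHS]integralE; congr (_ - _)%E;
  apply: eq_integral => y _; rewrite ?funeposE ?funenegE.
Qed.

Variables (k : T1 * T2 -> R) (M : R).
Hypotheses (mk : measurable_fun [set: T1 * T2] k) (kM : forall z, `|k z| <= M).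

Let mk2 x : measurable_fun [set: T2] (fun y => k (x, y)).
Proof. by apply: measurableT_comp => //; exact: pair1_measurable. Qed.

Let mk1 y : measurable_fun [set: T1] (fun x => k (x, y)).
Proof. by apply: measurableT_comp => //; exact: pair2_measurable. Qed.

Lemma integrable_kernel (g : T2 -> R) x : m2.-integrable [set: T2] (EFin \o g) ->
  m2.-integrable [set: T2] (EFin \o (fun y => k (x, y) * g y)).
Proof. by apply: integrable_bounded_mul (mk2 x) _ => y; exact: kM. Qed.

Lemma kernel_bound (g : T2 -> R) x : m2.-integrable [set: T2] (EFin \o g) ->
  `|\int[m2]_y (k (x, y) * g y)| <= M * \int[m2]_y `|g y|.
Proof.
move=> ig; have ik := integrable_kernel x ig.
have ign := integrable_norm ig.
apply: le_trans (le_normr_Rintegral measurableT ik) _.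
rewrite -RintegralZl//; apply: le_Rintegral => //.
- exact: (integrable_norm ik).
- exact: integrableZl_EFin.
- by move=> y _; rewrite normrM ler_wpM2r.
Qed.

(** Fubini, the kernel being bounded. *)
Lemma kernel_dual (f : T1 -> R) (g : T2 -> R) :
  m1.-integrable [set: T1] (EFin \o f) -> m2.-integrable [set: T2] (EFin \o g) ->
  \int[m1]_x (f x * \int[m2]_y (k (x, y) * g y)) =
  \int[m2]_y (g y * \int[m1]_x (k (x, y) * f x)).
Proof.
move=> If Ig.
have mf : measurable_fun [set: T1] f by exact/measurable_EFinP/measurable_int/If.
have mg : measurable_fun [set: T2] g by exact/measurable_EFinP/measurable_int/Ig.
pose F z := (f z.1 * (k z * g z.2))%:E.
have mF : measurable_fun [set: T1 * T2] F.
  apply/measurable_EFinP; apply: measurable_funM; first exact: measurableT_comp.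
  by apply: measurable_funM => //; exact: measurableT_comp.
have iF : (m1 \x m2)%E.-integrable [set: T1 * T2] F.
  apply/(integrable12ltyP m1 m2 mF).
  have [_ gfin] := integrableP _ _ _ Ig; have [_ ffin] := integrableP _ _ _ If.
  set G := (\int[m2]_y _)%E in gfin.
  have G0 : (0 <= G)%E by exact: integral_ge0.
  apply: (@le_lt_trans _ _ (\int[m1]_x (`|M|%:E * G * `|(f x)%:E|))%E).
    apply: ge0_le_integral => //.
    - by move=> x _; exact: integral_ge0.
    - apply: (@measurable_fun_fubini_tonelli_F _ _ _ _ _ m2 (abse \o F)) => //.
        exact: measurableT_comp.
      by move=> z; exact: abse_ge0.
    - by apply: emeasurable_funM => //; apply: measurableT_comp => //; exact/measurable_EFinP.
    - move=> x _; rewrite [leRHS]muleC muleA -ge0_integralZl//; last first.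
        by apply: measurableT_comp => //; exact/measurable_EFinP.
      apply: ge0_le_integral => //.
      + apply: measurableT_comp => //.
        apply: (measurableT_comp (f := F)) => //; exact: pair1_measurable.
      + apply: emeasurable_funM => //; apply: measurableT_comp => //; exact/measurable_EFinP.
      + move=> y _; rewrite /F /= -!EFinM lee_fin !normrM mulrA ler_wpM2r//.
        by rewrite ler_wpM2l// (le_trans (kM _))// ler_norm.
  rewrite ge0_integralZl//.
  - by rewrite lte_mul_pinfty// ?mule_ge0// ?fin_numM// ge0_fin_numE.
  - by apply: measurableT_comp => //; exact/measurable_EFinP.
  - by rewrite mule_ge0.
have := Fubini iF; rewrite /F /= => FB.
rewrite /Rintegral; congr fine.
transitivity (\int[m1]_x \int[m2]_y (f x * (k (x, y) * g y))%:E)%E.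
  apply: eq_integral => x _.
  rewrite -EFin_RintegralZl//; exact: integrable_kernel.
rewrite FB; apply: eq_integral => y _.
have ik : m1.-integrable [set: T1] (EFin \o (fun x => k (x, y) * f x)).
  by apply: integrable_bounded_mul If => // x; exact: kM.
transitivity (\int[m1]_x (g y * (k (x, y) * f x))%:E)%E.
  by apply: eq_integral => x _; congr EFin; ring.
by rewrite -EFin_RintegralZl.
Qed.
End bounded_kernels.

Section lebesgue_affine.
Variable R : realType.
Local Notation mu := (@lebesgue_measure R).

(** Half-open intervals determine the Lebesgue measure. *)
Lemma lebesgue_measure_affine (a b : R) (A : set (measurableTypeR R)) : a != 0 ->
  measurable A ->
  (`|a|%:E * mu ((fun x : R => a * x + b)%R @^-1` A) = mu A)%E.
Proof.
move=> a0 mA.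
have maff : measurable_fun [set: measurableTypeR R]
    (fun x : measurableTypeR R => a * x + b : measurableTypeR R).
  by apply: measurable_funD => //; exact: measurable_funM.
pose phi := fun x : measurableTypeR R => a * x + b : measurableTypeR R.
pose na := NngNum (normr_ge0 a).
rewrite [RHS](@lebesgue_measure_unique R (mscale na (pushforward mu phi)) _ _)//.
move=> X /ocitvP[->|[[c e] /= ce ->]]; first by rewrite !measure0.
rewrite /mscale /= /pushforward lebesgue_measure_itv /= lte_fin ce.
have [ap|an|/eqP a00] := ltgtP 0 a; last by rewrite eq_sym (negbTE a0) in a00.
- rewrite (_ : _ @^-1` _ = `](c - b) / a, (e - b) / a]%classic); last first.
    by apply/seteqP; split => x /=; rewrite !in_itv /= ltr_pdivrMr// ler_pdivlMr//
      [x * a]mulrC ltrBlDr lerBrDr.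
  rewrite lebesgue_measure_itv /= lte_fin ltr_pM2r ?invr_gt0// ltrD2r ce.
  by rewrite gtr0_norm// -EFinB -EFinB -EFinM; congr EFin; field.
- rewrite (_ : _ @^-1` _ = `[(e - b) / a, (c - b) / a[%classic); last first.
    by apply/seteqP; split => x /=; rewrite !in_itv /= ltr_ndivlMr// ler_ndivrMr//
      [x * a]mulrC ltrBlDr lerBrDr andbC.
  rewrite lebesgue_measure_itv /= lte_fin ltr_nM2r ?invr_lt0// ltrD2r ce.
  by rewrite ltr0_norm// -EFinB -EFinB -EFinM; congr EFin; field.
Qed.

(** Both sides integrate [f] against the Lebesgue measure, on the right seen as
    a multiple of its own image under the affine map. *)
Lemma ge0_integral_affine (a b : R) (f : R -> \bar R) : a != 0 ->
  measurable_fun [set: measurableTypeR R] f -> (forall x, (0 <= f x)%E) ->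
  (`|a|%:E * \int[mu]_x f (a * x + b)%R = \int[mu]_x f x)%E.
Proof.
move=> a0 mf f0.
have maff : measurable_fun [set: measurableTypeR R]
    (fun x : measurableTypeR R => a * x + b : measurableTypeR R).
  by apply: measurable_funD => //; exact: measurable_funM.
pose phi := fun x : measurableTypeR R => a * x + b : measurableTypeR R.
pose na := NngNum (normr_ge0 a).
rewrite [RHS](@eq_measure_integral _ _ _ _ (mscale na (pushforward mu phi))); last first.
  by move=> A mA _; exact/esym/(lebesgue_measure_affine b a0 mA).
rewrite ge0_integral_mscale//= ge0_integral_pushforward//.
Qed.
End lebesgue_affine.

(** * Cosine and sine transforms *)

Section cosine_sine_transforms.
Variable R : realType.
Local Notation T := (measurableTypeR R).
Local Notation mu := (@lebesgue_measure R).
Implicit Types (p f g W : T -> R) (x y t s : R).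

Local Notation rint f := (mu.-integrable [set: T] (EFin \o f)).

Definition cosT p : T -> R := fun x => \int[mu]_y (cos (x * y) * p y).
Definition sinT p : T -> R := fun x => \int[mu]_y (sin (x * y) * p y).

Lemma rint_measurable f : rint f -> measurable_fun [set: T] f.
Proof. by move=> h; exact/measurable_EFinP/measurable_int/h. Qed.

Lemma measurable_cos : measurable_fun [set: R] (@cos R).
Proof. by apply: continuous_measurable_fun; exact: continuous_cos. Qed.

Lemma measurable_sin : measurable_fun [set: R] (@sin R).
Proof. by apply: continuous_measurable_fun; exact: continuous_sin. Qed.

Lemma normr_cos_le1 x : `|cos x| <= 1.
Proof. by rewrite ler_norml cos_geN1 cos_le1. Qed.

Lemma normr_sin_le1 x : `|sin x| <= 1.
Proof. by rewrite ler_norml sin_geN1 sin_le1. Qed.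

Let mcos2 : measurable_fun [set: T * T] (fun z : T * T => cos (z.1 * z.2)).
Proof.
by apply: measurableT_comp; [exact: measurable_cos|exact: measurable_funM].
Qed.

Let msin2 : measurable_fun [set: T * T] (fun z : T * T => sin (z.1 * z.2)).
Proof.
by apply: measurableT_comp; [exact: measurable_sin|exact: measurable_funM].
Qed.

Let mcosl x : measurable_fun [set: T] (fun y : T => cos (x * y)).
Proof. by apply: measurableT_comp; [exact: measurable_cos|exact: measurable_funM]. Qed.

Let msinl x : measurable_fun [set: T] (fun y : T => sin (x * y)).
Proof. by apply: measurableT_comp; [exact: measurable_sin|exact: measurable_funM]. Qed.

Lemma rint_cos_mul f x : rint f -> rint (fun y => cos (x * y) * f y).
Proof. by apply: (@integrable_bounded_mul _ _ _ _ _ _ 1) => // y; exact: normr_cos_le1. Qed.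

Lemma rint_sin_mul f x : rint f -> rint (fun y => sin (x * y) * f y).
Proof. by apply: (@integrable_bounded_mul _ _ _ _ _ _ 1) => // y; exact: normr_sin_le1. Qed.

Lemma measurable_cosT p : measurable_fun [set: T] p -> measurable_fun [set: T] (cosT p).
Proof.
move=> mp; apply: (@measurable_Rintegral_param _ _ T T _ mu (fun z => cos (z.1 * z.2) * p z.2)).
by apply: measurable_funM => //; exact: measurableT_comp.
Qed.

Lemma measurable_sinT p : measurable_fun [set: T] p -> measurable_fun [set: T] (sinT p).
Proof.
move=> mp; apply: (@measurable_Rintegral_param _ _ T T _ mu (fun z => sin (z.1 * z.2) * p z.2)).
by apply: measurable_funM => //; exact: measurableT_comp.
Qed.

Lemma cosT_bound p x : rint p -> `|cosT p x| <= \int[mu]_y `|p y|.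
Proof.
move=> ip; rewrite -[leRHS]mul1r.
exact: (@kernel_bound _ _ T T _ mu (fun z => cos (z.1 * z.2)) 1 mcos2 (fun z => normr_cos_le1 _)).
Qed.

Lemma sinT_bound p x : rint p -> `|sinT p x| <= \int[mu]_y `|p y|.
Proof.
move=> ip; rewrite -[leRHS]mul1r.
exact: (@kernel_bound _ _ T T _ mu (fun z => sin (z.1 * z.2)) 1 msin2 (fun z => normr_sin_le1 _)).
Qed.

Lemma cosTN p x : cosT p (- x) = cosT p x.
Proof. by apply: eq_Rintegral => y _; rewrite mulNr cosN. Qed.

Lemma sinTN p x : rint p -> sinT p (- x) = - sinT p x.
Proof.
move=> ip; rewrite -[RHS]mulN1r /sinT -RintegralZl//; last exact: rint_sin_mul.
by apply: eq_Rintegral => y _; rewrite mulNr sinN mulN1r mulNr.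
Qed.

Lemma cosT_dual f g : rint f -> rint g ->
  \int[mu]_x (f x * cosT g x) = \int[mu]_y (g y * cosT f y).
Proof.
move=> If Ig.
have h := @kernel_dual _ _ T T _ mu mu (fun z => cos (z.1 * z.2)) 1 mcos2
  (fun z => normr_cos_le1 _) f g If Ig.
apply: eq_trans h _; apply: eq_Rintegral => y _; congr (_ * _).
by apply: eq_Rintegral => x _; rewrite /= [x * y]mulrC.
Qed.

Lemma sinT_dual f g : rint f -> rint g ->
  \int[mu]_x (f x * sinT g x) = \int[mu]_y (g y * sinT f y).
Proof.
move=> If Ig.
have h := @kernel_dual _ _ T T _ mu mu (fun z => sin (z.1 * z.2)) 1 msin2
  (fun z => normr_sin_le1 _) f g If Ig.
apply: eq_trans h _; apply: eq_Rintegral => y _; congr (_ * _).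
by apply: eq_Rintegral => x _; rewrite /= [x * y]mulrC.
Qed.

Section weighted_inversion.
Variables (W p : T -> R).
Hypotheses (iW : rint W) (ip : rint p).

(** For [W = 1] this would be the inversion formula for [p], up to a factor.  An
    integrable [W] makes the integrals converge absolutely and turns the formula
    into a convolution ([winvE]). *)
Definition winv : T -> R := fun t =>
  cosT (fun x => W x * cosT p x) t + sinT (fun x => W x * sinT p x) t.

Let mp : measurable_fun [set: T] p. Proof. exact: rint_measurable. Qed.
Let mW : measurable_fun [set: T] W. Proof. exact: rint_measurable. Qed.

Lemma rint_mul_cosT : rint (fun x => W x * cosT p x).
Proof.
under [X in EFin \o X]eq_fun do rewrite mulrC.
apply: (integrable_bounded_mul _ _ iW); first exact: measurable_cosT.
by move=> x; exact: cosT_bound.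
Qed.

Lemma rint_mul_sinT : rint (fun x => W x * sinT p x).
Proof.
under [X in EFin \o X]eq_fun do rewrite mulrC.
apply: (integrable_bounded_mul _ _ iW); first exact: measurable_sinT.
by move=> x; exact: sinT_bound.
Qed.

(** Duality moves the transforms onto the kernels [cos (t * x) * W x] and
    [sin (t * x) * W x], which the addition formula combines. *)
Lemma winvE t : winv t = \int[mu]_s (p s * cosT W (t - s)).
Proof.
rewrite /winv.
have -> : cosT (fun x => W x * cosT p x) t =
    \int[mu]_s (p s * cosT (fun x => cos (t * x) * W x) s).
  rewrite -cosT_dual//; last exact: rint_cos_mul.
  by apply: eq_Rintegral => x _; rewrite mulrA.
have -> : sinT (fun x => W x * sinT p x) t =
    \int[mu]_s (p s * sinT (fun x => sin (t * x) * W x) s).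
  rewrite -sinT_dual//; last exact: rint_sin_mul.
  by apply: eq_Rintegral => x _; rewrite mulrA.
rewrite -RintegralD//.
- apply: eq_Rintegral => s _; rewrite -mulrDr; congr (_ * _).
  rewrite /cosT /sinT -RintegralD//.
  + by apply: eq_Rintegral => x _; rewrite mulrBl cosB; ring.
  + by apply: rint_cos_mul; exact: rint_cos_mul.
  + by apply: rint_sin_mul; exact: rint_sin_mul.
- under [X in EFin \o X]eq_fun do rewrite mulrC.
  apply: (integrable_bounded_mul _ _ ip).
    by apply: measurable_cosT; apply: measurable_funM.
  by move=> x; apply: cosT_bound; exact: rint_cos_mul.
- under [X in EFin \o X]eq_fun do rewrite mulrC.
  apply: (integrable_bounded_mul _ _ ip).
    by apply: measurable_sinT; apply: measurable_funM.
  by move=> x; apply: sinT_bound; exact: rint_sin_mul.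
Qed.

Lemma measurable_winv : measurable_fun [set: T] winv.
Proof.
apply: measurable_funD.
- by apply: measurable_cosT; apply: measurable_funM => //; exact: measurable_cosT.
- by apply: measurable_sinT; apply: measurable_funM => //; exact: measurable_sinT.
Qed.

Lemma winv_bound : exists M, forall t, `|winv t| <= M.
Proof.
exists (\int[mu]_x `|W x * cosT p x| + \int[mu]_x `|W x * sinT p x|) => t.
apply: le_trans (ler_normD _ _) _; apply: lerD.
- apply: cosT_bound; exact: rint_mul_cosT.
- apply: sinT_bound; exact: rint_mul_sinT.
Qed.

Lemma rint_weighted_square : rint (fun x => W x * (cosT p x ^+ 2 + sinT p x ^+ 2)).
Proof.
under [X in EFin \o X]eq_fun do rewrite mulrC.
set B := \int[mu]_y `|p y|.
apply: (@integrable_bounded_mul _ _ _ _ _ _ (B ^+ 2 + B ^+ 2) _ _ iW).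
  by apply: measurable_funD; apply: measurable_funX; [exact: measurable_cosT|exact: measurable_sinT].
move=> x; rewrite ger0_norm ?addr_ge0 ?sqr_ge0//.
have B0 : 0 <= B by apply: Rintegral_ge0.
by apply: lerD; rewrite -[leLHS]real_normK ?num_real// ler_sqr ?nnegrE//;
  [exact: cosT_bound|exact: sinT_bound].
Qed.

(** Duality moves the outer transforms of [winv] onto [p]. *)
Lemma winv_pairing : \int[mu]_t (p t * winv t) =
  \int[mu]_x (W x * (cosT p x ^+ 2 + sinT p x ^+ 2)).
Proof.
under eq_Rintegral do rewrite mulrDr.
have i1 : rint (fun t => p t * cosT (fun x => W x * cosT p x) t).
  under [X in EFin \o X]eq_fun do rewrite mulrC.
  apply: (integrable_bounded_mul _ _ ip).
    by apply: measurable_cosT; apply: rint_measurable; exact: rint_mul_cosT.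
  by move=> x; apply: cosT_bound; exact: rint_mul_cosT.
have i2 : rint (fun t => p t * sinT (fun x => W x * sinT p x) t).
  under [X in EFin \o X]eq_fun do rewrite mulrC.
  apply: (integrable_bounded_mul _ _ ip).
    by apply: measurable_sinT; apply: rint_measurable; exact: rint_mul_sinT.
  by move=> x; apply: sinT_bound; exact: rint_mul_sinT.
have j1 : rint (fun x => W x * cosT p x * cosT p x).
  under [X in EFin \o X]eq_fun do rewrite mulrC.
  apply: (integrable_bounded_mul _ _ rint_mul_cosT); first exact: measurable_cosT.
  by move=> x; exact: cosT_bound.
have j2 : rint (fun x => W x * sinT p x * sinT p x).
  under [X in EFin \o X]eq_fun do rewrite mulrC.
  apply: (integrable_bounded_mul _ _ rint_mul_sinT); first exact: measurable_sinT.
  by move=> x; exact: sinT_bound.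
apply: (eq_trans (RintegralD measurableT i1 i2)).
apply: (eq_trans (congr2 +%R (cosT_dual ip rint_mul_cosT) (sinT_dual ip rint_mul_sinT))).
apply: (eq_trans (esym (RintegralD measurableT j1 j2))).
by apply: eq_Rintegral => x _; ring.
Qed.
End weighted_inversion.
End cosine_sine_transforms.

(** * The Poisson kernel *)

Section fatou_limits.
Context d (T : measurableType d) (R : realType) (mu : {measure set T -> \bar R}).

Lemma fatou_bound (f_ : nat -> T -> R) (f : T -> R) (B : \bar R) :
  (forall n, measurable_fun [set: T] (f_ n)) -> measurable_fun [set: T] f ->
  (forall n x, 0 <= f_ n x) -> (forall x, 0 <= f x) ->
  {ae mu, forall x, f_ ^~ x @ \oo --> f x} ->
  (forall n, (\int[mu]_x (f_ n x)%:E <= B)%E) ->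
  (\int[mu]_x (f x)%:E <= B)%E.
Proof.
move=> mf_ mf f_0 f0 f_f fB.
have mE n : measurable_fun [set: T] (fun x => (f_ n x)%:E) by exact/measurable_EFinP.
apply: (@le_trans _ _ (limn_einf (fun n => \int[mu]_x (f_ n x)%:E)%E)); last first.
  rewrite limn_einf_lim; apply: lime_le; first exact: is_cvg_einfs.
  apply: nearW => n; apply: le_trans (fB n); apply: ereal_inf_lbound.
  by exists n => /=.
apply: le_trans (fatou mu measurableT mE _); last by move=> n x _; rewrite lee_fin.
rewrite (ae_eq_integral (fun x => limn_einf (fun n => (f_ n x)%:E)))//.
- exact/measurable_EFinP.
- rewrite (_ : (fun x => _) =
      (fun x => - limn_esup (-%E \o (fun n => (f_ n x)%:E)))%E); last first.
    by apply/funext => x; rewrite limn_esupN oppeK.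
  apply: measurableT_comp => //; apply: measurable_fun_limn_esup => n.
  exact: measurableT_comp.
- apply: filterS f_f => x fx _; apply/esym.
  have fxE : (fun n => (f_ n x)%:E) @ \oo --> (f x)%:E.
    by apply: cvg_EFin => //; exact: nearW.
  by rewrite is_cvg_limn_einfE ?(cvg_lim _ fxE)//; exact: cvgP fxE.
Qed.
End fatou_limits.

Section poisson_kernel.
Variable R : realType.
Local Notation T := (measurableTypeR R).
Local Notation mu := (@lebesgue_measure R).
Local Notation rint f := (mu.-integrable [set: T] (EFin \o f)).

(** The indicator function of the half-line is [expw 0]. *)
Definition expw (e : R) : T -> R := fun x => if 0 < x then expR (- (e * x)) else 0.

Lemma expw_ge0 e x : 0 <= expw e x.
Proof. by rewrite /expw; case: ifP => // _; exact: expR_ge0. Qed.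

Lemma expw_le e x : 0 <= e -> expw e x <= expw 0 x.
Proof.
move=> e0; rewrite /expw; case: ifP => // x0.
by rewrite mul0r oppr0 ler_expR oppr_le0 mulr_ge0// ltW.
Qed.

Lemma expw0_le1 x : expw 0 x <= 1.
Proof. by rewrite /expw; case: ifP => // x0; rewrite mul0r oppr0 expR0. Qed.

Lemma measurable_expw e : measurable_fun [set: T] (expw e).
Proof.
apply: measurable_fun_ifT => //.
- by apply: measurable_fun_ltr.
- apply: measurableT_comp; first exact: measurable_expR.
  by apply: measurableT_comp => //; exact: measurable_funM.
Qed.

Lemma expw_integral (e : R) (g : T -> R) : measurable_fun [set: T] g ->
  (\int[mu]_x (expw e x * g x)%:E =
   \int[mu]_(x in `[0%R, +oo[) (expR (- (e * x)) * g x)%:E)%E.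
Proof.
move=> mg; rewrite -integral_itv_obnd_cbnd; last first.
  apply/measurable_EFinP; apply: measurable_funTS; apply: measurable_funM => //.
  apply: measurableT_comp; first exact: measurable_expR.
  by apply: measurableT_comp => //; exact: measurable_funM.
rewrite [RHS]integral_mkcond; apply: eq_integral => x _.
rewrite /expw patchE; case: ifPn => x0; first by rewrite mem_set//= in_itv/= x0.
by rewrite memNset ?mul0r//= in_itv /= andbT; exact/negP.
Qed.

Lemma expw_cvg (x : R) : (fun n => expw n.+1%:R^-1 x) @ \oo --> expw 0 x.
Proof.
rewrite /expw; case: ifP => x0; last exact: cvg_cst.
apply: (@continuous_cvg nat R R \oo _ (fun n => - (n.+1%:R^-1 * x)) expR (- (0 * x))); first exact: continuous_expR.
by apply: cvgN; apply: cvgM; [exact: cvg_harmonic|exact: cvg_cst].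
Qed.

Lemma is_derive_mul_const (c x : R) : is_derive x 1 (fun y : R => c * y) c.
Proof.
rewrite -[X in is_derive _ _ _ X](mulr1 c).
exact: (is_deriveZ c (is_derive_id x 1)).
Qed.

Lemma is_derive_continuous (f df : R -> R) :
  (forall x : R, is_derive x 1 f (df x)) -> continuous f.
Proof.
move=> fdf x; apply: differentiable_continuous; apply/derivable1_diffP.
exact: (@ex_derive _ _ _ _ _ _ _ (fdf x)).
Qed.

Lemma is_derive_mulr_const (c x a : R) (f : R -> R) :
  is_derive x 1 f a -> is_derive x 1 (fun y => f y * c) (a * c).
Proof.
move=> h; rewrite mulrC (_ : (fun y => _) = (fun y => c * f y)); last first.
  by apply/funext => y; rewrite mulrC.
exact: (is_deriveZ c h).
Qed.

Section laplace.
Variables e t : R.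
Hypothesis e0 : 0 < e.

Let F (x : R) := expR (- (e * x)) * (- e^-1).
Let G (x : R) := expR (- (e * x)) * ((t * sin (t * x) - e * cos (t * x)) / (e ^+ 2 + t ^+ 2)).

Let den0 : e ^+ 2 + t ^+ 2 != 0.
Proof. by rewrite lt0r_neq0// ltr_wpDr ?sqr_ge0// exprn_gt0. Qed.

Let dE x : is_derive (x : R) 1 (fun y => expR (- (e * y))) (- e * expR (- (e * x))).
Proof.
have h := is_derive1_comp (is_derive_expR (- e * x)) (is_derive_mul_const (- e) x).
rewrite mulrC in h; rewrite -mulNr; move: h; congr is_derive.
by apply/funext => y /=; rewrite mulNr.
Qed.

Let dF x : is_derive (x : R) 1 F (expR (- (e * x))).
Proof.
have h := is_derive_mulr_const (- e^-1) (dE x).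
rewrite (_ : - e * _ * _ = expR (- (e * x))) in h; first exact: h.
by field; exact: lt0r_neq0.
Qed.

Let dG x : is_derive (x : R) 1 G (expR (- (e * x)) * cos (t * x)).
Proof.
have ds := is_derive1_comp (is_derive_sin (t * x)) (is_derive_mul_const t x).
have dc := is_derive1_comp (is_derive_cos (t * x)) (is_derive_mul_const t x).
have h := is_deriveM (dE x) (is_derive_mulr_const (e ^+ 2 + t ^+ 2)^-1
  (is_deriveB (is_deriveZ t ds) (is_deriveZ e dc))).
apply: (is_derive_eq h).
change (expR (- (e * x)) * ((t * (cos (t * x) * t) - e * (- sin (t * x) * t)) /
    (e ^+ 2 + t ^+ 2)) + ((t * sin (t * x) - e * cos (t * x)) /
    (e ^+ 2 + t ^+ 2)) * (- e * expR (- (e * x))) = expR (- (e * x)) * cos (t * x)).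
by field.
Qed.

Let cvg_E : (fun x : R => expR (- (e * x))) x @[x --> +oo] --> (0 : R).
Proof.
apply: (@cvg_comp _ _ _ (fun x => e * x) (fun y => expR (- y)) _ +oo%R); last first.
  exact: cvgr_expR.
by apply: gt0_cvgMry => //; exact: cvg_id.
Qed.

Let cF : F x @[x --> +oo] --> (0 : R).
Proof.
by rewrite -[X in _ --> X](mul0r (- e^-1)); apply: cvgM; [exact: cvg_E|exact: cvg_cst].
Qed.

Let cG : G x @[x --> +oo] --> (0 : R).
Proof.
pose B := (`|t| + `|e|) / (e ^+ 2 + t ^+ 2).
have cB : (fun x : R => expR (- (e * x)) * B) x @[x --> +oo] --> (0 : R).
  by rewrite -[X in _ --> X](mul0r B); apply: cvgM; [exact: cvg_E|exact: cvg_cst].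
have cNB : (fun x : R => - (expR (- (e * x)) * B)) x @[x --> +oo] --> (0 : R).
  by rewrite -[X in _ --> X]oppr0; exact: cvgN.
apply: (squeeze_cvgr _ cNB cB); apply: nearW => x.
rewrite -ler_norml /G /B normrM ger0_norm ?expR_ge0// ler_wpM2l ?expR_ge0//.
rewrite normrM [X in _ * X]ger0_norm; last by rewrite invr_ge0 addr_ge0// sqr_ge0.
rewrite ler_wpM2r//; first by rewrite invr_ge0 addr_ge0// sqr_ge0.
apply: le_trans (ler_normB _ _) _; rewrite !normrM.
by apply: lerD; rewrite -[leRHS]mulr1 ler_wpM2l ?normr_sin_le1 ?normr_cos_le1.
Qed.

Let integral_exp :
  (\int[mu]_(x in `[0%R, +oo[) (expR (- (e * x)))%:E = (e^-1)%:E)%E.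
Proof.
rewrite (@ge0_continuous_FTC2y _ (fun x => expR (- (e * x))) F 0 0)//.
- by rewrite /F mulr0 oppr0 expR0 mul1r -EFinB sub0r opprK.
- by apply: continuous_subspaceT; exact: (is_derive_continuous dE).
- by apply: cvg_at_right_filter; exact: (is_derive_continuous dF).
- by move=> x _; rewrite derive1E; exact: (@derive_val _ _ _ _ _ _ _ (dF x)).
Qed.

(** The fundamental theorem of calculus on a half-line requires a nonnegative
    integrand, hence the summand [1]. *)
Let integral_exp_cos :
  (\int[mu]_(x in `[0%R, +oo[) (expR (- (e * x)) * (1 + cos (t * x)))%:E =
    (e^-1 + e / (e ^+ 2 + t ^+ 2))%:E)%E.
Proof.
have dH x : is_derive (x : R) 1 (F + G) (expR (- (e * x)) * (1 + cos (t * x))).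
  by rewrite mulrDr mulr1; exact: (is_deriveD (dF x) (dG x)).
rewrite (@ge0_continuous_FTC2y _ _ (F + G) 0 0)//.
- rewrite /F /G addrfctE !mulr0 oppr0 expR0 !mul1r sin0 cos0 -EFinB; congr EFin.
  by rewrite mulr0 mulr1; field; rewrite ?den0 ?lt0r_neq0.
- apply: continuous_subspaceT => x; apply: cvgM; first exact: (is_derive_continuous dE).
  apply: cvgD; first exact: cvg_cst.
  apply: (@continuous_cvg _ _ _ _ _ (fun x => t * x) cos (t * x)); first exact: continuous_cos.
  by apply: cvgM; [exact: cvg_cst|exact: cvg_id].
- by rewrite -[X in _ --> X]addr0; exact: cvgD.
- by apply: cvg_at_right_filter; exact: (is_derive_continuous dH).
- by move=> x _; rewrite derive1E; exact: (@derive_val _ _ _ _ _ _ _ (dH x)).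
Qed.

Lemma rint_expw : rint (expw e).
Proof.
apply/integrableP; split; first by apply/measurable_EFinP; exact: measurable_expw.
rewrite (eq_integral (fun x => (expw e x * 1)%:E)); last first.
  by move=> x _; rewrite /= ger0_norm ?expw_ge0// mulr1.
rewrite expw_integral//; under eq_integral do rewrite mulr1.
by rewrite integral_exp ltry.
Qed.

Lemma cosT_expw : cosT (expw e) t = e / (e ^+ 2 + t ^+ 2).
Proof.
have mc : measurable_fun [set: T] (fun x : T => 1 + cos (t * x)).
  apply: measurable_funD => //; apply: measurableT_comp; first exact: measurable_cos.
  exact: measurable_funM.
have i1 : \int[mu]_x (expw e x * (1 + cos (t * x))) = e^-1 + e / (e ^+ 2 + t ^+ 2).
  by rewrite /Rintegral expw_integral// integral_exp_cos.
have i2 : \int[mu]_x expw e x = e^-1.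
  rewrite /Rintegral (eq_integral (fun x => (expw e x * 1)%:E)); last first.
    by move=> x _; rewrite mulr1.
  by rewrite expw_integral//; under eq_integral do rewrite mulr1; rewrite integral_exp.
have := i1; rewrite (@eq_Rintegral _ _ _ mu _ (fun x => expw e x + cos (t * x) * expw e x)); last first.
  by move=> x _; rewrite mulrDr mulr1 [expw e x * _]mulrC.
rewrite RintegralD//; [|exact: rint_expw|exact/rint_cos_mul/rint_expw].
by rewrite i2 => /addrI.
Qed.
End laplace.
End poisson_kernel.

(** * The upper Plancherel bound *)

Section poisson_integrals.
Variable R : realType.
Local Notation T := (measurableTypeR R).
Local Notation mu := (@lebesgue_measure R).
Local Notation rint f := (mu.-integrable [set: T] (EFin \o f)).

Lemma ge0_integral_fold (f : T -> R) : measurable_fun [set: T] f ->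
  (forall x, 0 <= f x) ->
  (\int[mu]_x (f x)%:E = \int[mu]_x (expw 0 x * (f x + f (- x)))%:E)%E.
Proof.
move=> mf f0.
have mfN : measurable_fun [set: T] (fun x : T => f (- x)) by exact: measurableT_comp.
have mw := @measurable_expw R 0.
have mwN : measurable_fun [set: T] (fun x : T => expw 0 (- x)).
  exact: (measurableT_comp mw).
rewrite (ae_eq_integral (fun x => (expw 0 x * f x + expw 0 (- x) * f x)%:E))//; last 3 first.
- exact/measurable_EFinP.
- apply/measurable_EFinP; apply: measurable_funD; exact: measurable_funM.
- have : mu.-negligible [set (0 : R)].
    apply/negligibleP; first exact: measurable_set1.
    exact: lebesgue_measure_set1.
  apply: negligibleS => x /= /not_implyP[_ h]; apply: contrapT => /eqP x0; apply: h.
  congr EFin; rewrite /expw !mul0r oppr0 expR0 oppr_gt0.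
  by case: ltgtP x0 => // _ _; rewrite mul0r mul1r ?addr0 ?add0r.
under eq_integral do rewrite EFinD.
under [RHS]eq_integral do rewrite mulrDr EFinD.
rewrite !ge0_integralD//; try by [move=> x _; rewrite lee_fin mulr_ge0 ?expw_ge0|
  apply/measurable_EFinP; exact: measurable_funM].
congr (_ + _)%E.
rewrite -(@ge0_integral_affine _ (-1) 0 (fun x => (expw 0 (- x) * f x)%:E))//.
- rewrite normrN normr1 mul1e; apply: eq_integral => x _.
  by rewrite addr0 mulN1r opprK.
- by apply/measurable_EFinP; exact: measurable_funM.
- by move=> x; rewrite lee_fin mulr_ge0 ?expw_ge0.
Qed.

Lemma ge0_integral_even (f : T -> R) : measurable_fun [set: T] f ->
  (forall x, 0 <= f x) -> (forall x, f (- x) = f x) ->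
  (\int[mu]_x (f x)%:E = 2%:E * \int[mu]_x (expw 0 x * f x)%:E)%E.
Proof.
move=> mf f0 fN; rewrite ge0_integral_fold// -ge0_integralZl//.
- by apply: eq_integral => x _; rewrite fN -EFinM; congr EFin; ring.
- by apply/measurable_EFinP; apply: measurable_funM => //; exact: measurable_expw.
- by move=> x _; rewrite lee_fin mulr_ge0 ?expw_ge0.
Qed.

Section poisson.
Variable e : R.
Hypothesis e0 : 0 < e.

Let den_gt0 y : 0 < e ^+ 2 + y ^+ 2.
Proof. by rewrite ltr_wpDr ?sqr_ge0// exprn_gt0. Qed.

Let den0 y : e ^+ 2 + y ^+ 2 != 0. Proof. exact/lt0r_neq0/den_gt0. Qed.

Let K (y : R) := e / (e ^+ 2 + y ^+ 2).

Let K_ge0 y : 0 <= K y. Proof. by rewrite divr_ge0 ?ltW. Qed.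

Let cK : continuous K.
Proof.
move=> y; apply: cvgM; first exact: cvg_cst.
apply: cvgV; first exact: den0.
by apply: cvgD; [exact: cvg_cst|apply: cvgM; exact: cvg_id].
Qed.

Let mK : measurable_fun [set: T] K. Proof. exact: continuous_measurable_fun. Qed.

Let A (y : R) := atan (e^-1 * y).

Let dA y : is_derive (y : R) 1 A (K y).
Proof.
have dat : is_derive (e^-1 * y) 1 atan (1 + (e^-1 * y) ^+ 2)^-1.
  by apply: DeriveDef; [exact: derivable_atan|rewrite -derive1E derive1_atan].
have h := is_derive1_comp dat (is_derive_mul_const e^-1 y).
rewrite (_ : K y = (1 + (e^-1 * y) ^+ 2)^-1 * e^-1); first exact: h.
rewrite /K; have e00 := lt0r_neq0 e0; field.
by rewrite e00 den0.
Qed.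

Lemma integral_poisson_itv a b : a < b ->
  (\int[mu]_(y in `[a, b]) (e / (e ^+ 2 + y ^+ 2))%:E =
   (atan (e^-1 * b) - atan (e^-1 * a))%:E)%E.
Proof.
move=> ab; rewrite (@continuous_FTC2 _ K A)//.
- by apply: continuous_subspaceT.
- split.
  + by move=> x _; exact: (@ex_derive _ _ _ _ _ _ _ (dA x)).
  + by apply: cvg_at_right_filter; exact: (is_derive_continuous dA).
  + by apply: cvg_at_left_filter; exact: (is_derive_continuous dA).
- by move=> x _; rewrite derive1E; exact: (@derive_val _ _ _ _ _ _ _ (dA x)).
Qed.

Lemma integral_poisson : (\int[mu]_y (e / (e ^+ 2 + y ^+ 2))%:E = (pi : R)%:E)%E.
Proof.
rewrite ge0_integral_even//; last by move=> x; rewrite sqrrN.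
rewrite expw_integral//.
under eq_integral do rewrite mul0r oppr0 expR0 mul1r.
rewrite (@ge0_continuous_FTC2y _ K A 0 (pi / 2))//.
- by rewrite /A mulr0 atan0 sube0 -EFinM; congr EFin; field.
- by apply: continuous_subspaceT.
- apply: (@cvg_comp _ _ _ (fun y => e^-1 * y) atan _ +oo%R); last exact: cvgy_atan.
  by apply: gt0_cvgMry; rewrite ?invr_gt0//; exact: cvg_id.
- by apply: cvg_at_right_filter; exact: (is_derive_continuous dA).
- by move=> x _; rewrite derive1E; exact: (@derive_val _ _ _ _ _ _ _ (dA x)).
Qed.

Lemma integral_poisson_shift t :
  (\int[mu]_s (e / (e ^+ 2 + (t - s) ^+ 2))%:E = (pi : R)%:E)%E.
Proof.
rewrite -integral_poisson -(@ge0_integral_affine _ (-1) t (fun y => (K y)%:E))//.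
- by rewrite normrN normr1 mul1e; apply: eq_integral => x _; rewrite /K mulN1r [- x + t]addrC.
- exact/measurable_EFinP.
Qed.
End poisson.
End poisson_integrals.

Section plancherel_upper.
Variable R : realType.
Local Notation T := (measurableTypeR R).
Local Notation mu := (@lebesgue_measure R).
Local Notation rint f := (mu.-integrable [set: T] (EFin \o f)).
Variable p : T -> R.
Hypothesis ip : rint p.
Let mp : measurable_fun [set: T] p. Proof. exact: rint_measurable. Qed.

(** The squared modulus of the Fourier transform of the real function [p]. *)
Definition power : T -> R := fun x => cosT p x ^+ 2 + sinT p x ^+ 2.

Lemma power_ge0 x : 0 <= power x.
Proof. by rewrite addr_ge0// sqr_ge0. Qed.

Lemma measurable_power : measurable_fun [set: T] power.
Proof.
by apply: measurable_funD; apply: measurable_funX; [exact: measurable_cosT|exact: measurable_sinT].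
Qed.

(** By [winv_pairing], the left-hand side is
    [\int \int p t * p s * K (t - s)] with [K] the Poisson kernel.  As
    [p t * p s] is at most the mean of [p t ^+ 2] and [p s ^+ 2], and [K] is even
    with mass [pi], the bound follows. *)
Let weighted_le (e : R) : 0 < e ->
  (\int[mu]_x (expw e x * power x)%:E <= (pi : R)%:E * \int[mu]_x (p x ^+ 2)%:E)%E.
Proof.
move=> e0; have iW := rint_expw e0.
pose K (y : R) := e / (e ^+ 2 + y ^+ 2).
have K0 y : 0 <= K y by rewrite divr_ge0 ?addr_ge0 ?sqr_ge0// ltW.
have mK1 : measurable_fun [set: T] K.
  by rewrite (_ : K = cosT (expw e)); [apply: measurable_cosT; exact: measurable_expw|apply/funext => y; rewrite cosT_expw].
have mK2 : measurable_fun [set: T * T] (fun z : T * T => K (z.1 - z.2)).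
  by apply: (measurableT_comp mK1); exact: measurable_funB.
have Keven y : K (- y) = K y by rewrite /K sqrrN.
rewrite -EFin_Rintegral; last exact: rint_weighted_square.
rewrite -(winv_pairing iW ip).
have [M wM] := winv_bound iW ip.
have mwinv := measurable_winv iW ip.
have ipw : rint (fun t => p t * winv (expw e) p t).
  under [X in EFin \o X]eq_fun do rewrite mulrC.
  exact: integrable_bounded_mul ip.
apply: (@le_trans _ _ (\int[mu]_t (`|p t| * `|winv (expw e) p t|)%:E)%E).
  rewrite EFin_Rintegral//; apply: le_trans (lee_abs _) _.
  apply: le_trans (le_abse_integral _ _ _) _ => //; first exact: measurable_int ipw.
  by under eq_integral do rewrite /= normrM.
pose H t s : R := 2^-1 * (p t ^+ 2 * K (t - s) + p s ^+ 2 * K (t - s)).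
have H0 t s : 0 <= H t s by rewrite mulr_ge0// addr_ge0// mulr_ge0// sqr_ge0.
have mH : measurable_fun [set: T * T] (fun z : T * T => (H z.1 z.2)%:E).
  apply/measurable_EFinP; apply: measurable_funM => //; apply: measurable_funD.
    by apply: measurable_funM => //; apply: measurable_funX; exact: measurableT_comp.
  by apply: measurable_funM => //; apply: measurable_funX; exact: measurableT_comp.
have mpabs : measurable_fun [set: T] (fun t => `|p t|) by exact: measurableT_comp.
have mKs t : measurable_fun [set: T] (fun s : T => K (t - s)).
  by apply: (measurableT_comp mK1); exact: measurable_funB.
apply: (@le_trans _ _ (\int[mu]_t \int[mu]_s (H t s)%:E)%E).
  apply: ge0_le_integral => //.
  - by apply/measurable_EFinP; apply: measurable_funM => //; exact: measurableT_comp.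
  - by apply: (@measurable_fun_fubini_tonelli_F _ _ T T _ mu (fun z => (H z.1 z.2)%:E)) => // z; rewrite lee_fin.
  - move=> t _; rewrite winvE// EFinM.
    have ipK : rint (fun s => p s * K (t - s)).
      under [X in EFin \o X]eq_fun do rewrite mulrC.
      apply: (@integrable_bounded_mul _ _ _ _ _ _ (e^-1) _ _ ip) => // y.
      rewrite ger0_norm// /K ler_pdivrMr; last by rewrite ltr_wpDr ?sqr_ge0// exprn_gt0.
      by rewrite mulrDr expr2 mulKf ?lt0r_neq0// lerDl mulr_ge0 ?sqr_ge0// invr_ge0 ltW.
    apply: (@le_trans _ _ (`|p t|%:E * \int[mu]_s (`|p s| * K (t - s))%:E)%E).
      rewrite lee_wpmul2l// (@eq_Rintegral _ _ _ mu _ (fun s => p s * K (t - s))); last first.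
        by move=> s _; rewrite cosT_expw.
      rewrite EFin_normr_Rintegral//; apply: le_trans (le_abse_integral _ _ _) _ => //.
        exact: measurable_int ipK.
      by rewrite le_eqVlt; apply/orP; left; apply/eqP; apply: eq_integral => s _; rewrite /= normrM (ger0_norm (K0 _)).
    rewrite -ge0_integralZl//; last 2 first.
    + by apply/measurable_EFinP; exact: measurable_funM.
    + by move=> s _; rewrite lee_fin mulr_ge0.
    apply: ge0_le_integral => //.
    + by move=> s _; rewrite mule_ge0// lee_fin mulr_ge0.
    + by apply: emeasurable_funM => //; apply/measurable_EFinP; exact: measurable_funM.
    + exact: (measurable_fun_section t mH).
    + move=> s _; rewrite -EFinM lee_fin mulrA.
      rewrite (_ : H t s = 2^-1 * (p t ^+ 2 + p s ^+ 2) * K (t - s)); last first.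
        by rewrite /H; ring.
      rewrite ler_wpM2r// -[p t ^+ 2]real_normK ?num_real// -[p s ^+ 2]real_normK ?num_real//.
      by have := sqr_ge0 (`|p t| - `|p s|); lra.
have mp2 : measurable_fun [set: T] (fun t => p t ^+ 2) by exact: measurable_funX.
pose H1 t s : R := 2^-1 * (p t ^+ 2 * K (t - s)).
have mH1 : measurable_fun [set: T * T] (fun z : T * T => (H1 z.1 z.2)%:E).
  apply/measurable_EFinP; apply: measurable_funM => //.
  by apply: measurable_funM => //; exact: (measurableT_comp mp2).
pose H2 t s : R := 2^-1 * (p s ^+ 2 * K (t - s)).
have mH2 : measurable_fun [set: T * T] (fun z : T * T => (H2 z.1 z.2)%:E).
  apply/measurable_EFinP; apply: measurable_funM => //.
  by apply: measurable_funM => //; exact: (measurableT_comp mp2).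
have H10 t s : (0 <= (H1 t s)%:E)%E by rewrite lee_fin mulr_ge0// mulr_ge0// sqr_ge0.
have H20 t s : (0 <= (H2 t s)%:E)%E by rewrite lee_fin mulr_ge0// mulr_ge0// sqr_ge0.
have inner t : (\int[mu]_s (H1 t s)%:E = (2^-1 * pi)%:E * (p t ^+ 2)%:E)%E.
  rewrite /H1 (_ : (fun s => _) = (fun s => (2^-1 * p t ^+ 2)%:E * (K (t - s))%:E)%E); last first.
    by apply/funext => s; rewrite -EFinM mulrA.
  rewrite ge0_integralZl//; last 3 first.
  - exact/measurable_EFinP.
  - by move=> s _; rewrite lee_fin.
  - by rewrite lee_fin mulr_ge0// sqr_ge0.
  by rewrite integral_poisson_shift// -!EFinM; congr EFin; ring.
have I1 : (\int[mu]_t \int[mu]_s (H1 t s)%:E = (2^-1 * pi)%:E * \int[mu]_x (p x ^+ 2)%:E)%E.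
  under eq_integral do rewrite inner.
  rewrite ge0_integralZl//.
  - exact/measurable_EFinP.
  - by move=> s _; rewrite lee_fin sqr_ge0.
  - by rewrite lee_fin mulr_ge0// pi_ge0.
rewrite (_ : (\int[mu]_t _ = \int[mu]_t (\int[mu]_s (H1 t s)%:E + \int[mu]_s (H2 t s)%:E))%E); last first.
  apply: eq_integral => t _; rewrite -ge0_integralD//.
  - by apply: eq_integral => s _; rewrite -EFinD /H mulrDr.
  - exact: (measurable_fun_section t mH1).
  - exact: (measurable_fun_section t mH2).
rewrite ge0_integralD//; last 4 first.
- by move=> t _; exact: integral_ge0.
- exact: (@measurable_fun_fubini_tonelli_F _ _ T T _ mu (fun z => (H1 z.1 z.2)%:E)).
- by move=> t _; exact: integral_ge0.
- exact: (@measurable_fun_fubini_tonelli_F _ _ T T _ mu (fun z => (H2 z.1 z.2)%:E)).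
have I2 : (\int[mu]_t \int[mu]_s (H2 t s)%:E = \int[mu]_t \int[mu]_s (H1 t s)%:E)%E.
  apply: (eq_trans (@fubini_tonelli _ _ T T _ mu mu (fun z => (H2 z.1 z.2)%:E) mH2 (fun z => H20 z.1 z.2))).
  apply: eq_integral => t _; apply: eq_integral => s _; congr EFin.
  by rewrite /H1 /H2 -(Keven (t - s)) opprB.
rewrite I2 I1 -ge0_muleDl ?lee_fin ?mulr_ge0 ?pi_ge0// -EFinD.
by rewrite (_ : _ + _ = pi)//; field.
Qed.

Theorem plancherel_upper :
  (\int[mu]_x (expw 0 x * power x)%:E <= (pi : R)%:E * \int[mu]_x (p x ^+ 2)%:E)%E.
Proof.
apply: (@fatou_bound _ _ _ mu (fun n x => expw n.+1%:R^-1 x * power x)).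
- by move=> n; apply: measurable_funM; [exact: measurable_expw|exact: measurable_power].
- by apply: measurable_funM; [exact: measurable_expw|exact: measurable_power].
- by move=> n x; rewrite mulr_ge0 ?expw_ge0 ?power_ge0.
- by move=> x; rewrite mulr_ge0 ?expw_ge0 ?power_ge0.
- by apply: aeW => x; apply: cvgM; [exact: expw_cvg|exact: cvg_cst].
- by move=> n; apply: weighted_le; rewrite invr_gt0.
Qed.
End plancherel_upper.

(** * Averaged Poisson kernels *)

Section box_weight.
Variable R : realType.
Local Notation T := (measurableTypeR R).
Local Notation mu := (@lebesgue_measure R).
Local Notation rint f := (mu.-integrable [set: T] (EFin \o f)).

Definition box (a b : R) : T -> R := \1_(`[a, b]%classic : set T).

Lemma measurable_box a b : measurable_fun [set: T] (box a b).
Proof. exact: measurable_indic. Qed.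

Lemma rint_box a b : rint (box a b).
Proof. exact: integrable_indic_itv. Qed.

Lemma Rintegral_box (a b : R) (f : T -> R) :
  \int[mu]_v (f v * box a b v) = \int[mu]_(v in `[a, b]) f v.
Proof.
rewrite [RHS]Rintegral_mkcond; apply: eq_Rintegral => v _.
rewrite /box indicE patchE; case: ifP => _; first by rewrite mulr1.
by rewrite mulr0.
Qed.

Lemma Rintegral_cst_itv (a b c : R) : a < b ->
  \int[mu]_(v in `[a, b]) c = c * (b - a).
Proof.
move=> ab; rewrite Rintegral_cst//; congr (_ * _).
have := @lebesgue_measure_itv R `[a, b]; rewrite /= lte_fin ab -EFinB.
by move=> h; rewrite [X in fine X]h.
Qed.

Lemma cosT_box a b x : a < b -> cosT (box a b) x =
  if x == 0 then b - a else (sin (x * b) - sin (x * a)) / x.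
Proof.
move=> ab; rewrite /cosT Rintegral_box; have [->|x0] := eqVneq x 0.
  under eq_Rintegral do rewrite mul0r cos0.
  by rewrite Rintegral_cst_itv// mul1r.
have dS (v : R) : is_derive v 1 (fun v => sin (x * v) * x^-1) (cos (x * v)).
  have h := is_derive_mulr_const x^-1
    (is_derive1_comp (is_derive_sin (x * v)) (is_derive_mul_const x v)).
  by rewrite -mulrA divff// mulr1 in h.
rewrite /Rintegral (@continuous_FTC2 _ _ (fun v => sin (x * v) * x^-1))//.
- by rewrite -EFinB /= mulrBl.
- apply: continuous_subspaceT => v.
  apply: (@continuous_cvg _ _ _ _ _ (fun v => x * v) cos (x * v)); first exact: continuous_cos.
  by apply: cvgM; [exact: cvg_cst|exact: cvg_id].
- split.
  + by move=> v _; exact: (@ex_derive _ _ _ _ _ _ _ (dS v)).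
  + by apply: cvg_at_right_filter; exact: (is_derive_continuous dS).
  + by apply: cvg_at_left_filter; exact: (is_derive_continuous dS).
- by move=> v _; rewrite derive1E; exact: (@derive_val _ _ _ _ _ _ _ (dS v)).
Qed.

Variable r : R.
Hypothesis r0 : 0 < r.

Let rr : - r < r. Proof. by rewrite gtrN. Qed.
Let yrr y : y - r < y + r. Proof. by rewrite ltrD2l. Qed.

(** Multiplication by [cos (x * y)] translates the interval by [y]; this is the
    product-to-sum formula for [cos (x * y) * sin (x * r)]. *)
Lemma cos_mul_box x y :
  cos (x * y) * cosT (box (- r) r) x = cosT (box (y - r) (y + r)) x.
Proof.
rewrite !cosT_box//; case: eqP => [->|/eqP x0].
  by rewrite mul0r cos0 mul1r; ring.
rewrite mulrN sinN mulrBr mulrDr sinD sinB; field.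
by [].
Qed.

(** Normalized so that [boxw 0 = 1]: by [cos_mul_box], this factor replaces a
    transform by its average over an interval of length [2 * r]. *)
Definition boxw : T -> R := fun x => (2 * r)^-1 * cosT (box (- r) r) x.

Lemma boxw_le1 x : `|boxw x| <= 1.
Proof.
rewrite /boxw normrM gtr0_norm ?invr_gt0 ?mulr_gt0// mulrC ler_pdivrMr ?mulr_gt0// mul1r.
apply: le_trans (cosT_bound x (rint_box _ _)) _.
rewrite (@eq_Rintegral _ _ _ mu _ (fun v => 1 * box (- r) r v)); last first.
  by move=> v _; rewrite mul1r ger0_norm.
rewrite Rintegral_box Rintegral_cst_itv// mul1r.
by rewrite le_eqVlt; apply/orP; left; apply/eqP; ring.
Qed.

Lemma measurable_boxw : measurable_fun [set: T] boxw.
Proof. by apply: measurable_funM => //; apply: measurable_cosT; exact: measurable_box. Qed.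

Variable e : R.
Hypothesis e0 : 0 < e.

Definition expboxw : T -> R := fun x => boxw x * expw e x.

Lemma rint_expboxw : rint expboxw.
Proof.
apply: integrable_bounded_mul (rint_expw e0); first exact: measurable_boxw.
exact: boxw_le1.
Qed.

Lemma expboxw_le x : `|expboxw x| <= expw 0 x.
Proof.
rewrite normrM (ger0_norm (expw_ge0 _ _)); apply: le_trans (expw_le x (ltW e0)).
by rewrite -[leRHS]mul1r ler_wpM2r ?expw_ge0 ?boxw_le1.
Qed.

(** The transform of [expw e] is the Poisson kernel; this is its average over the
    interval of centre [y] and radius [r]. *)
Lemma cosT_expboxw y : cosT expboxw y =
  (2 * r)^-1 * (atan (e^-1 * (y + r)) - atan (e^-1 * (y - r))).
Proof.
transitivity ((2 * r)^-1 * \int[mu]_x (expw e x * cosT (box (y - r) (y + r)) x)).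
  rewrite -RintegralZl//.
    apply: eq_Rintegral => x _; rewrite -cos_mul_box /expboxw /boxw [x * y]mulrC; ring.
  by apply: rint_mul_cosT; [exact: rint_expw|exact: rint_box].
rewrite (cosT_dual (rint_expw e0) (rint_box _ _)); congr (_ * _).
rewrite (@eq_Rintegral _ _ _ mu _ (fun v => e / (e ^+ 2 + v ^+ 2) * box (y - r) (y + r) v)); last first.
  by move=> v _; rewrite cosT_expw// mulrC.
by rewrite Rintegral_box /Rintegral integral_poisson_itv.
Qed.
End box_weight.

Section plancherel_lower.
Variable R : realType.
Local Notation T := (measurableTypeR R).
Local Notation mu := (@lebesgue_measure R).
Local Notation rint f := (mu.-integrable [set: T] (EFin \o f)).
Variable p : T -> R.
Hypothesis ip : rint p.

Lemma integral_power (f : T -> R) : rint f ->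
  (\int[mu]_x (power f x)%:E <= (2 * pi)%:E * \int[mu]_x (f x ^+ 2)%:E)%E.
Proof.
move=> If; rewrite ge0_integral_even.
- by rewrite EFinM -muleA lee_wpmul2l//; exact: plancherel_upper.
- exact: measurable_power.
- exact: power_ge0.
- by move=> x; rewrite /power cosTN sinTN// sqrrN.
Qed.

(** [winv W p] is built from the transforms of [W * cosT p] and [W * sinT p], whose
    square integrals the upper bound controls. *)
Lemma integral_winv_le (W : T -> R) : rint W -> (forall x, `|W x| <= expw 0 x) ->
  (\int[mu]_t (winv W p t ^+ 2)%:E <= (4 * pi)%:E * \int[mu]_x (expw 0 x * power p x)%:E)%E.
Proof.
move=> iW Wle.
pose f1 := fun x => W x * cosT p x; pose f2 := fun x => W x * sinT p x.
have if1 : rint f1 by exact: rint_mul_cosT.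
have if2 : rint f2 by exact: rint_mul_sinT.
have mf1 := rint_measurable if1; have mf2 := rint_measurable if2.
have mpw f : rint f -> measurable_fun [set: T] (fun x => (2 * power f x)%:E).
  by move=> If; apply/measurable_EFinP; apply: measurable_funM => //; exact: measurable_power.
apply: (@le_trans _ _ (\int[mu]_t ((2 * power f1 t)%:E + (2 * power f2 t)%:E))%E).
  apply: ge0_le_integral => //.
  - by move=> x _; rewrite lee_fin sqr_ge0.
  - by apply/measurable_EFinP; apply: measurable_funX; exact: measurable_winv.
  - by apply: emeasurable_funD; exact: mpw.
  - move=> t _; rewrite -EFinD lee_fin /winv /power -/f1 -/f2.
    move: (cosT f1 t) (sinT f1 t) (cosT f2 t) (sinT f2 t) => a b c d.
    have := sqr_ge0 (a - d); have := sqr_ge0 b; have := sqr_ge0 c; lra.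
rewrite ge0_integralD//; last 4 first.
- by move=> t _; rewrite lee_fin mulr_ge0 ?power_ge0.
- exact: mpw.
- by move=> t _; rewrite lee_fin mulr_ge0 ?power_ge0.
- exact: mpw.
have h f : rint f -> (\int[mu]_t (2 * power f t)%:E <= (4 * pi)%:E * \int[mu]_x (f x ^+ 2)%:E)%E.
  move=> If; under eq_integral do rewrite EFinM.
  rewrite ge0_integralZl//; last 2 first.
  - by apply/measurable_EFinP; exact: measurable_power.
  - by move=> t _; rewrite lee_fin power_ge0.
  rewrite (_ : 4 * pi = 2 * (2 * pi)); last by ring.
  by rewrite (EFinM 2 (2 * pi)) -muleA lee_wpmul2l//; exact: integral_power.
apply: (@le_trans _ _ ((4 * pi)%:E * \int[mu]_x (f1 x ^+ 2)%:E +
  (4 * pi)%:E * \int[mu]_x (f2 x ^+ 2)%:E)%E).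
  by apply: leeD; exact: h.
have pi0 : 0 <= 4 * pi :> R by rewrite mulr_ge0// pi_ge0.
have sq0 (f : T -> R) : (0 <= \int[mu]_x (f x ^+ 2)%:E)%E.
  by apply: integral_ge0 => x _; rewrite lee_fin sqr_ge0.
rewrite -(ge0_muleDr _ (sq0 f1) (sq0 f2)); apply: lee_wpmul2l => //.
rewrite -ge0_integralD//; last 4 first.
- by move=> x _; rewrite lee_fin sqr_ge0.
- by apply/measurable_EFinP; exact: measurable_funX.
- by move=> x _; rewrite lee_fin sqr_ge0.
- by apply/measurable_EFinP; exact: measurable_funX.
apply: ge0_le_integral => //.
- by move=> x _; rewrite -EFinD lee_fin addr_ge0// sqr_ge0.
- by apply: emeasurable_funD; apply/measurable_EFinP; exact: measurable_funX.
- by apply/measurable_EFinP; apply: measurable_funM; [exact: measurable_expw|exact: measurable_power].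
- move=> x _; rewrite -EFinD lee_fin /f1 /f2 !exprMn -mulrDr ler_wpM2r ?power_ge0//.
  rewrite -real_normK ?num_real// expr2.
  apply: (@le_trans _ _ (1 * `|W x|)); last by rewrite mul1r.
  by rewrite ler_wpM2r// (le_trans (Wle x))// expw0_le1.
Qed.
End plancherel_lower.

(** * The lower Plancherel bound *)

Section box_averages.
Variable R : realType.
Local Notation T := (measurableTypeR R).
Local Notation mu := (@lebesgue_measure R).
Local Notation rint f := (mu.-integrable [set: T] (EFin \o f)).
Variable p : T -> R.
Hypothesis ip : rint p.
Let mp : measurable_fun [set: T] p. Proof. exact: rint_measurable. Qed.

Lemma atan_cvg_pos (z : R) : 0 < z ->
  (fun n => atan (n.+1%:R^-1^-1 * z)) @ \oo --> (pi / 2 : R).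
Proof.
move=> z0; pose g (n : nat) : R := n.+1%:R^-1^-1 * z.
have : g @ \oo --> +oo%R.
  apply/cvgryPge => A; have /cvgryPge/(_ (A / z)) := @cvgr_idn R.
  apply: filterS => n; rewrite ler_pdivrMr// => h; apply: le_trans h _.
  by rewrite /g invrK; apply: ler_wpM2r; rewrite ?ler_nat//; exact: ltW.
by move=> h; apply: (@cvg_comp _ _ _ g (@atan R) _ _ _ h); exact: cvgy_atan.
Qed.

Lemma atan_cvg_neg (z : R) : z < 0 ->
  (fun n => atan (n.+1%:R^-1^-1 * z)) @ \oo --> (- (pi / 2) : R).
Proof.
move=> z0; rewrite (_ : (fun n => _) = (fun n => - atan (n.+1%:R^-1^-1 * - z))).
  by apply: cvgN; apply: atan_cvg_pos; rewrite oppr_gt0.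
by apply/funext => n; rewrite mulrN atanN opprK.
Qed.

Variable r : R.
Hypothesis r0 : 0 < r.

Definition average (t : R) : R := (2 * r)^-1 * \int[mu]_(s in ball t r) p s.

Let W n := expboxw r n.+1%:R^-1.

(** As the parameter [n.+1%:R^-1] tends to [0], the two arctangents of
    [cosT_expboxw] at [t - s] tend to [pi / 2] or [- (pi / 2)], with opposite
    signs exactly when [s] lies in the ball of centre [t] and radius [r]. *)
Lemma winv_cvg_average (t : R) : (fun n => winv (W n) p t) @ \oo --> pi * average t.
Proof.
have iW n : rint (W n) by exact: rint_expboxw.
pose f_ n s := (p s * cosT (W n) (t - s))%:E.
pose f s := (p s * ((2 * r)^-1 * (pi * \1_(ball t r) s)))%:E.
have mball : measurable (ball t r : set T) by exact: measurable_ball.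
have mf_ n : measurable_fun [set: T] (f_ n).
  apply/measurable_EFinP; apply: measurable_funM => //.
  apply: (measurableT_comp (f := cosT (W n))).
    by apply: measurable_cosT; exact: rint_measurable.
  exact: measurable_funB.
have mf : measurable_fun [set: T] f.
  apply/measurable_EFinP; apply: measurable_funM => //; apply: measurable_funM => //.
  by apply: measurable_funM => //; exact: measurable_indic.
have := @dominated_convergence _ _ _ mu _ measurableT f_ f
  (EFin \o (fun s => (2 * r)^-1 * pi * `|p s|)) mf_ mf.
case.
  (* The endpoints of the interval are exceptional: one arctangent vanishes there. *)
- have : mu.-negligible ([set t - r] `|` [set t + r]).
    have ng (x : T) : mu.-negligible [set x].
      by exists [set x]; split => //; exact: (@lebesgue_measure_set1 R x).
    exact: (negligibleU (ng _) (ng _)).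
  apply: negligibleS => s /= /not_implyP[_ h]; apply: contrapT => /not_orP[s1 s2]; apply: h.
  apply: cvg_EFin; first exact: nearW.
  apply: cvgM; first exact: cvg_cst.
  rewrite /= (_ : (fun n => _) = (fun n => (2 * r)^-1 *
    (atan (n.+1%:R^-1^-1 * (t - s + r)) - atan (n.+1%:R^-1^-1 * (t - s - r))))); last first.
    by apply/funext => n; rewrite /W cosT_expboxw.
  apply: cvgM; first exact: cvg_cst.
  have [s3|s3] := ltP `|t - s| r.
    move: (s3); rewrite ltr_norml => /andP[s4 s5].
    rewrite indicE mem_set// mulr1 [X in _ --> X](_ : _ = pi / 2 - - (pi / 2)); last by field.
    by apply: cvgB; [apply: atan_cvg_pos; lra|apply: atan_cvg_neg; lra].
  rewrite indicE memNset ?mulr0; last by apply/negP; rewrite -leNgt.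
  have [ts|ts] := leP 0 (t - s).
    rewrite ger0_norm// in s3; rewrite -[0](subrr (pi / 2)).
    have d1 : 0 < t - s - r.
      rewrite lt_neqAle subr_ge0 s3 andbT eq_sym subr_eq0; apply/eqP => h.
      by apply: s1; rewrite /= -h opprB addrCA subrr addr0.
    have d3 : 0 < t - s + r by rewrite ltr_wpDl.
    by apply: cvgB; apply: atan_cvg_pos.
  rewrite ltr0_norm// in s3; rewrite -[0](subrr (- (pi / 2))).
  have d2 : t - s + r < 0.
    rewrite -oppr_gt0 opprD lt_neqAle subr_ge0 s3 andbT eq_sym subr_eq0; apply/eqP => h.
    by apply: s2; rewrite /= -h opprB addrCA subrr addr0.
  have d3 : t - s - r < 0 by rewrite subr_lt0; exact: lt_trans ts r0.
  by apply: cvgB; apply: atan_cvg_neg.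
- by apply: integrableZl_EFin; exact: integrable_norm ip.
- apply: aeW => s n _; rewrite /f_ /= lee_fin normrM mulrC ler_wpM2r//.
  rewrite /W cosT_expboxw// normrM gtr0_norm ?invr_gt0 ?mulr_gt0//.
  rewrite ler_wpM2l ?invr_ge0 ?mulr_ge0 ?ltW//.
  apply: le_lt_trans (ler_normB _ _) _; rewrite [ltRHS]splitr.
  by apply: ltrD; rewrite ltr_norml atan_gtNpi2 atan_ltpi2.
move=> intf _ h.
have <- : fine (\int[mu]_s f s)%E = pi * average t.
  rewrite /average mulrA [RHS]/= Rintegral_mkcond.
  rewrite (@eq_Rintegral _ _ _ mu _ (fun s => \1_(ball t r) s * p s)); last first.
    move=> s _; rewrite patchE indicE; case: ifP => _; first by rewrite mul1r.
    by rewrite mul0r.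
  rewrite -RintegralZl//.
    by congr fine; apply: eq_integral => s _; rewrite /f; congr EFin; ring.
  apply: (@integrable_bounded_mul _ _ _ _ _ _ 1) => //.
  by move=> s; rewrite ger0_norm// indicE; case: (_ \in _).
rewrite (_ : (fun n => _) = fine \o (fun n => \int[mu]_s f_ n s)%E); last first.
  by apply/funext => n; rewrite winvE.
by apply: fine_cvg; rewrite fineK//; exact: integrable_fin_num intf.
Qed.

Lemma measurable_average : measurable_fun [set: T] average.
Proof.
have pi0 : (pi : R) != 0 by rewrite gt_eqF ?pi_gt0.
rewrite (_ : average = fun t => pi^-1 * (pi * average t)); last first.
  by apply/funext => t; rewrite mulKf.
apply: measurable_funM => //.
apply: (measurable_fun_cvg (h := fun n => winv (W n) p)).
  by move=> n; apply: measurable_winv => //; exact: rint_expboxw.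
by move=> t _; exact: winv_cvg_average.
Qed.

Lemma integral_average_le : (\int[mu]_t ((pi * average t) ^+ 2)%:E <=
  (4 * pi)%:E * \int[mu]_x (expw 0 x * power p x)%:E)%E.
Proof.
apply: (@fatou_bound _ _ _ mu (fun n t => winv (W n) p t ^+ 2)).
- by move=> n; apply: measurable_funX; apply: measurable_winv => //; exact: rint_expboxw.
- by apply: measurable_funX; apply: measurable_funM => //; exact: measurable_average.
- by move=> n x; exact: sqr_ge0.
- by move=> x; exact: sqr_ge0.
- by apply: aeW => t; rewrite expr2; under eq_fun do rewrite expr2;
    apply: cvgM; exact: winv_cvg_average.
- move=> n; apply: integral_winv_le => //; first exact: rint_expboxw.
  by move=> x; exact: expboxw_le.
Qed.
End box_averages.

Section plancherel_lower_bound.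
Variable R : realType.
Local Notation T := (measurableTypeR R).
Local Notation mu := (@lebesgue_measure R).
Local Notation rint f := (mu.-integrable [set: T] (EFin \o f)).

Lemma average_cvg (p : T -> R) : rint p ->
  {ae mu, forall t, (fun m => average p m.+1%:R^-1 t) @ \oo --> p t}.
Proof.
move=> ip.
have lip : locally_integrable [set: R] p.
  apply: open_integrable_locally => //; exact: openT.
pose E (x : R) (m : nat) : set R := ball x m.+1%:R^-1.
have m0 m : 0 < m.+1%:R^-1 :> R by rewrite invr_gt0.
have nE x : nicely_shrinking x (E x).
  split; first by move=> m; exact: measurable_ball.
  exists (1, fun m => PosNum (m0 m)); split => //=.
  - exact: cvg_harmonic.
  - by move=> m; exact: subset_refl.
  - by move=> m; rewrite mul1e.
have lpt : {ae mu, forall t, lebesgue_pt p t} := lebesgue_differentiation lip.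
move: lpt; apply: (@filterS _ _ (ae_filter_ringOfSetsType mu)) => t /(nice_lebesgue_differentiation nE lip) h.
have := fine_cvg h.
rewrite (_ : fine \o _ = (fun m => average p m.+1%:R^-1 t)); first exact.
apply/funext => m; rewrite /= /E lebesgue_measure_ball ?ltW// inver.
rewrite gt_eqF ?pmulrn_lgt0// /average /Rintegral.
rewrite fineM//.
  by rewrite /= mulr_natl.
apply: integrable_fin_num; first exact: measurable_ball.
by apply: integrableS ip => //; exact: measurable_ball.
Qed.

(** The averages of [p] over shrinking balls tend to [p] almost everywhere, and
    Fatou's lemma transfers the bounds on their square integrals to [p]. *)
Theorem plancherel_lower (p : T -> R) : rint p ->
  ((pi ^+ 2)%:E * \int[mu]_x (p x ^+ 2)%:E <=
   (4 * pi)%:E * \int[mu]_x (expw 0 x * power p x)%:E)%E.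
Proof.
move=> ip; have mp := rint_measurable ip.
rewrite -ge0_integralZl//; last 3 first.
- by apply/measurable_EFinP; exact: measurable_funX.
- by move=> x _; rewrite lee_fin sqr_ge0.
- by rewrite lee_fin sqr_ge0.
rewrite (eq_integral (fun x => ((pi * p x) ^+ 2)%:E)); last first.
  by move=> x _; rewrite -EFinM exprMn.
apply: (@fatou_bound _ _ _ mu (fun m t => (pi * average p m.+1%:R^-1 t) ^+ 2)).
- move=> m; apply: measurable_funX; apply: measurable_funM => //.
  by apply: measurable_average; rewrite ?invr_gt0.
- by apply: measurable_funX; exact: measurable_funM.
- by move=> n x; exact: sqr_ge0.
- by move=> x; exact: sqr_ge0.
- have := average_cvg ip; apply: (@filterS _ _ (ae_filter_ringOfSetsType mu)) => t ht.
  rewrite expr2; under eq_fun do rewrite expr2.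
  by apply: cvgM; apply: cvgM => //; exact: cvg_cst.
- by move=> m; apply: integral_average_le; rewrite ?invr_gt0.
Qed.
End plancherel_lower_bound.

(** * Plancherel bounds for complex functions *)

Section complex_plancherel.
Variable R : realType.
Local Notation T := (measurableTypeR R).
Local Notation mu := (@lebesgue_measure R).
Local Notation rint f := (mu.-integrable [set: T] (EFin \o f)).

Definition fourier (h : T -> R[i]) : R -> R[i] := fun x =>
  cintegral mu (fun r => cexpi (2 * pi * x * r) * h r).

Variable h : T -> R[i].
Hypothesis ih : cintegrable mu h.
Let p : T -> R := fun r => complex.Re (h r).
Let q : T -> R := fun r => complex.Im (h r).
Let ip : rint p. Proof. by case: ih. Qed.
Let iq : rint q. Proof. by case: ih. Qed.
Let mp : measurable_fun [set: T] p. Proof. exact: rint_measurable. Qed.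
Let mq : measurable_fun [set: T] q. Proof. exact: rint_measurable. Qed.

Let F (x : T) : R := (cosT p x - sinT q x) ^+ 2 + (cosT q x + sinT p x) ^+ 2.

Let Re_fourier x : complex.Re (cintegral mu (fun r => cexpi (x * r) * h r)) =
  cosT p x - sinT q x.
Proof.
rewrite /cintegral /cosT /sinT /= -(@RintegralB _ _ _ mu)//; last 2 first.
- exact: rint_cos_mul.
- exact: rint_sin_mul.
by apply: (@eq_Rintegral _ _ _ mu _) => r _; rewrite ReM.
Qed.

Let Im_fourier x : complex.Im (cintegral mu (fun r => cexpi (x * r) * h r)) =
  cosT q x + sinT p x.
Proof.
rewrite /cintegral /cosT /sinT /= -(@RintegralD _ _ _ mu)//; last 2 first.
- exact: rint_cos_mul.
- exact: rint_sin_mul.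
by apply: (@eq_Rintegral _ _ _ mu _) => r _; rewrite ImM.
Qed.

Let fourierE x : sqmod (fourier h x) = F (2 * pi * x).
Proof. by rewrite /sqmod /fourier Re_fourier Im_fourier. Qed.

Let mF : measurable_fun [set: T] F.
Proof.
apply: measurable_funD; apply: measurable_funX.
  by apply: measurable_funB; [exact: measurable_cosT|exact: measurable_sinT].
by apply: measurable_funD; [exact: measurable_cosT|exact: measurable_sinT].
Qed.

Let F_ge0 x : 0 <= F x. Proof. by rewrite addr_ge0// sqr_ge0. Qed.

(** The products of a transform of [p] with one of [q] have opposite signs at [x]
    and [- x]. *)
Let F_fold x : F x + F (- x) = 2 * (power p x + power q x).
Proof. by rewrite /F !cosTN !sinTN// /power; ring. Qed.

Let P (f : T -> R) := (\int[mu]_x (expw 0 x * power f x)%:E)%E.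

Let mwP (f : T -> R) : rint f ->
  measurable_fun [set: T] (fun x => (expw 0 x * power f x)%:E).
Proof.
move=> mf; apply/measurable_EFinP; apply: measurable_funM.
  exact: measurable_expw.
exact: measurable_power.
Qed.

Let wP_ge0 (f : T -> R) x : (0 <= (expw 0 x * power f x)%:E)%E.
Proof. by rewrite lee_fin mulr_ge0 ?expw_ge0 ?power_ge0. Qed.

Let integral_F : (\int[mu]_x (F x)%:E = 2%:E * (P p + P q))%E.
Proof.
apply: (eq_trans (ge0_integral_fold mF F_ge0)); rewrite /P.
have D := @ge0_integralD _ T R mu _ measurableT _ _ (fun x _ => wP_ge0 p x) (mwP ip)
  (fun x _ => wP_ge0 q x) (mwP iq).
apply: (eq_trans _ (congr1 (mule 2%:E) D)).
have two0 : (0 <= (2%:R : R)%:E)%E by rewrite lee_fin.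
have Z := @ge0_integralZl _ T R mu _ measurableT _
  (emeasurable_funD (mwP ip) (mwP iq)) _ (fun x _ => adde_ge0 (wP_ge0 p x) (wP_ge0 q x)) two0.
apply: (eq_trans _ Z).
by apply: eq_integral => x _; rewrite -EFinD -EFinM F_fold; congr EFin; ring.
Qed.

Let integral_fourier :
  ((2 * pi)%:E * \int[mu]_x (sqmod (fourier h x))%:E = \int[mu]_x (F x)%:E)%E.
Proof.
have pi0 : 0 < 2 * pi :> R by rewrite mulr_gt0// pi_gt0.
have /= <- := @ge0_integral_affine R (2 * pi) 0 (EFin \o F); last 3 first.
- by rewrite gt_eqF.
- exact/measurable_EFinP.
- by move=> x; rewrite lee_fin.
rewrite gtr0_norm//; congr (_ * _)%E; apply: eq_integral => x _.
by rewrite fourierE addr0.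
Qed.

Let integral_sqmod : (\int[mu]_x (sqmod (h x))%:E =
  \int[mu]_x (p x ^+ 2)%:E + \int[mu]_x (q x ^+ 2)%:E)%E.
Proof.
rewrite -ge0_integralD//.
- by move=> x _; rewrite lee_fin sqr_ge0.
- by apply/measurable_EFinP; exact: measurable_funX.
- by move=> x _; rewrite lee_fin sqr_ge0.
- by apply/measurable_EFinP; exact: measurable_funX.
Qed.

Let int_ge0 (f : T -> R) : (0 <= \int[mu]_x (f x ^+ 2)%:E)%E.
Proof. by apply: integral_ge0 => x _; rewrite lee_fin sqr_ge0. Qed.

Let P_ge0 (f : T -> R) : (0 <= P f)%E. Proof. exact: integral_ge0. Qed.

Lemma measurable_sqmod_fourier :
  measurable_fun [set: T] (fun x => sqmod (fourier h x)).
Proof.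
under eq_fun do rewrite fourierE.
by apply: (measurableT_comp (f := F)) => //; exact: measurable_funM.
Qed.

Theorem fourier_upper : (\int[mu]_x (sqmod (fourier h x))%:E <=
  \int[mu]_x (sqmod (h x))%:E)%E.
Proof.
have pi0 : 0 < 2 * pi :> R by rewrite mulr_gt0// pi_gt0.
rewrite -(@lee_pmul2l _ (2 * pi)%:E) ?lte_fin// integral_fourier integral_F integral_sqmod.
rewrite EFinM -muleA lee_pmul2l ?lte_fin// (ge0_muleDr _ (int_ge0 p) (int_ge0 q)).
by apply: leeD; exact: plancherel_upper.
Qed.

(** The factor [4] is the one lost in [plancherel_lower], where the exact identity
    would have [pi] instead of [4 * pi]. *)
Theorem fourier_lower : (\int[mu]_x (sqmod (h x))%:E <=
  4%:E * \int[mu]_x (sqmod (fourier h x))%:E)%E.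
Proof.
have pi0 : 0 < pi :> R by exact: pi_gt0.
rewrite -(@lee_pmul2l _ (pi ^+ 2)%:E) ?lte_fin ?exprn_gt0//.
rewrite (_ : _ * (4%:E * _) = (2 * pi)%:E * ((2 * pi)%:E *
  \int[mu]_x (sqmod (fourier h x))%:E))%E; last first.
  by rewrite !muleA -!EFinM; congr (_%:E * _)%E; ring.
rewrite integral_fourier integral_F muleA -EFinM integral_sqmod.
rewrite (ge0_muleDr _ (int_ge0 p) (int_ge0 q)) (ge0_muleDr _ (P_ge0 p) (P_ge0 q)).
rewrite (_ : 2 * pi * 2 = 4 * pi :> R); last by ring.
by apply: leeD; exact: plancherel_lower.
Qed.
End complex_plancherel.

(** * Integration against the invariant measure of the half-line *)

Section density.
Import HBNNSimple.
Context d (T : measurableType d) (R : realType).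
Variables mu nu : {measure set T -> \bar R}.
Variable g : T -> R.
Hypothesis mg : measurable_fun [set: T] g.
Hypothesis g_ge0 : forall x, 0 <= g x.
Hypothesis nuE : forall A, measurable A -> nu A = (\int[mu]_(x in A) (g x)%:E)%E.

Let mgE : measurable_fun [set: T] (EFin \o g). Proof. exact/measurable_EFinP. Qed.
Let gE_ge0 x : (0 <= (g x)%:E)%E. Proof. by rewrite lee_fin. Qed.

Lemma ge0_integral_density (f : T -> \bar R) :
  measurable_fun [set: T] f -> (forall x, (0 <= f x)%E) ->
  (\int[nu]_x f x = \int[mu]_x (f x * (g x)%:E))%E.
Proof.
move=> mf f0; pose h := nnsfun_approx measurableT mf.
have -> : (\int[nu]_x f x = lim (\int[nu]_x (EFin \o h n) x @[n --> \oo]))%E.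
  have fE x : f x = lim ((EFin \o h n) x @[n --> \oo]).
    by apply/esym/cvg_lim => //; exact: cvg_nnsfun_approx.
  under eq_integral => x _ do rewrite fE.
  apply: monotone_convergence => //.
  - by move=> n; apply/measurable_EFinP; exact/measurable_funP.
  - by move=> n x _ /=; rewrite lee_fin.
  - by move=> x _ a b ab; rewrite lee_fin; exact/lefP/nd_nnsfun_approx.
have -> : (\int[mu]_x (f x * (g x)%:E) =
    lim (\int[mu]_x ((EFin \o h n) x * (g x)%:E) @[n --> \oo]))%E.
  have fE x : (f x * (g x)%:E = lim ((EFin \o h n) x * (g x)%:E @[n --> \oo]))%E.
    apply/esym/cvg_lim => //; apply: cvgeZr => //; exact: cvg_nnsfun_approx.
  under eq_integral => x _ do rewrite fE.
  apply: monotone_convergence => //.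
  - by move=> n; apply: emeasurable_funM => //; apply/measurable_EFinP; exact/measurable_funP.
  - by move=> n x _ /=; rewrite mule_ge0// lee_fin.
  - by move=> x _ a b ab /=; rewrite lee_wpmul2r// lee_fin; exact/lefP/nd_nnsfun_approx.
suff suf n : (\int[nu]_x (EFin \o h n) x = \int[mu]_x ((EFin \o h n) x * (g x)%:E))%E.
  by under eq_fun do rewrite suf.
transitivity (\int[nu]_x
   (\sum_(y \in range (h n)) (y * \1_(h n @^-1` [set y]) x)%:E))%E.
  by apply: eq_integral => t tE; rewrite /= fimfunE -fsumEFin.
have indich m r : measurable_fun [set: T] (fun x => (r * \1_(h m @^-1` [set r]) x)%:E).
  by apply: (measurable_comp measurableT) => //; exact: measurable_funM.
rewrite ge0_integral_fsum//; last by move=> m y Ey; exact: nnfun_muleindic_ge0.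
transitivity (\int[mu]_x (\sum_(y \in range (h n))
    (y * \1_(h n @^-1` [set y]) x)%:E * (g x)%:E))%E; last first.
  apply: eq_integral => x xE.
  rewrite -ge0_mule_fsuml => [|y]; last exact: nnfun_muleindic_ge0.
  by rewrite fsumEFin // -(fimfunE _ x).
rewrite ge0_integral_fsum//; last 2 first.
  - by move=> y; exact: emeasurable_funM.
  - by move=> m y Ey; rewrite mule_ge0// nnfun_muleindic_ge0.
apply: eq_fsbigr => r rhn.
have r0 : 0 <= r by move: rhn; rewrite inE => -[t _ <-].
under eq_integral do rewrite EFinM.
rewrite integralZl_indic_nnsfun => //.
under [RHS]eq_integral do rewrite EFinM -muleA.
rewrite ge0_integralZl//.
- under [in RHS]eq_integral do rewrite muleC.
  rewrite [in RHS](eq_integral ((EFin \o g) \_ (h n @^-1` [set r]))); last first.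
    by move=> x xE; rewrite epatch_indic.
  by rewrite -integral_mkcond -nuE// integral_indic// setIT.
- by apply: emeasurable_funM => //; exact/measurable_EFinP.
- by move=> t Et; rewrite mule_ge0 ?lee_fin.
Qed.
End density.

Section haar_integral.
Variable R : realType.
Local Notation T := (measurableTypeR R).
Local Notation mu := (@lebesgue_measure R).
Local Notation haar := (@haar R).

(** The density of [haar], extended by [0] to the whole line. *)
Definition hdens (r : T) : R := if 0 < r then r^-1 else 0.

Lemma hdens_ge0 r : 0 <= hdens r.
Proof. by rewrite /hdens; case: ifP => // r0; rewrite invr_ge0 ltW. Qed.

Lemma measurable_hdens : measurable_fun [set: T] hdens.
Proof.
rewrite (_ : hdens = (fun x : T => expw 0 x * x `^ (-1))).
  apply: measurable_funM; first exact: measurable_expw.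
  exact: measurable_powR.
apply/funext => x; rewrite /hdens /expw; case: ifPn => x0; last by rewrite mul0r.
by rewrite mul0r oppr0 expR0 mul1r powR_inv1// ltW.
Qed.

Lemma haar_density A : measurable A -> haar A = (\int[mu]_(r in A) (hdens r)%:E)%E.
Proof.
move=> mA; rewrite /Defs.haar integral_mkcondr; apply: eq_integral => r _.
rewrite patchE /hdens mem_setE in_itv/= andbT; by case: ifP.
Qed.

Lemma ge0_integral_haar (f : T -> \bar R) :
  measurable_fun [set: T] f -> (forall x, (0 <= f x)%E) ->
  (\int[haar]_x f x = \int[mu]_x (f x * (hdens x)%:E))%E.
Proof.
apply: ge0_integral_density; first exact: measurable_hdens.
  exact: hdens_ge0.
exact: haar_density.
Qed.

(** The factor [a] of the substitution cancels the one of [(a * x)^-1]. *)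
Lemma ge0_haar_dilate (a : R) (f : T -> \bar R) : 0 < a ->
  measurable_fun [set: T] f -> (forall x, (0 <= f x)%E) ->
  (\int[haar]_x f (a * x)%R = \int[haar]_x f x)%E.
Proof.
move=> a0 mf f0.
have mfa : measurable_fun [set: T] (fun x : T => f (a * x)).
  by apply: (measurableT_comp mf); exact: measurable_funM.
rewrite (ge0_integral_haar mfa)// (ge0_integral_haar mf)//.
have mF : measurable_fun [set: T] (fun x => f x * (hdens x)%:E)%E.
  by apply: emeasurable_funM => //; apply/measurable_EFinP; exact: measurable_hdens.
have F0 x : (0 <= f x * (hdens x)%:E)%E by rewrite mule_ge0// lee_fin hdens_ge0.
have <- := @ge0_integral_affine R a 0 _ (lt0r_neq0 a0) mF F0.
rewrite gtr0_norm//.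
have mF' : measurable_fun [set: T] (fun x : T => f (a * x + 0)%R * (hdens (a * x + 0)%R)%:E)%E.
  apply: (measurableT_comp mF); apply: measurable_funD => //; exact: measurable_funM.
rewrite -ge0_integralZl//; last by rewrite lee_fin ltW.
apply: eq_integral => x _; rewrite addr0 muleCA -EFinM; congr (_ * _%:E)%E.
rewrite /hdens pmulr_rgt0//; case: ifP => x0; last by rewrite mulr0.
by rewrite invfM mulrA divff ?mul1r// gt_eqF.
Qed.

Lemma haar_pos_ae : {ae haar, forall r, 0 < r}.
Proof.
exists `]-oo, 0%R]%classic; split => //.
  rewrite haar_density// integral_mkcond (eq_integral (cst 0%E)) ?integral0//.
  move=> r _; rewrite patchE; case: ifPn => //.
  by rewrite mem_setE in_itv/= /hdens => r0; rewrite ltNge r0.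
by move=> r /= /negP; rewrite -leNgt in_itv.
Qed.

Lemma haar_dilate_ae (a : R) (P : T -> Prop) : 0 < a ->
  {ae haar, forall r, P r} -> {ae haar, forall r, P (a * r)}.
Proof.
move=> a0 [A [mA A0 PA]].
have mM : measurable_fun [set: T] (fun x : T => a * x) by exact: measurable_funM.
exists ((fun x : T => a * x) @^-1` A); split.
- by rewrite -[X in measurable X]setTI; exact: mM.
- have mA' : measurable ((fun x : T => a * x) @^-1` A : set T).
    by rewrite -[X in measurable X]setTI; exact: mM.
  have := integral_indic haar measurableT mA'; rewrite setIT => <-.
  apply: (eq_trans _ A0).
  have := integral_indic haar measurableT mA; rewrite setIT => <-.
  apply: (eq_trans _ (@ge0_haar_dilate a (fun x => (\1_A x)%:E) a0 _ _)).
  + by apply: eq_integral => x _; rewrite !indicE.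
  + by apply/measurable_EFinP; exact: measurable_indic.
  + by move=> x; rewrite lee_fin.
- by move=> r /= /PA.
Qed.

Lemma integrable_haar (f : T -> R) : haar.-integrable [set: T] (EFin \o f) ->
  mu.-integrable [set: T] (EFin \o (fun r => hdens r * f r)) /\
  \int[haar]_r f r = \int[mu]_r (hdens r * f r).
Proof.
move=> fi; have /measurable_EFinP mf := measurable_int _ fi.
have mhf : measurable_fun [set: T] (fun r => hdens r * f r).
  by apply: measurable_funM => //; exact: measurable_hdens.
have hfi : mu.-integrable [set: T] (EFin \o (fun r => hdens r * f r)).
  apply/integrableP; split; first exact/measurable_EFinP.
  have /integrableP[_] := fi.
  rewrite (ge0_integral_haar (f := fun x => `|(EFin \o f) x|%E))//; last first.
    by apply: measurableT_comp => //; exact/measurable_EFinP.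
  under eq_integral do rewrite /= muleC -EFinM -[X in X * _](ger0_norm (hdens_ge0 _)) -normrM.
  by [].
split => //; rewrite /Rintegral; congr fine.
rewrite integralE [RHS]integralE; congr (_ - _)%E.
  rewrite (ge0_integral_haar (f := (EFin \o f)^\+%E))//.
    apply: eq_integral => r _; rewrite /= !funeposE /= -!EFin_max -EFinM; congr EFin.
    by rewrite mulrC maxr_pMr ?hdens_ge0// mulr0.
  by apply: measurable_funepos; exact/measurable_EFinP.
rewrite (ge0_integral_haar (f := (EFin \o f)^\-%E))//.
  apply: eq_integral => r _; rewrite /= !funenegE /= -!EFin_max -EFinM; congr EFin.
  by rewrite mulrC maxr_pMr ?hdens_ge0// mulr0 mulrN.
by apply: measurable_funeneg; exact/measurable_EFinP.
Qed.

Lemma cintegrable_haar (f : T -> R[i]) : cintegrable haar f ->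
  cintegrable mu (fun r => (hdens r)%:C%C * f r) /\
  cintegral haar f = cintegral mu (fun r => (hdens r)%:C%C * f r).
Proof.
move=> [/integrable_haar[r1 r2] /integrable_haar[i1 i2]]; split.
  split; [move: r1|move: i1]; apply: eq_integrable => // r _ /=; congr EFin.
    by rewrite ReCM.
  by rewrite ImM /= mul0r addr0.
rewrite /cintegral r2 i2; congr Complex; apply: (@eq_Rintegral _ _ _ mu _) => r _.
  by rewrite ReCM.
by rewrite ImM /= mul0r addr0.
Qed.
End haar_integral.

(** * The representation of the affine group *)

Section affine_representation.
Variable R : realType.
Local Notation T := (measurableTypeR R).
Local Notation mu := (@lebesgue_measure R).
Local Notation haar := (@haar R).
Local Notation L2pos := (L2pos R).
Implicit Types (x a : R) (u v : L2pos).

Lemma sqmod_cexpi (t : R) : sqmod (cexpi t) = 1.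
Proof. by rewrite /sqmod /= cos2Dsin2. Qed.

Lemma cexpiN (t : R) : cexpi (- t) = conjc (cexpi t).
Proof. by rewrite /cexpi /= cosN sinN. Qed.

Lemma cmeasurable_cexpi (c : R) : cmeasurable [set: T] (fun r => cexpi (c * r)).
Proof.
by split; [apply: (measurableT_comp (@measurable_cos R))|
           apply: (measurableT_comp (@measurable_sin R))]; exact: measurable_funM.
Qed.

Lemma cmeasurable_dilate a u : cmeasurable [set: T] (fun r => u (a * r)).
Proof.
have [m1 m2] := l2_cmeasurable u.
by split; [apply: (measurableT_comp m1)|apply: (measurableT_comp m2)];
  exact: measurable_funM.
Qed.

Lemma integral_dilate a u : 0 < a ->
  (\int[haar]_r (sqmod (u (a * r)))%:E = (nsq u)%:E)%E.
Proof.
move=> a0; rewrite (nsqE (l2_cmeasurable u)); last exact: aeW.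
apply: (@ge0_haar_dilate R a (fun r => (sqmod (u r))%:E)) => //.
  by apply/measurable_EFinP; apply: measurable_sqmod; exact: l2_cmeasurable.
by move=> r; rewrite lee_fin sqmod_ge0.
Qed.

Lemma square_integrable_dilate a u : 0 < a ->
  square_integrable haar (fun r => u (a * r)).
Proof.
move=> a0; apply/square_integrableE; split; first exact: cmeasurable_dilate.
by rewrite integral_dilate// ltry.
Qed.

Lemma affU_square_integrable x a u : 0 < a ->
  square_integrable haar (fun r => cexpi (2 * pi * x * r) * u (a * r)).
Proof.
move=> a0; apply: (@square_integrable_le _ T R haar _ (fun r => sqmod (u (a * r)))).
- by apply: cmeasurableM; [exact: cmeasurable_cexpi|exact: cmeasurable_dilate].
- by move=> r; rewrite sqmodM sqmod_cexpi mul1r.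
- by apply: measurable_sqmod; exact: cmeasurable_dilate.
- by rewrite integral_dilate// ltry.
Qed.

Lemma affU_ae x a u : 0 < a ->
  {ae haar, forall r, affU x a u r = cexpi (2 * pi * x * r) * u (a * r)}.
Proof. by move=> a0; apply: toL2_ae; exact: affU_square_integrable. Qed.

Lemma affU_linear x a : 0 < a -> linear (affU x a).
Proof.
move=> a0 c u v; apply: l2_ae_eq.
have H1 := aeI (aeI (affU_ae x u a0) (affU_ae x v a0)) (affU_ae x (c *: u + v) a0).
have H2 := aeI (haar_dilate_ae a0 (l2D_ae (c *: u) v)) (haar_dilate_ae a0 (l2Z_ae c u)).
have H3 := aeI (l2D_ae (c *: affU x a u) (affU x a v)) (l2Z_ae c (affU x a u)).
apply: (aeS (aeI H1 (aeI H2 H3))) => r [[[h1 h2] h3] [[h4 h5] [h6 h7]]].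
by rewrite h6 h7 h3 h4 h5 h1 h2 mulrDr mulrCA.
Qed.

Lemma nsq_affU x a u : 0 < a -> nsq (affU x a u) = nsq u.
Proof.
move=> a0; have [m _] := affU_square_integrable x u a0.
apply: EFin_inj; rewrite (nsqE m (affU_ae x u a0)) -(integral_dilate u a0).
by apply: eq_integral => r _; rewrite sqmodM sqmod_cexpi mul1r.
Qed.

Lemma Rintegral_haar_dilate a (f : T -> R) : 0 < a -> measurable_fun [set: T] f ->
  \int[haar]_r f (a * r) = \int[haar]_r f r.
Proof.
move=> a0 mf; have mfE : measurable_fun [set: T] (EFin \o f) by exact/measurable_EFinP.
rewrite /Rintegral; congr fine; rewrite integralE [RHS]integralE; congr (_ - _)%E.
  apply: (eq_trans _ (@ge0_haar_dilate R a (EFin \o f)^\+%E a0 _ _)) => //.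
    by apply: eq_integral => r _; rewrite !funeposE.
  exact: measurable_funepos.
apply: (eq_trans _ (@ge0_haar_dilate R a (EFin \o f)^\-%E a0 _ _)) => //.
  by apply: eq_integral => r _; rewrite !funenegE.
exact: measurable_funeneg.
Qed.

Lemma cintegral_haar_dilate a (f : T -> R[i]) : 0 < a -> cmeasurable [set: T] f ->
  cintegral haar (fun r => f (a * r)) = cintegral haar f.
Proof.
move=> a0 [m1 m2]; rewrite /cintegral.
by rewrite (Rintegral_haar_dilate a0 m1) (Rintegral_haar_dilate a0 m2).
Qed.

(** The substitution [r |-> a * r].  In the affine group, [(- (x / a), a^-1)] is the
    inverse of [(x, a)]. *)
Lemma affU_dot x a u v : 0 < a ->
  l2dot (affU x a u) v = l2dot u (affU (- (x / a)) a^-1 v).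
Proof.
move=> a0; have ai0 : 0 < a^-1 by rewrite invr_gt0.
have s1 := affU_square_integrable x u a0.
have s2 := affU_square_integrable (- (x / a)) v ai0.
rewrite (l2dotE s1 (l2P v) (affU_ae x u a0)); last exact: aeW.
rewrite (l2dotE (l2P u) s2 _ (affU_ae _ v ai0)); last exact: aeW.
rewrite -[RHS](@cintegral_haar_dilate a)//; last first.
  apply: cmeasurableM; first exact: l2_cmeasurable.
  by apply: cmeasurable_conj; case: s2.
congr (cintegral haar); apply/funext => r.
rewrite mulKf ?gt_eqF// conjcM -cexpiN mulrCA mulrA; congr (cexpi _ * _ * _).
by field; rewrite gt_eqF.
Qed.

Lemma affU_adjoint x a : 0 < a -> adjoint (affU x a) = affU (- (x / a)) a^-1.
Proof. by move=> a0; apply: adjointE => u v; exact: affU_dot. Qed.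

(** The function of which [x |-> <U(x, a) u, v>] is the Fourier transform; the
    factor [hdens] passes from [haar] to the Lebesgue measure. *)
Definition shifted_product u v a : T -> R[i] :=
  fun r => (hdens r)%:C%C * (u (a * r) * conjc (v r)).

Let shifted_product_haar u v a : 0 < a ->
  cintegrable haar (fun r => u (a * r) * conjc (v r)).
Proof.
by move=> a0; apply: cintegrable_mul_conj; [exact: square_integrable_dilate|exact: l2P].
Qed.

Lemma cintegrable_shifted_product u v a : 0 < a -> cintegrable mu (shifted_product u v a).
Proof. by move=> a0; have [] := cintegrable_haar (shifted_product_haar u v a0). Qed.

Lemma affU_fourier x a u v : 0 < a ->
  l2dot (affU x a u) v = fourier (shifted_product u v a) x.
Proof.
move=> a0; have s1 := affU_square_integrable x u a0.
rewrite (l2dotE s1 (l2P v) (affU_ae x u a0)); last exact: aeW.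
have [_ ->] := cintegrable_haar (cintegrable_mul_conj s1 (l2P v)).
by rewrite /fourier; congr (cintegral mu); apply/funext => r; rewrite -(mulrA (cexpi _)) mulrCA.
Qed.
End affine_representation.

(** * Square integrals of matrix coefficients *)

Section matrix_coefficients.
Variable R : realType.
Local Notation T := (measurableTypeR R).
Local Notation mu := (@lebesgue_measure R).
Local Notation haar := (@haar R).
Local Notation L2pos := (L2pos R).

(** The squared norm of [D^-1 v], infinite outside of the domain of [D^-1]
    (see [energyE] and [energy_dom]). *)
Definition energy (v : L2pos) : \bar R := (\int[haar]_r (hdens r * sqmod (v r))%:E)%E.

Lemma energy_ge0 w : (0 <= energy w)%E.
Proof. by apply: integral_ge0 => r _; rewrite lee_fin mulr_ge0 ?hdens_ge0 ?sqmod_ge0. Qed.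

Variables u v : L2pos.

Let su : measurable_fun [set: T] (fun r => sqmod (u r)).
Proof. by apply: measurable_sqmod; exact: l2_cmeasurable. Qed.

Let sv : measurable_fun [set: T] (fun r => sqmod (v r)).
Proof. by apply: measurable_sqmod; exact: l2_cmeasurable. Qed.

(** The factor [expw 0 z.2] extends the squared coefficient by [0] outside of the
    affine group, where [affU] is meaningless. *)
Let K (z : T * T) : R := expw 0 z.2 * sqmod (fourier (shifted_product u v z.2) (- z.1)).

Let K_ge0 z : 0 <= K z.
Proof. by rewrite mulr_ge0 ?expw_ge0 ?sqmod_ge0. Qed.

Let mexpw2 : measurable_fun [set: T * T] (fun z : T * T => expw 0 z.2).
Proof. by apply: (measurableT_comp (f := expw 0)) => //; exact: measurable_expw. Qed.

Let mK : measurable_fun [set: T * T] K.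
Proof.
pose F (y : (T * T) * T) : R[i] :=
  cexpi (2 * pi * (- y.1.1) * y.2) * shifted_product u v y.1.2 y.2.
have mF : cmeasurable [set: (T * T) * T] F.
  have mlin (f : (T * T) * T -> R) (g : T -> R) : measurable_fun [set: T] g ->
      measurable_fun [set: (T * T) * T] f -> measurable_fun [set: (T * T) * T] (g \o f).
    by move=> mg; exact: measurableT_comp.
  have [u1 u2] := l2_cmeasurable u; have [v1 v2] := l2_cmeasurable v.
  have marg : measurable_fun [set: (T * T) * T]
      (fun y : (T * T) * T => 2 * pi * (- y.1.1) * y.2).
    apply: measurable_funM => //; apply: measurable_funM => //.
    by apply: measurableT_comp => //; exact: measurableT_comp.
  have mar : measurable_fun [set: (T * T) * T] (fun y : (T * T) * T => y.1.2 * y.2).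
    by apply: measurable_funM => //; exact: measurableT_comp.
  apply: cmeasurableM.
    by split; [apply: (mlin _ (@cos R)) => //; exact: measurable_cos|
               apply: (mlin _ (@sin R)) => //; exact: measurable_sin].
  apply: cmeasurableM.
    by apply: cmeasurableC; apply: (mlin _ (@hdens R)) => //; exact: measurable_hdens.
  apply: cmeasurableM.
    by split; [exact: (mlin _ _ u1 mar)|exact: (mlin _ _ u2 mar)].
  apply: cmeasurable_conj.
  by split; [exact: (mlin _ _ v1 measurable_snd)|exact: (mlin _ _ v2 measurable_snd)].
have [m1 m2] := mF.
apply: measurable_funM => //; apply: measurable_funD; apply: measurable_funX.
  exact: (@measurable_Rintegral_param _ _ (T * T)%type T _ mu _ m1).
exact: (@measurable_Rintegral_param _ _ (T * T)%type T _ mu _ m2).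
Qed.

Let mKE : measurable_fun [set: T * T] (EFin \o K).
Proof. exact/measurable_EFinP. Qed.

Let Aff : set (T * T) := [set: R] `*` `]0, +oo[.

Let mAff : measurable Aff.
Proof. by apply: measurableX => //; exact: measurable_itv. Qed.

Let coef (z : T * T) : R := sqmod (l2dot (affU (- z.1) z.2 u) v).

Let coefE z : Aff z -> coef z = K z.
Proof.
move=> [_]; rewrite /= in_itv/= andbT => z0.
by rewrite /coef /K affU_fourier// /expw z0 mul0r oppr0 expR0 mul1r.
Qed.

Lemma measurable_coef : measurable_fun Aff coef.
Proof.
apply: (@eq_measurable_fun _ _ _ _ _ K); last exact: measurable_funTS.
by move=> z; rewrite inE => /coefE.
Qed.

Let slice (a : T) : \bar R := (\int[mu]_x (K (x, a))%:E)%E.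

Let integral_coef : (\int[mu \x haar]_(z in Aff) (coef z)%:E = \int[haar]_a slice a)%E.
Proof.
rewrite integral_mkcond.
rewrite (eq_integral (EFin \o K)); last first.
  move=> z _; rewrite patchE; case: ifPn => [/[1!inE] zA|zA]; first by rewrite coefE.
  have z0 : z.2 <= 0.
    rewrite leNgt; apply/negP => z0; move: zA; rewrite notin_setE; apply.
    by split => //; rewrite /= in_itv/= andbT.
  by rewrite /= /K /expw ltNge z0 mul0r.
by apply: (@fubini_tonelli2 _ _ T T R mu haar) => // z; rewrite lee_fin.
Qed.

Let J (z : T * T) : R :=
  (hdens z.2 * sqmod (v z.2)) * (expw 0 z.1 * sqmod (u (z.1 * z.2))).

Let J_ge0 z : 0 <= J z.
Proof. by rewrite !mulr_ge0 ?hdens_ge0 ?expw_ge0 ?sqmod_ge0. Qed.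

Let mJ : measurable_fun [set: T * T] (EFin \o J).
Proof.
apply/measurable_EFinP; apply: measurable_funM; apply: measurable_funM.
- by apply: (measurableT_comp (f := @hdens R)) => //; exact: measurable_hdens.
- exact: (measurableT_comp sv).
- by apply: (measurableT_comp (f := expw 0)) => //; exact: measurable_expw.
- by apply: (measurableT_comp su); exact: measurable_funM.
Qed.

Let weight (a : T) : \bar R := (\int[haar]_r (J (a, r))%:E)%E.

Let slice_weight a : (slice a <= weight a <= 4%:E * slice a)%E.
Proof.
have [a0|a0] := ltP 0 a; last first.
  have e0 : expw 0 a = 0 by rewrite /expw ltNge a0.
  have -> : slice a = 0%E.
    by rewrite /slice (eq_integral (cst 0%E)) ?integral0// => x _; rewrite /K /= e0 mul0r.
  have -> : weight a = 0%E.
    by rewrite /weight (eq_integral (cst 0%E)) ?integral0// => r _; rewrite /J /= e0 mul0r mulr0.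
  by rewrite mule0 lexx.
have e1 : expw 0 a = 1 by rewrite /expw a0 mul0r oppr0 expR0.
pose h := shifted_product u v a.
have ih : cintegrable mu h by exact: cintegrable_shifted_product.
have -> : slice a = (\int[mu]_x (sqmod (fourier h x))%:E)%E.
  have m1 : measurable_fun [set: T] (fun x => (sqmod (fourier h x))%:E).
    by apply/measurable_EFinP; exact: measurable_sqmod_fourier.
  rewrite -(@ge0_integral_affine R (-1) 0 _ _ m1)//; last first.
    by move=> x; rewrite lee_fin sqmod_ge0.
  rewrite normrN1 mul1e; apply: eq_integral => x _.
  by rewrite /K /= e1 mul1r addr0 mulN1r.
have -> : weight a = (\int[mu]_r (sqmod (h r))%:E)%E.
  rewrite /weight (@ge0_integral_haar R (fun r => (J (a, r))%:E)).
  - apply: eq_integral => r _; rewrite /J /h /shifted_product /= e1 -EFinM; congr EFin.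
    by rewrite !sqmodM sqmodC sqmod_conj; ring.
  - exact: (measurable_fun_section a mJ).
  - by move=> r; rewrite lee_fin.
by rewrite fourier_upper ?fourier_lower.
Qed.

(** Tonelli: at fixed [r > 0], the substitution [a |-> r * a] preserves [haar], so
    that the integral in [a] is [nsq u]. *)
Let integral_weight : (\int[haar]_a weight a = (nsq u)%:E * energy v)%E.
Proof.
apply: (eq_trans (@fubini_tonelli _ _ T T R haar haar (EFin \o J) mJ _)).
  by move=> z; rewrite lee_fin.
rewrite /energy -ge0_integralZl//; last 3 first.
- by apply/measurable_EFinP; apply: measurable_funM => //; exact: measurable_hdens.
- by move=> r _; rewrite lee_fin mulr_ge0 ?hdens_ge0 ?sqmod_ge0.
- by rewrite lee_fin nsq_ge0.
apply: eq_integral => r _.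
have [r0|r0] := ltP 0 r; last first.
  have h0 : hdens r = 0 by rewrite /hdens ltNge r0.
  rewrite (eq_integral (cst 0%E)) ?integral0 ?h0 ?mul0r ?mule0//.
  by move=> a _; rewrite /J /= h0 !mul0r.
rewrite -(integral_dilate u r0) muleC.
have mur : measurable_fun [set: T] (fun a => (sqmod (u (r * a)))%:E).
  by apply/measurable_EFinP; apply: measurable_sqmod; exact: cmeasurable_dilate.
rewrite -ge0_integralZl//; last 2 first.
- by move=> a _; rewrite lee_fin sqmod_ge0.
- by rewrite lee_fin mulr_ge0 ?hdens_ge0 ?sqmod_ge0.
apply: ae_eq_integral => //.
- apply: (measurable_funTS (D := setT)).
  by apply: (measurableT_comp mJ); exact: measurable_fun_pair.
- by apply: emeasurable_funM.
- apply: (aeS (@haar_pos_ae R)) => a a0 _.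
  by rewrite /J /= /expw a0 mul0r oppr0 expR0 mul1r mulrC [a * r]mulrC -EFinM mulrC.
Qed.

Let mslice : measurable_fun [set: T] slice.
Proof.
by apply: (@measurable_fun_fubini_tonelli_G _ _ T T R mu (EFin \o K)).
Qed.

Let mweight : measurable_fun [set: T] weight.
Proof.
by apply: (@measurable_fun_fubini_tonelli_F _ _ T T R haar (EFin \o J)).
Qed.

Let slice_ge0 a : (0 <= slice a)%E.
Proof. by apply: integral_ge0 => x _; rewrite lee_fin. Qed.

Let weight_ge0 a : (0 <= weight a)%E.
Proof. by apply: integral_ge0 => x _; rewrite lee_fin. Qed.

(** Together with [le_integral_coef], this is the orthogonality relation of the
    representation up to a constant, with both sides possibly infinite. *)
Theorem integral_coef_le :
  (\int[mu \x haar]_(z in Aff) (sqmod (l2dot (affU (- z.1) z.2 u) v))%:E <=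
   (nsq u)%:E * energy v)%E.
Proof.
rewrite integral_coef -integral_weight; apply: ge0_le_integral => // a _.
by case/andP: (slice_weight a).
Qed.

Theorem le_integral_coef : ((nsq u)%:E * energy v <=
  4%:E * \int[mu \x haar]_(z in Aff) (sqmod (l2dot (affU (- z.1) z.2 u) v))%:E)%E.
Proof.
have four0 : (0 <= (4%:R : R)%:E)%E by rewrite lee_fin.
have Z := @ge0_integralZl _ T R haar _ measurableT _ mslice _ (fun a _ => slice_ge0 a) four0.
rewrite integral_coef -integral_weight -Z; apply: ge0_le_integral => //.
- exact: emeasurable_funM.
- by move=> a _; case/andP: (slice_weight a).
Qed.
End matrix_coefficients.

(** * Integrability of the convolution *)

Section convolution_integrability.
Variable R : realType.
Local Notation T := (measurableTypeR R).
Local Notation mu := (@lebesgue_measure R).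
Local Notation haar := (@haar R).
Local Notation L2pos := (L2pos R).

Variables (S : L2pos -> L2pos) (v e : nat -> L2pos).
Hypotheses (bS : bounded_op S) (S0 : positive_op S) (gS : gram S v).
Hypothesis onb_e : orthonormal_basis e.

Let lS : linear S. Proof. by case: bS. Qed.

Let term (k j : nat) (g : T * T) : \bar R :=
  (sqmod (l2dot (affU (- g.1) g.2 (v k)) (v j)))%:E.

Let term_ge0 k j g : (0 <= term k j g)%E.
Proof. by rewrite lee_fin sqmod_ge0. Qed.

Let total (g : T * T) : \bar R :=
  (\sum_(0 <= k <oo) \sum_(0 <= j <oo) term k j g)%E.

Let inner_ge0 k g : (0 <= \sum_(0 <= j <oo) term k j g)%E.
Proof. exact: nneseries_ge0. Qed.

(** The trace of [S \o W], for [W] the conjugate of [S] by [U], is the sum of the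
    [<W v_k, v_k> = <S (U v_k), U v_k>], and the second copy of [S] is expanded
    in turn. *)
Lemma aff_conv_gram (g : R * R) : 0 < g.2 ->
  exists2 t : R, aff_conv S S g = t%:C%C & t%:E = total g.
Proof.
move=> g0; set U := affU (- g.1) g.2.
pose W := adjoint U \o S \o U.
have lU : linear U by exact: affU_linear.
have adj p q : l2dot (U p) q = l2dot p (adjoint U q).
  by rewrite /U affU_adjoint// affU_dot.
have WE p : l2dot (W p) p = l2dot (S (U p)) (U p).
  by rewrite /W /= l2dotC -adj -l2dotC.
have nsq_adj p : nsq (adjoint U p) = nsq p.
  by rewrite /U affU_adjoint// nsq_affU// invr_gt0.
have bW : bounded_op W.
  have [M M0 SM] := bounded_op_nsq bS.
  apply: (@bounded_op_of_nsq _ _ _ _ _ M).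
    move=> c p q; rewrite /W /= lU lS {1}/U affU_adjoint//.
    by apply: affU_linear; rewrite invr_gt0.
  by move=> p; rewrite /W /= nsq_adj; apply: le_trans (SM _) _; rewrite nsq_affU.
have W0 : positive_op W by move=> p; rewrite WE; exact: S0.
have [t tE trE] := trace_gram_mul gS bW W0 onb_e.
exists t; first exact: trE.
rewrite tE; apply: eq_eseriesr => k _.
by rewrite WE -(gram_diag (U (v k)) gS).
Qed.

Let Aff : set (T * T) := [set: R] `*` `]0, +oo[.

Let mAff : measurable Aff.
Proof. by apply: measurableX => //; exact: measurable_itv. Qed.

Let AffE g : Aff g -> 0 < g.2.
Proof. by move=> [_]; rewrite /= in_itv/= andbT. Qed.

Let mterm k j : measurable_fun Aff (term k j).
Proof. by apply/measurable_EFinP; exact: measurable_coef. Qed.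

Let minner k : measurable_fun Aff (fun g => \sum_(0 <= j <oo) term k j g)%E.
Proof. exact: ge0_emeasurable_sum. Qed.

Let I k j : \bar R := (\int[mu \x haar]_(g in Aff) term k j g)%E.

Let I_ge0 k j : (0 <= I k j)%E.
Proof. by apply: integral_ge0 => g _. Qed.

Let integral_total : (\int[mu \x haar]_(g in Aff) total g =
  \sum_(0 <= k <oo) \sum_(0 <= j <oo) I k j)%E.
Proof.
rewrite /total integral_nneseries//.
by apply: eq_eseriesr => k _; rewrite integral_nneseries.
Qed.

Let L1r_total : L1r_Aff (aff_conv S S) <-> (\int[mu \x haar]_(g in Aff) total g < +oo)%E.
Proof.
have mtotal : measurable_fun Aff total by exact: ge0_emeasurable_sum.
have total_ge0 g : (0 <= total g)%E by exact: nneseries_ge0.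
have ReE g : Aff g -> ((complex.Re (aff_conv S S g))%:E = total g)%E.
  by move=> /AffE/aff_conv_gram[t -> <-].
have ImE g : Aff g -> ((complex.Im (aff_conv S S g))%:E = 0)%E.
  by move=> /AffE/aff_conv_gram[t -> _].
split.
  move=> [/integrableP[_] + _]; apply: le_lt_trans; apply: ge0_le_integral => //.
  - apply: measurableT_comp => //; apply: (@eq_measurable_fun _ _ _ _ _ total) => //.
    by move=> g; rewrite inE => /ReE.
  - by move=> g /ReE ->; rewrite gee0_abs.
move=> h; split.
  apply: (@eq_integrable _ _ _ _ _ mAff total).
    by move=> g; rewrite inE => /ReE.
  apply/integrableP; split => //.
  move: h; congr (_ < +oo)%E; by apply: eq_integral => g _; rewrite gee0_abs.
apply: (@eq_integrable _ _ _ _ _ mAff (cst 0%E)).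
  by move=> g; rewrite inE => /ImE.
exact: integrable0.
Qed.

Let energy_v_ge0 j : (0 <= energy (v j))%E. Proof. exact: energy_ge0. Qed.

(** The double sum of the integrals of the coefficients is comparable to the
    product of [\sum_k nsq (v k)] and [\sum_j energy (v j)]; the first sum is
    finite, and nonzero as [S] is. *)
Theorem L1r_aff_conv : S <> (fun=> 0) ->
  L1r_Aff (aff_conv S S) <-> (\sum_(0 <= j <oo) energy (v j) < +oo)%E.
Proof.
move=> S_neq0; rewrite L1r_total integral_total; split=> h; last first.
  apply: (@le_lt_trans _ _ (\sum_(0 <= k <oo) ((nsq (v k))%:E *
    \sum_(0 <= j <oo) energy (v j))))%E.
    apply: lee_nneseries => [k _ _|k _]; first exact: nneseries_ge0.
    rewrite -nneseriesZl//; apply: lee_nneseries => // j _; exact: integral_coef_le.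
  have fE : (\sum_(0 <= j <oo) energy (v j))%E \is a fin_num.
    by rewrite ge0_fin_numE//; exact: nneseries_ge0.
  rewrite -(fineK fE); under eq_eseriesr do rewrite muleC.
  rewrite nneseriesZl; last by move=> k _; rewrite lee_fin nsq_ge0.
  rewrite lte_mul_pinfty//; first by rewrite lee_fin fine_ge0// nneseries_ge0.
  by case: gS.
have [k vk] : exists k, 0 < nsq (v k).
  apply: contrapT => /forallNP nv; apply: S_neq0; apply/funext => u.
  apply: l2dot_extl => w; rewrite l2dot0l.
  have [/(_ u w) Suw _] := gS; apply: (ccvg_unique Suw).
  have v0 k : v k = 0.
    apply: nsq_eq0; apply/eqP; rewrite eq_le nsq_ge0 andbT leNgt.
    by apply/negP; exact: nv.
  apply: (@ccvg_le _ _ _ (fun=> 0)); last exact: cvg_cst.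
  move=> n; rewrite big1 ?subrr ?sqmod0// => i _.
  by rewrite v0 l2dot0l mulr0.
have : ((nsq (v k))%:E * \sum_(0 <= j <oo) energy (v j) < +oo)%E.
  rewrite -nneseriesZl//.
  apply: (@le_lt_trans _ _ (4%:E * \sum_(0 <= k <oo) \sum_(0 <= j <oo) I k j)%E); last first.
    by rewrite lte_mul_pinfty// lee_fin.
  apply: (@le_trans _ _ (4%:E * \sum_(0 <= j <oo) I k j)%E).
    rewrite -nneseriesZl//; apply: lee_nneseries => [j _ _|j _].
      by rewrite mule_ge0// lee_fin nsq_ge0.
    exact: le_integral_coef.
  rewrite lee_pmul2l// ?lte_fin//.
  have := @nneseries_lim_ge R (fun k => \sum_(0 <= j <oo) I k j)%E xpredT 0 k.+1.
  move=> H; apply: le_trans (H _); last by move=> *; exact: nneseries_ge0.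
  by rewrite big_nat_recr//= leeDr// sume_ge0// => i _; exact: nneseries_ge0.
case E : (\sum_(0 <= j <oo) energy (v j))%E => [x||]//.
  by move=> _; exact: ltry.
by rewrite gt0_muley// lte_fin.
Qed.
End convolution_integrability.

(** * Truncated powers *)

Section truncated_powers.
Variable R : realType.
Local Notation T := (measurableTypeR R).
Local Notation haar := (@haar R).
Local Notation L2pos := (L2pos R).
Implicit Types (s t : R) (N : nat) (u w y : L2pos).

(** A bounded substitute for [r `^ s], equal to it on larger and larger intervals
    that exhaust the half-line. *)
Definition cutpow s N : T -> R :=
  fun r => \1_(`[N.+1%:R^-1, N.+1%:R]%classic : set T) r * r `^ s.

Lemma measurable_cutpow s N : measurable_fun [set: T] (cutpow s N).
Proof.
apply: measurable_funM; last exact: measurable_powR.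
by apply: measurable_indic; exact: measurable_itv.
Qed.

Lemma cutpow_bound s N : exists2 C, 0 <= C & forall r, cutpow s N r ^+ 2 <= C.
Proof.
have N0 : 0 < N.+1%:R :> R by [].
exists (expR (`|s| * ln N.+1%:R) ^+ 2); first by rewrite sqr_ge0.
move=> r; rewrite /cutpow indicE; case: (boolP (_ \in _)); last first.
  by rewrite mul0r expr0n/= sqr_ge0.
rewrite mem_setE in_itv/= => /andP[Nr rN].
have r0 : 0 < r by apply: lt_le_trans Nr; rewrite invr_gt0.
rewrite mul1r ler_sqr ?nnegrE ?powR_ge0 ?expR_ge0// /powR gt_eqF// ler_expR.
apply: le_trans (ler_norm _) _; rewrite normrM ler_wpM2l// ler_norml.
rewrite -lnV ?posrE// !ler_ln ?posrE ?invr_gt0//; exact/andP.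
Qed.

Lemma cutpowM s t N r : cutpow s N r * r `^ t = cutpow (s + t) N r.
Proof.
rewrite /cutpow indicE; case: (boolP (_ \in _)); last by rewrite !mul0r.
rewrite mem_setE in_itv/= => /andP[Nr _].
have r0 : r != 0 by rewrite gt_eqF//; apply: lt_le_trans Nr; rewrite invr_gt0.
by rewrite !mul1r -powRD// r0 implybT.
Qed.

Lemma cutpow_eventually (r : T) : 0 < r -> \forall N \near \oo, cutpow 0 N r = 1.
Proof.
move=> r0.
have H1 : \forall N \near \oo, r <= N.+1%:R.
  have /cvgryPge/(_ r) := @cvgr_idn R; apply: filterS => n h.
  by apply: le_trans h _; rewrite ler_nat.
have H2 : \forall N \near \oo, r^-1 <= N.+1%:R.
  have /cvgryPge/(_ r^-1) := @cvgr_idn R; apply: filterS => n h.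
  by apply: le_trans h _; rewrite ler_nat.
apply: filterS2 H1 H2 => N h1 h2.
by rewrite /cutpow indicE mem_setE in_itv/= h1 andbT powRr0 mulr1 invf_ple ?posrE// h2.
Qed.

Lemma cutpow0_itv N r : 0 <= cutpow 0 N r <= 1.
Proof. by rewrite /cutpow powRr0 mulr1 indicE; case: (_ \in _); rewrite ?lexx ?ler01. Qed.

Let cut_square_integrable s N u :
  square_integrable haar (fun r => (cutpow s N r)%:C%C * u r).
Proof.
have [C C0 hC] := cutpow_bound s N.
have mu2 := measurable_sqmod (l2_cmeasurable u).
apply: (@square_integrable_le _ T R haar _ (fun r : T => C * sqmod (u r))).
- by apply: cmeasurableM; [apply: cmeasurableC; exact: measurable_cutpow|exact: l2_cmeasurable].
- by move=> r; rewrite sqmodM sqmodC ler_wpM2r// sqmod_ge0.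
- exact: measurable_funM.
- under eq_integral do rewrite EFinM.
  rewrite ge0_integralZl//.
  + by rewrite -(@nsqE _ _ _ haar u u (l2_cmeasurable u)) ?ltry//; exact: aeW.
  + exact/measurable_EFinP.
  + by move=> r _; rewrite lee_fin sqmod_ge0.
Qed.

Definition cut s N u : L2pos := toL2 haar (fun r => (cutpow s N r)%:C%C * u r).

Lemma cut_ae s N u : {ae haar, forall r, cut s N u r = (cutpow s N r)%:C%C * u r}.
Proof. exact: toL2_ae (cut_square_integrable s N u). Qed.

Lemma cut_dot s N u w : l2dot (cut s N u) w = l2dot u (cut s N w).
Proof.
rewrite (l2dotE (cut_square_integrable s N u) (l2P w) (cut_ae s N u)); last exact: aeW.
rewrite (l2dotE (l2P u) (cut_square_integrable s N w) _ (cut_ae s N w)); last exact: aeW.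
congr (cintegral haar); apply/funext => r; rewrite conjcM mulrCA mulrA.
by rewrite conjc_real.
Qed.

Lemma nsq_cut s N u : (nsq (cut s N u))%:E =
  (\int[haar]_r (cutpow s N r ^+ 2 * sqmod (u r))%:E)%E.
Proof.
have [m _] := cut_square_integrable s N u.
rewrite (nsqE m (cut_ae s N u)).
by apply: eq_integral => r _; rewrite sqmodM sqmodC.
Qed.

Lemma nsq_cut0_le N u : nsq (cut 0 N u) <= nsq u.
Proof.
have mu2 := measurable_sqmod (l2_cmeasurable u).
rewrite -lee_fin nsq_cut (@nsqE _ _ _ haar u u (l2_cmeasurable u)); last exact: aeW.
apply: ge0_le_integral => //.
- by move=> r _; rewrite lee_fin mulr_ge0 ?sqr_ge0 ?sqmod_ge0.
- apply/measurable_EFinP; apply: measurable_funM => //; apply: measurable_funX.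
  exact: measurable_cutpow.
- exact/measurable_EFinP.
- move=> r _; rewrite lee_fin ler_piMl ?sqmod_ge0//.
  by case/andP: (cutpow0_itv N r) => c0 c1; rewrite expr_le1.
Qed.

Lemma cmeasurable_mulpow s u : cmeasurable [set: T] (mulpow_fun s u).
Proof.
apply: cmeasurableM; last exact: l2_cmeasurable.
by apply: cmeasurableC; exact: measurable_powR.
Qed.

Lemma mulpow_ae s u : dom_mulpow s u ->
  {ae haar, forall r, mulpow s u r = mulpow_fun s u r}.
Proof. by move=> h; exact: toL2_ae. Qed.

Lemma mulpow_ae_eq s u y : {ae haar, forall r, y r = mulpow_fun s u r} ->
  dom_mulpow s u /\ mulpow s u = y.
Proof.
move=> h; have hd : dom_mulpow s u.
  exact: (ae_square_integrable (cmeasurable_mulpow s u) h).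
split => //; apply: l2_ae_eq; apply: (aeS (aeI h (mulpow_ae hd))) => r.
by case=> -> ->.
Qed.

Lemma cut_mulpow s t N u : dom_mulpow t u ->
  cut s N (mulpow t u) = cut (s + t) N u.
Proof.
move=> h; apply: l2_ae_eq.
apply: (aeS (aeI (mulpow_ae h) (aeI (cut_ae s N (mulpow t u)) (cut_ae (s + t) N u)))).
move=> r [h1 [h2 h3]]; apply: (eq_trans h2); apply: (eq_trans _ (esym h3)).
by rewrite h1 /mulpow_fun mulrA -(cutpowM s t) realCM.
Qed.

Lemma mulpow_cut s N u : dom_mulpow s (cut 0 N u) /\ mulpow s (cut 0 N u) = cut s N u.
Proof.
apply: mulpow_ae_eq; apply: (aeS (aeI (cut_ae s N u) (cut_ae 0 N u))) => r [h1 h2].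
apply: (eq_trans h1); rewrite /mulpow_fun h2 mulrA -realCM.
by rewrite [_ `^ _ * _]mulrC cutpowM add0r.
Qed.

(** Domains and values of the unbounded operators are detected on truncations. *)
Lemma mulpow_of_cut s u y : (forall N, cut s N u = cut 0 N y) ->
  dom_mulpow s u /\ mulpow s u = y.
Proof.
move=> h; apply: mulpow_ae_eq.
have h1 : {ae haar, forall r, forall N,
    (cutpow s N r)%:C%C * u r = (cutpow 0 N r)%:C%C * y r}.
  apply: ae_foralln => N; apply: (aeS (aeI (cut_ae s N u) (cut_ae 0 N y))) => r [h1 h2].
  by apply: (eq_trans (esym h1)); rewrite h.
apply: (aeS (aeI (@haar_pos_ae R) h1)) => r [r0 hr].
have [N _ /(_ N (leqnn N)) cN] := cutpow_eventually r0.
by have := hr N; rewrite -[s]add0r -(cutpowM 0 s) cN !mul1r add0r => <-.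
Qed.

Lemma cut0_cvg u : (fun N => nsq (u - cut 0 N u)) @ \oo --> (0 : R).
Proof.
pose f_ N (r : T) : \bar R := ((1 - cutpow 0 N r) ^+ 2 * sqmod (u r))%:E.
have mu2 := measurable_sqmod (l2_cmeasurable u).
have mf_ N : measurable_fun [set: T] (f_ N).
  apply/measurable_EFinP; apply: measurable_funM => //; apply: measurable_funX.
  by apply: measurable_funB => //; exact: measurable_cutpow.
have E N : ((nsq (u - cut 0 N u))%:E = \int[haar]_r f_ N r)%E.
  have m : cmeasurable [set: T] (fun r => (1 - cutpow 0 N r)%:C%C * u r).
    apply: cmeasurableM; last exact: l2_cmeasurable.
    by apply: cmeasurableC; apply: measurable_funB => //; exact: measurable_cutpow.
  rewrite (nsqE m).
    by apply: eq_integral => r _; rewrite sqmodM sqmodC.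
  apply: (aeS (aeI (l2B_ae u (cut 0 N u)) (cut_ae 0 N u))) => r [h1 h2].
  by apply: (eq_trans h1); rewrite h2 realCB mulrBl mul1r.
have [] := @dominated_convergence _ _ _ haar _ measurableT f_ (cst 0%E)
  (fun r => (sqmod (u r))%:E) mf_ (measurable_cst _).
- apply: (aeS (@haar_pos_ae R)) => r r0 _; apply: cvg_EFin; first exact: nearW.
  apply: cvg_near_cst; apply: filterS (cutpow_eventually r0) => N /= ->.
  by rewrite subrr expr0n mul0r.
- exact: integrable_sqmod (l2P u).
- apply: aeW => r N _; rewrite /f_ /= lee_fin ger0_norm; last first.
    by rewrite mulr_ge0 ?sqr_ge0 ?sqmod_ge0.
  rewrite ler_piMl ?sqmod_ge0// expr_le1//; last first.
    by rewrite subr_ge0; case/andP: (cutpow0_itv N r).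
  by rewrite gerBl; case/andP: (cutpow0_itv N r).
move=> _ _; rewrite integral0 => h.
rewrite (_ : (fun N => _) = fine \o (fun N => \int[haar]_r f_ N r)%E); first exact: fine_cvg h.
by apply/funext => N; rewrite /= -E.
Qed.

Lemma energyE u : energy u = (\int[haar]_r (sqmod (mulpow_fun (- 2^-1) u r))%:E)%E.
Proof.
have m1 : measurable_fun [set: T] (fun r => (sqmod (u r))%:E).
  by apply/measurable_EFinP; exact: measurable_sqmod (l2_cmeasurable u).
apply: ae_eq_integral => //.
- apply/measurable_EFinP; apply: measurable_funM; first exact: measurable_hdens.
  exact: measurable_sqmod (l2_cmeasurable u).
- by apply/measurable_EFinP; apply: measurable_sqmod; exact: cmeasurable_mulpow.
- apply: (aeS (@haar_pos_ae R)) => r r0 _; congr EFin.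
  rewrite /mulpow_fun sqmodM sqmodC /hdens r0; congr (_ * _).
  rewrite expr2 -powRD; last by apply/implyP => _; rewrite gt_eqF.
  rewrite (_ : - 2^-1 - 2^-1 = -1 :> R); last by field.
  by rewrite powR_inv1// ltW.
Qed.

Lemma energy_dom u : (energy u < +oo)%E -> dom_Dinv u.
Proof.
move=> h; apply/square_integrableE; split; first exact: cmeasurable_mulpow.
by rewrite -energyE.
Qed.

Lemma energy_nsq u : dom_Dinv u -> energy u = (nsq (Dinv u))%:E.
Proof. by move=> h; rewrite energyE (nsqE (cmeasurable_mulpow _ u) (mulpow_ae h)). Qed.

Lemma Dinv_sym u w : dom_Dinv u -> dom_Dinv w ->
  l2dot (Dinv u) w = l2dot u (Dinv w).
Proof.
move=> du dw.
rewrite (l2dotE du (l2P w) (mulpow_ae du)); last exact: aeW.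
rewrite (l2dotE (l2P u) dw _ (mulpow_ae dw)); last exact: aeW.
congr (cintegral haar); apply/funext => r; rewrite /mulpow_fun conjcM mulrCA mulrA.
by rewrite conjc_real.
Qed.

Lemma Dinv_dom_D u : dom_Dinv u -> dom_D (Dinv u).
Proof.
move=> du.
have h : {ae haar, forall r, u r = mulpow_fun 2^-1 (Dinv u) r}.
  apply: (aeS (aeI (@haar_pos_ae R) (mulpow_ae du))) => r [r0 h].
  rewrite /mulpow_fun h /mulpow_fun mulrA -realCM -powRD; last by apply/implyP => _; rewrite gt_eqF.
  by rewrite subrr powRr0 mul1r.
by have [] := mulpow_ae_eq h.
Qed.
End truncated_powers.

(** * Admissibility *)

Section admissibility.
Variable R : realType.
Local Notation T := (measurableTypeR R).
Local Notation haar := (@haar R).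
Local Notation L2pos := (L2pos R).

Lemma cut0_form_cvg (A : L2pos -> L2pos) (u : L2pos) : bounded_op A ->
  ccvg (fun N => l2dot (A (cut 0 N u)) (cut 0 N u)) (l2dot (A u) u).
Proof.
move=> bA; have [lA _] := bA; have [M M0 AM] := bounded_op_nsq bA.
apply: (@ccvg_le _ _ _ (fun N => 4 * M * nsq u * nsq (u - cut 0 N u))); last first.
  rewrite [X in _ --> X](_ : 0 = 4 * M * nsq u * 0 :> R); last by rewrite mulr0.
  by apply: cvgM; [exact: cvg_cst|exact: cut0_cvg].
move=> N; set p := cut 0 N u.
have -> : l2dot (A u) u - l2dot (A p) p = l2dot (A (u - p)) u + l2dot (A p) (u - p).
  by rewrite (linear_lmodB lA) l2dotBl l2dotBr addrA subrK.
apply: le_trans (sqmodD_le _ _) _.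
have -> : 4 * M * nsq u * nsq (u - p) =
  2 * (M * nsq (u - p) * nsq u) + 2 * (M * nsq u * nsq (u - p)) by ring.
apply: lerD; rewrite ler_wpM2l//; apply: le_trans (l2dot_CS _ _) _.
  by rewrite ler_wpM2r ?nsq_ge0.
rewrite ler_wpM2r ?nsq_ge0//; apply: le_trans (AM _) _.
by rewrite ler_wpM2l// nsq_cut0_le.
Qed.

(** Both sides are the trace of [cut s N \o A \o cut s N]. *)
Lemma gram_cut (A : L2pos -> L2pos) (x e : nat -> L2pos) (s : R) N :
  gram A x -> orthonormal_basis e ->
  (\sum_(0 <= j <oo) (nsq (cut s N (x j)))%:E =
   \sum_(0 <= n <oo) (complex.Re (l2dot (A (cut s N (e n))) (cut s N (e n))))%:E)%E.
Proof.
move=> gA onb_e.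
transitivity (\sum_(0 <= j <oo) \sum_(0 <= n <oo)
    (sqmod (l2dot (cut s N (e n)) (x j)))%:E)%E.
  apply: eq_eseriesr => j _; rewrite -(parseval_ereal onb_e).
  apply: eq_eseriesr => n _; congr EFin.
  by rewrite cut_dot l2dotC sqmod_conj.
rewrite nneseries_interchange; last by move=> i j; rewrite lee_fin sqmod_ge0.
by apply: eq_eseriesr => n _; exact: gram_diag.
Qed.

Variables (S : L2pos -> L2pos) (v e : nat -> L2pos).
Hypotheses (bS : bounded_op S) (S0 : positive_op S) (gS : gram S v).
Hypotheses (onb_e : orthonormal_basis e) (S_neq0 : S <> (fun=> 0)).

Let half : R := - 2^-1.

Let energy_v_ge0 j : (0 <= energy (v j))%E. Proof. exact: energy_ge0. Qed.

(** [A] extends [D^-1 S D^-1] and [G] is [D^-1 S].  To see the latter, one tests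
    against truncated vectors: each [v k] can then be replaced by [w k] at the
    price of a bounded factor. *)
Lemma admissible_of_energy : (\sum_(0 <= j <oo) energy (v j) < +oo)%E -> admissible S.
Proof.
move=> fin.
have vd j : dom_Dinv (v j).
  apply: energy_dom; apply: le_lt_trans fin.
  apply: le_trans (@nneseries_lim_ge R (fun j => energy (v j)) xpredT 0 j.+1 _) => //.
  by rewrite big_nat_recr//= leeDr// sume_ge0.
pose w j := Dinv (v j).
have sumw : (\sum_(0 <= j <oo) (nsq (w j))%:E < +oo)%E.
  apply: le_lt_trans fin; rewrite le_eqVlt; apply/orP; left; apply/eqP.
  by apply: eq_eseriesr => j _; exact: esym (energy_nsq (vd j)).
have [gS1 sumv] := gS.
have [A lA Adot] := rank_one_sum sumw sumw.
have gA : gram A w by split.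
have bA := gram_bounded lA gA.
have [G lG Gdot] := rank_one_sum sumv sumw.
have SG phi : dom_Dinv (S phi) /\ Dinv (S phi) = G phi.
  apply: mulpow_of_cut => N; apply: l2dot_extl => z.
  apply: (eq_trans (cut_dot half N (S phi) z)).
  apply: (eq_trans _ (esym (cut_dot 0 N (G phi) z))).
  have wv k : l2dot (w k) (cut 0 N z) = l2dot (v k) (cut half N z).
    by rewrite -(cut_dot half) -(cut_dot 0) (cut_mulpow 0 N (vd k)) add0r.
  apply: (ccvg_unique (gS1 phi (cut half N z))).
  apply: (ccvg_eq _ (Gdot phi (cut 0 N z))) => n.
  by apply: eq_bigr => k _; rewrite wv.
have AE psi : dom_Dinv psi -> A psi = Dinv (S (Dinv psi)).
  move=> dpsi; rewrite (SG _).2; apply: l2dot_extl => z.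
  apply: (ccvg_unique (Adot psi z)).
  apply: (ccvg_eq _ (Gdot (Dinv psi) z)) => n.
  by apply: eq_bigr => k _; rewrite (Dinv_sym dpsi (vd k)).
split; [exact: bS|exact: S_neq0| | |].
- by move=> psi _; case: (SG psi).
- have [_ [M AM]] := bA.
  by exists M => psi dpsi; rewrite -AE.
- by exists A => //; exact: gram_trace_class bA gA onb_e.
Qed.

(** Truncated vectors lie in the domain of [D^-1] and tend to the given ones, so
    the extension [A] of [D^-1 S D^-1] inherits positivity from [S] and is a sum
    of rank-one operators with vectors [w j].  Comparing traces of truncations
    bounds the truncated energies of the [v j] by [\sum_j nsq (w j)], and
    Fatou's lemma removes the truncation. *)
Lemma energy_of_admissible : admissible S -> (\sum_(0 <= j <oo) energy (v j) < +oo)%E.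
Proof.
move=> [_ _ SD _ [A tA AE]].
have [bA _] := tA.
have Adot psi phi : dom_Dinv psi -> dom_Dinv phi ->
    l2dot (A psi) phi = l2dot (S (Dinv psi)) (Dinv phi).
  move=> dpsi dphi; rewrite AE// (Dinv_sym _ dphi)//.
  by apply: SD; exact: Dinv_dom_D.
have A0 : positive_op A.
  move=> psi; pose z N := l2dot (A (cut 0 N psi)) (cut 0 N psi).
  have zc : ccvg z (l2dot (A psi) psi) by exact: cut0_form_cvg.
  have z0 N : 0 <= z N.
    have [d _] := mulpow_cut half N psi.
    by rewrite /z (Adot _ _ d d); exact: S0.
  have {}z0 N : complex.Im (z N) = 0 /\ 0 <= complex.Re (z N).
    by have := z0 N; rewrite lecE => /andP[/eqP/esym].
  rewrite lecE; apply/andP; split.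
    apply/eqP/esym; have := ccvg_Im zc.
    rewrite (_ : (fun N => complex.Im (z N)) = cst 0); last first.
      by apply/funext => N; case: (z0 N).
    by move=> h; rewrite -(cvg_lim (@Rhausdorff R) h) lim_cst.
  by apply: (le_cvg_seq (ccvg_Re zc)) => N; case: (z0 N).
have [w gA] := trace_class_gram tA A0.
have [_ sumw] := gA.
set B := (\sum_(0 <= k <oo) (nsq (w k))%:E)%E in sumw.
have cut_le N : (\sum_(0 <= j <oo) (nsq (cut half N (v j)))%:E <= B)%E.
  apply: (@le_trans _ _ (\sum_(0 <= j <oo) (nsq (cut 0 N (w j)))%:E)%E).
    rewrite le_eqVlt; apply/orP; left; apply/eqP.
    apply: (eq_trans (gram_cut half N gS onb_e)).
    apply: (eq_trans _ (esym (gram_cut 0 N gA onb_e))).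
    apply: eq_eseriesr => n _.
    have [d1 E1] := mulpow_cut half N (e n).
    have {}E1 : Dinv (cut 0 N (e n)) = cut half N (e n) by exact: E1.
    by have := Adot _ _ d1 d1; rewrite E1 => ->.
  apply: lee_nneseries => [j _ _|j _]; first by rewrite lee_fin nsq_ge0.
  by rewrite lee_fin nsq_cut0_le.
apply: le_lt_trans sumw.
apply: lime_le; first by apply: is_cvg_nneseries => j _ _.
(* Fatou is applied to finitely many [j] at a time. *)
apply: nearW => n.
pose g j (r : T) := sqmod (mulpow_fun half (v j) r).
have mg j : measurable_fun [set: T] (g j).
  by apply: measurable_sqmod; exact: cmeasurable_mulpow.
have mgE j : measurable_fun [set: T] (EFin \o g j) by exact/measurable_EFinP.
under eq_bigr do rewrite energyE.
rewrite -ge0_integral_sum//; last by move=> j r _; rewrite lee_fin sqmod_ge0.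
under eq_integral do rewrite sumEFin.
apply: (@fatou_bound _ _ _ haar (fun N r => cutpow 0 N r ^+ 2 * \sum_(0 <= j < n) g j r)).
- move=> N; apply: measurable_funM; last exact: measurable_sum.
  by apply: measurable_funX; exact: measurable_cutpow.
- exact: measurable_sum.
- by move=> N r; rewrite mulr_ge0 ?sqr_ge0// sumr_ge0// => j _; exact: sqmod_ge0.
- by move=> r; rewrite sumr_ge0// => j _; exact: sqmod_ge0.
- apply: (aeS (@haar_pos_ae R)) => r r0; apply: cvg_near_cst.
  by apply: filterS (cutpow_eventually r0) => N /= ->; rewrite expr1n mul1r.
- move=> N; apply: le_trans (cut_le N).
  apply: le_trans (nneseries_lim_ge n _); last by move=> j _ _; rewrite lee_fin nsq_ge0.
  under [leRHS]eq_bigr do rewrite nsq_cut.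
  rewrite -ge0_integral_sum//; last 2 first.
  + move=> j; apply/measurable_EFinP; apply: measurable_funM.
      by apply: measurable_funX; exact: measurable_cutpow.
    exact: measurable_sqmod (l2_cmeasurable _).
  + by move=> j r _; rewrite lee_fin mulr_ge0 ?sqr_ge0 ?sqmod_ge0.
  rewrite le_eqVlt; apply/orP; left; apply/eqP; apply: eq_integral => r _.
  rewrite sumEFin mulr_sumr; congr EFin; apply: eq_bigr => j _.
  by rewrite /g /mulpow_fun sqmodM sqmodC mulrA -exprMn cutpowM add0r.
Qed.
End admissibility.

Theorem theorem5 (R : realType) (S : L2pos R -> L2pos R)
  (S_neq0 : S <> (fun=> 0%R)) (S_ge0 : positive_op S) (S_tc : trace_class S) :
  admissible S <-> L1r_Aff (aff_conv S S).
Proof.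
have [bS [P _ [e onb_e _]]] := S_tc.
have [v gS] := trace_class_gram S_tc S_ge0.
have L1E := L1r_aff_conv bS S_ge0 gS onb_e S_neq0.
split=> h; first by apply/L1E; exact: energy_of_admissible S_ge0 gS onb_e h.
exact: admissible_of_energy bS gS onb_e S_neq0 (iffLR L1E h).
Qed.
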